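(* Let $m\ge 1$ and let $(\pi_\rho,V_\rho)$ be an irreducible unitary representation of $U(m)$ with highest weight $\rho=(\rho^1,\dots,\rho^m)$. Let $w_{\pm i}$ be the conformal weights associated to $\rho$, let $p_{\pm i}$ be the Clifford homomorphisms on $V_\rho$, and let $e_{kl}^q,\tilde e_{kl}^q\in U(\mathfrak{gl}(m,\mathbb{C}))$ and $c_q,\tilde c_q$ be as in the context. Then for all $q\in\mathbb{Z}_{\ge 0}$ and all $k,l\in\{1,\dots,m\}$, $$\sum_{1\le i\le m} w_{+i}^q\,p_{+i}(\epsilon_k)^{\ast}p_{+i}(\epsilon_l)=\pi_{\rho}(\tilde e_{kl}^q)\in\mathrm{End}(V_\rho),\qquad \sum_{1\le i\le m} w_{-i}^q\,p_{-i}(\bar\epsilon_k)^{\ast}p_{-i}(\bar\epsilon_l)=\pi_{\rho}(e_{kl}^q)\in\mathrm{End}(V_\rho).$$ Furthermore, for all $q\in\mathbb{Z}_{\ge 0}$, $$\sum_{i,k} w_{+i}^q\,p_{+i}(\epsilon_k)^{\ast}p_{+i}(\epsilon_k)=\pi_{\rho}(\tilde c_q),\qquad \sum_{i,k} w_{-i}^q\,p_{-i}(\bar\epsilon_k)^{\ast}p_{-i}(\bar\epsilon_k)=\pi_{\rho}(c_q).$$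
   Context: Representations. Irreducible unitary representations $(\pi_\rho,V_\rho)$ of $U(m)$ are labelled by their highest weights $\rho=(\rho^1,\dots,\rho^m)\in\mathbb{Z}^m$ with $\rho^1\ge\cdots\ge\rho^m$ (''dominant integral''); weights are the simultaneous eigenvalues of $e_{11},\dots,e_{mm}$, where $e_{kl}$ is the $m\times m$ matrix with $1$ in place $(k,l)$ and $0$ elsewhere. $\pi_\rho$ also denotes the induced complex representation of $\mathfrak{gl}(m,\mathbb{C})=\mathfrak{u}(m)\otimes\mathbb{C}$ and of its universal enveloping algebra $U(\mathfrak{gl}(m,\mathbb{C}))$. $\mathbb{C}^m$ is the natural representation with standard unitary basis $\epsilon_1,\dots,\epsilon_m$, and $\overline{\mathbb{C}^m}$ its complex conjugate representation with basis $\bar\epsilon_1,\dots,\bar\epsilon_m$. Clifford homomorphisms. Let $\mu_i\in\mathbb{Z}^m$ be the $i$-th standard basis vector. One has multiplicity-free orthogonal decompositions $V_\rho\otimes\mathbb{C}^m=\bigoplus_{i=1}^m V_{\rho+\mu_i}$ and $V_\rho\otimes\overline{\mathbb{C}^m}=\bigoplus_{i=1}^m V_{\rho-\mu_i}$, where $V_{\rho\pm\mu_i}:=\{0\}$ if $\rho\pm\mu_i$ is not dominant integral. Let $\Pi_{\pm i}$ be the orthogonal projection onto $V_{\rho\pm\mu_i}$. For $u\in\mathbb{C}^m$, $\bar u\in\overline{\mathbb{C}^m}$, define $p_{+i}(u):V_\rho\to V_{\rho+\mu_i}$, $\phi\mapsto\Pi_{+i}(\phi\otimes u)$ and $p_{-i}(\bar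 u):V_\rho\to V_{\rho-\mu_i}$, $\phi\mapsto\Pi_{-i}(\phi\otimes\bar u)$; ${}^{\ast}$ denotes the adjoint. Conformal weights associated to $\rho$: $w_{+i}:=-\rho^i+i-1$ and $w_{-i}:=\rho^i+m-i$. Enveloping algebra elements: $e_{kl}^0:=\tilde e_{kl}^0:=\delta_{kl}$ and for $q\ge1$ $$e_{kl}^q:=\sum_{1\le i_1,\dots,i_{q-1}\le m}e_{ki_1}e_{i_1i_2}\cdots e_{i_{q-1}l},\qquad \tilde e_{kl}^q:=(-1)^q\sum_{1\le i_1,\dots,i_{q-1}\le m}e_{i_1k}e_{i_2i_1}\cdots e_{li_{q-1}}$$ (so $e_{kl}^1=e_{kl}$, $\tilde e_{kl}^1=-e_{lk}$). Put $c_q:=\sum_k e_{kk}^q$ and $\tilde c_q:=\sum_k\tilde e_{kk}^q$; these are central. Convention: $0^0=1$. *)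

(* Defs.v *)
From HB Require Import structures.
From mathcomp Require Import all_boot all_order all_algebra.
From mathcomp Require Import all_classical all_reals all_analysis.
From mathcomp Require Import complex mxtens.

Set Implicit Arguments.
Unset Strict Implicit.
Unset Printing Implicit Defensive.

Import Order.TTheory GRing.Theory Num.Theory.
Import numFieldNormedType.Exports.
Local Open Scope classical_set_scope.
Local Open Scope quotient_scope.
Local Open Scope ring_scope.
Local Open Scope complex_scope.
Local Open Scope sesquilinear_scope.

(* the topology of C defined by the modulus *)
HB.instance Definition _ (R : realType) := NormedModule.copy R[i] (R[i])^o.

(** * The universal enveloping algebra U(gl(m, K))

  It is presented by generators and relations: noncommutative polynomials
  ([uterm]) in the elements of gl(m, K), modulo the congruence [ugl_eq]
  generated by the axioms of associative unital K-algebras, the linearity of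
  the generators and [X, Y] = X Y - Y X. *)

Section Terms.
Variables (K : fieldType) (m : nat).

Inductive uterm : Type :=
  | UScal of K
  | UGen of 'M[K]_m
  | UAdd of uterm & uterm
  | UMul of uterm & uterm.

HB.instance Definition _ := gen_eqMixin uterm.
HB.instance Definition _ := gen_choiceMixin uterm.

Inductive ugl_eq : uterm -> uterm -> Prop :=
  | UeqRefl x : ugl_eq x x
  | UeqSym x y : ugl_eq x y -> ugl_eq y x
  | UeqTrans x y z : ugl_eq x y -> ugl_eq y z -> ugl_eq x z
  | UeqAdd x x' y y' :
      ugl_eq x x' -> ugl_eq y y' -> ugl_eq (UAdd x y) (UAdd x' y')
  | UeqMul x x' y y' :
      ugl_eq x x' -> ugl_eq y y' -> ugl_eq (UMul x y) (UMul x' y')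
  | UeqAddA x y z : ugl_eq (UAdd x (UAdd y z)) (UAdd (UAdd x y) z)
  | UeqAddC x y : ugl_eq (UAdd x y) (UAdd y x)
  | UeqAdd0 x : ugl_eq (UAdd (UScal 0) x) x
  | UeqAddN x : ugl_eq (UAdd (UMul (UScal (- 1)) x) x) (UScal 0)
  | UeqMulA x y z : ugl_eq (UMul x (UMul y z)) (UMul (UMul x y) z)
  | UeqMul1l x : ugl_eq (UMul (UScal 1) x) x
  | UeqMul1r x : ugl_eq (UMul x (UScal 1)) x
  | UeqMulDl x y z :
      ugl_eq (UMul (UAdd x y) z) (UAdd (UMul x z) (UMul y z))
  | UeqMulDr x y z :
      ugl_eq (UMul x (UAdd y z)) (UAdd (UMul x y) (UMul x z))
  | UeqScalD a b : ugl_eq (UScal (a + b)) (UAdd (UScal a) (UScal b))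
  | UeqScalM a b : ugl_eq (UScal (a * b)) (UMul (UScal a) (UScal b))
  | UeqScalC a x : ugl_eq (UMul (UScal a) x) (UMul x (UScal a))
  | UeqGenD X Y : ugl_eq (UGen (X + Y)) (UAdd (UGen X) (UGen Y))
  | UeqGenZ a X : ugl_eq (UGen (a *: X)) (UMul (UScal a) (UGen X))
  | UeqLie X Y :
      ugl_eq (UGen (X *m Y - Y *m X))
             (UAdd (UMul (UGen X) (UGen Y))
                   (UMul (UScal (- 1)) (UMul (UGen Y) (UGen X)))).

Definition ugl_eqb : rel uterm := fun x y => `[< ugl_eq x y >].

Lemma ugl_eqb_equiv : equiv_class_of ugl_eqb.
Proof.
split=> [x|x y|y x z].
- exact/asboolP/UeqRefl.
- by apply/asboolP/asboolP => ?; exact: UeqSym.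
- by move=> /asboolP xy /asboolP yz; apply/asboolP/(UeqTrans xy).
Qed.

Canonical ugl_equiv := EquivRelPack ugl_eqb_equiv.

Definition ugl := {eq_quot ugl_equiv}.

HB.instance Definition _ := Choice.on ugl.
HB.instance Definition _ := EqQuotient.on ugl.

Lemma ugl_piP x y : ugl_eq x y -> \pi_ugl x = \pi_ugl y.
Proof. by move=> xy; apply/eqmodP/asboolP. Qed.

Lemma ugl_reprP x : ugl_eq (repr (\pi_ugl x)) x.
Proof. by apply/asboolP; move/eqmodP: (reprK (\pi_ugl x)). Qed.

Definition ugl_scal (a : K) : ugl := \pi_ugl (UScal a).
Definition ugl_gen (X : 'M[K]_m) : ugl := \pi_ugl (UGen X).
Definition ugl_add (x y : ugl) : ugl := \pi_ugl (UAdd (repr x) (repr y)).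
Definition ugl_mul (x y : ugl) : ugl := \pi_ugl (UMul (repr x) (repr y)).
Definition ugl_opp (x : ugl) : ugl := ugl_mul (ugl_scal (- 1)) x.

Lemma ugl_addE x y : ugl_add (\pi_ugl x) (\pi_ugl y) = \pi_ugl (UAdd x y).
Proof. by apply/ugl_piP/UeqAdd; exact: ugl_reprP. Qed.

Lemma ugl_mulE x y : ugl_mul (\pi_ugl x) (\pi_ugl y) = \pi_ugl (UMul x y).
Proof. by apply/ugl_piP/UeqMul; exact: ugl_reprP. Qed.

Lemma ugl_ind (P : ugl -> Prop) : (forall x, P (\pi_ugl x)) -> forall x, P x.
Proof. by move=> Px x; rewrite -[x]reprK. Qed.

Lemma ugl_addA : associative ugl_add.
Proof.
elim/ugl_ind=> x; elim/ugl_ind=> y; elim/ugl_ind=> z.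
by rewrite !ugl_addE; exact/ugl_piP/UeqAddA.
Qed.

Lemma ugl_addC : commutative ugl_add.
Proof.
elim/ugl_ind=> x; elim/ugl_ind=> y.
by rewrite !ugl_addE; exact/ugl_piP/UeqAddC.
Qed.

Lemma ugl_add0 : left_id (ugl_scal 0) ugl_add.
Proof. by elim/ugl_ind=> x; rewrite ugl_addE; exact/ugl_piP/UeqAdd0. Qed.

Lemma ugl_addN : left_inverse (ugl_scal 0) ugl_opp ugl_add.
Proof.
by elim/ugl_ind=> x; rewrite /ugl_opp ugl_mulE ugl_addE; exact/ugl_piP/UeqAddN.
Qed.

HB.instance Definition _ :=
  GRing.isZmodule.Build ugl ugl_addA ugl_addC ugl_add0 ugl_addN.

Lemma ugl_mulA : associative ugl_mul.
Proof.
elim/ugl_ind=> x; elim/ugl_ind=> y; elim/ugl_ind=> z.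
by rewrite !ugl_mulE; exact/ugl_piP/UeqMulA.
Qed.

Lemma ugl_mul1l : left_id (ugl_scal 1) ugl_mul.
Proof. by elim/ugl_ind=> x; rewrite ugl_mulE; exact/ugl_piP/UeqMul1l. Qed.

Lemma ugl_mul1r : right_id (ugl_scal 1) ugl_mul.
Proof. by elim/ugl_ind=> x; rewrite ugl_mulE; exact/ugl_piP/UeqMul1r. Qed.

Lemma ugl_mulDl : left_distributive ugl_mul ugl_add.
Proof.
elim/ugl_ind=> x; elim/ugl_ind=> y; elim/ugl_ind=> z.
by rewrite !(ugl_addE, ugl_mulE); exact/ugl_piP/UeqMulDl.
Qed.

Lemma ugl_mulDr : right_distributive ugl_mul ugl_add.
Proof.
elim/ugl_ind=> x; elim/ugl_ind=> y; elim/ugl_ind=> z.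
by rewrite !(ugl_addE, ugl_mulE); exact/ugl_piP/UeqMulDr.
Qed.

Fixpoint uterm_counit (x : uterm) : K :=
  match x with
  | UScal a => a
  | UGen _ => 0
  | UAdd x y => uterm_counit x + uterm_counit y
  | UMul x y => uterm_counit x * uterm_counit y
  end.

Lemma uterm_counit_eq x y : ugl_eq x y -> uterm_counit x = uterm_counit y.
Proof.
elim=> //=.
- by move=> ? ? ? _ -> _ ->.
- by move=> ? ? ? ? _ -> _ ->.
- by move=> ? ? ? ? _ -> _ ->.
- by move=> *; rewrite addrA.
- by move=> *; rewrite addrC.
- by move=> *; rewrite add0r.
- by move=> *; rewrite mulN1r addNr.
- by move=> *; rewrite mulrA.
- by move=> *; rewrite mul1r.
- by move=> *; rewrite mulr1.
- by move=> *; rewrite mulrDl.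
- by move=> *; rewrite mulrDr.
- by move=> *; rewrite mulrC.
- by rewrite addr0.
- by move=> *; rewrite mulr0.
- by move=> *; rewrite !mulr0 addr0.
Qed.

Lemma ugl_one_neq0 : ugl_scal 1 != 0 :> ugl.
Proof.
apply/eqP => /eqmodP/asboolP/uterm_counit_eq/= /eqP.
by rewrite (negbTE (oner_neq0 K)).
Qed.

HB.instance Definition _ := GRing.Zmodule_isNzRing.Build ugl
  ugl_mulA ugl_mul1l ugl_mul1r ugl_mulDl ugl_mulDr ugl_one_neq0.

Definition ugl_scale (a : K) (x : ugl) : ugl := ugl_scal a * x.

Lemma ugl_scaleA a b x :
  ugl_scale a (ugl_scale b x) = ugl_scale (a * b) x.
Proof.
rewrite /ugl_scale mulrA; congr (_ * _).
rewrite /GRing.mul/= ugl_mulE; exact/ugl_piP/UeqSym/UeqScalM.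
Qed.

Lemma ugl_scale1 : left_id 1 ugl_scale.
Proof. exact: mul1r. Qed.

Lemma ugl_scaleDr : right_distributive ugl_scale +%R.
Proof. by move=> a x y; exact: mulrDr. Qed.

Lemma ugl_scaleDl x : {morph ugl_scale^~ x : a b / a + b}.
Proof.
move=> a b; rewrite /ugl_scale -mulrDl; congr (_ * _).
by rewrite /GRing.add/= ugl_addE; exact/ugl_piP/UeqScalD.
Qed.

HB.instance Definition _ := GRing.Zmodule_isLmodule.Build K ugl
  ugl_scaleA ugl_scale1 ugl_scaleDr ugl_scaleDl.

Lemma ugl_scaleAl (a : K) (x y : ugl) : a *: (x * y) = (a *: x) * y.
Proof. exact: mulrA. Qed.

HB.instance Definition _ := GRing.Lmodule_isLalgebra.Build K ugl ugl_scaleAl.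

Lemma ugl_scaleAr (a : K) (x y : ugl) : a *: (x * y) = x * (a *: y).
Proof.
rewrite /GRing.scale/= /ugl_scale !mulrA; congr (_ * _).
elim/ugl_ind: x => x.
by rewrite /GRing.mul/= !ugl_mulE; exact/ugl_piP/UeqScalC.
Qed.

HB.instance Definition _ := GRing.Lalgebra_isAlgebra.Build K ugl ugl_scaleAr.

Fixpoint uterm_eval n (f : 'M[K]_m -> 'M[K]_n) (x : uterm) : 'M[K]_n :=
  match x with
  | UScal a => a%:M
  | UGen X => f X
  | UAdd x y => uterm_eval f x + uterm_eval f y
  | UMul x y => uterm_eval f x *m uterm_eval f y
  end.

(** The extension to U(gl(m, K)) of a representation [f] of gl(m, K); as
  [env_ext_pi] shows, it does not depend on the representative [repr x]. *)
Definition env_ext n (f : 'M[K]_m -> 'M[K]_n) (x : ugl) : 'M[K]_n :=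
  uterm_eval f (repr x).

Lemma uterm_eval_eq n (f : 'M[K]_m -> 'M[K]_n) x y :
    (forall X Y, f (X + Y) = f X + f Y) ->
    (forall a X, f (a *: X) = a *: f X) ->
    (forall X Y, f (X *m Y - Y *m X) = f X *m f Y - f Y *m f X) ->
  ugl_eq x y -> uterm_eval f x = uterm_eval f y.
Proof.
move=> fD fZ fL; elim=> //=.
- by move=> ? ? ? _ -> _ ->.
- by move=> ? ? ? ? _ -> _ ->.
- by move=> ? ? ? ? _ -> _ ->.
- by move=> *; rewrite addrA.
- by move=> *; rewrite addrC.
- by move=> *; rewrite raddf0 add0r.
- by move=> *; rewrite mul_scalar_mx scaleN1r addNr raddf0.
- by move=> *; rewrite mulmxA.
- by move=> *; rewrite mul1mx.
- by move=> *; rewrite mulmx1.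
- by move=> *; rewrite mulmxDl.
- by move=> *; rewrite mulmxDr.
- by move=> *; rewrite raddfD.
- by move=> *; rewrite scalar_mxM.
- by move=> *; rewrite scalar_mxC.
- by move=> *; rewrite fZ mul_scalar_mx.
- by move=> *; rewrite fL mul_scalar_mx scaleN1r.
Qed.

Lemma env_ext_pi n (f : 'M[K]_m -> 'M[K]_n) x :
    (forall X Y, f (X + Y) = f X + f Y) ->
    (forall a X, f (a *: X) = a *: f X) ->
    (forall X Y, f (X *m Y - Y *m X) = f X *m f Y - f Y *m f X) ->
  env_ext f (\pi_ugl x) = uterm_eval f x.
Proof. by move=> fD fZ fL; apply: uterm_eval_eq => //; exact: ugl_reprP. Qed.

Definition ugl_e (k l : 'I_m) : ugl := ugl_gen (delta_mx k l).

(* the j-th entry of k, i_1, ..., i_{q-1}, l *)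
Definition vertex (k : 'I_m) (t : seq 'I_m) (l : 'I_m) (j : nat) : 'I_m :=
  nth k (k :: rcons t l) j.

Definition e_pow (q : nat) (k l : 'I_m) : ugl :=
  if q is p.+1 then
    \sum_(t : p.-tuple 'I_m)
      \prod_(j < p.+1) ugl_e (vertex k t l j) (vertex k t l j.+1)
  else (k == l)%:R.

Definition etilde_pow (q : nat) (k l : 'I_m) : ugl :=
  if q is p.+1 then
    (- 1) ^+ p.+1 *
    \sum_(t : p.-tuple 'I_m)
      \prod_(j < p.+1) ugl_e (vertex k t l j.+1) (vertex k t l j)
  else (k == l)%:R.

Definition c_pow (q : nat) : ugl := \sum_k e_pow q k k.
Definition ctilde_pow (q : nat) : ugl := \sum_k etilde_pow q k k.

End Terms.

(** * Unitary representations of U(m)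

  A representation is given by its matrices in an orthonormal basis, so the
  representation space is C^N = ['cV[R[i]]_N] with its standard hermitian
  product.  Only the values on unitary matrices are meaningful. *)

Section Representations.
Variables (R : realType) (m : nat).
Local Notation C := (R[i]).

Definition unitary_rep N (pr : 'M[C]_m -> 'M[C]_N) : Prop :=
  [/\ pr 1%:M = 1%:M,
      forall g h, g \is unitarymx -> h \is unitarymx ->
        pr (g *m h) = pr g *m pr h,
      forall g, g \is unitarymx -> pr g \is unitarymx &
      {within [set g | g \is unitarymx], continuous pr}].

Definition invariant_sub N (pr : 'M[C]_m -> 'M[C]_N)
    (W : {vspace 'cV[C]_N}) : Prop :=
  forall g v, g \is unitarymx -> v \in W -> pr g *m v \in W.

Definition irreducible_sub N (pr : 'M[C]_m -> 'M[C]_N)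
    (W : {vspace 'cV[C]_N}) : Prop :=
  [/\ W <> 0%VS, invariant_sub pr W &
      forall U : {vspace 'cV[C]_N},
        invariant_sub pr U -> (U <= W)%VS -> U = 0%VS \/ U = W].

Definition irreducible_rep N (pr : 'M[C]_m -> 'M[C]_N) : Prop :=
  irreducible_sub pr fullv.

Definition expmx (X : 'M[C]_m) : 'M[C]_m :=
  limn (series (fun k : nat => (k`!%:R : C)^-1 *: X ^+ k)).

(** The differential of a representation, for X in u(m). *)
Definition diff_rep N (pr : 'M[C]_m -> 'M[C]_N) (X : 'M[C]_m) : 'M[C]_N :=
  lim ((t^-1)%:C *: (pr (expmx (t%:C *: X)) - pr 1%:M) @[t --> (0 : R)^']).

(** Its complex linear extension to gl(m, C): Z is decomposed as X + 'i Y with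
  X and Y skew-hermitian. *)
Definition gl_rep N (pr : 'M[C]_m -> 'M[C]_N) (Z : 'M[C]_m) : 'M[C]_N :=
  diff_rep pr (2%:R^-1 *: (Z - Z ^t*)) +
  'i *: diff_rep pr ((2%:R * 'i)^-1 *: (Z + Z ^t*)).

Definition ugl_rep N (pr : 'M[C]_m -> 'M[C]_N) : ugl C m -> 'M[C]_N :=
  env_ext (gl_rep pr).

Definition weight_vector N (pr : 'M[C]_m -> 'M[C]_N) (lam : 'I_m -> int)
    (v : 'cV[C]_N) : Prop :=
  v <> 0 /\ forall k, gl_rep pr (delta_mx k k) *m v = (lam k)%:~R *: v.

(** [lam] is the highest weight of the irreducible subrepresentation [W]: it is
  the weight of a vector killed by the positive root vectors. *)
Definition highest_weight N (pr : 'M[C]_m -> 'M[C]_N)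
    (W : {vspace 'cV[C]_N}) (lam : 'I_m -> int) : Prop :=
  exists v, [/\ v \in W, weight_vector pr lam v &
    forall k l : 'I_m, (k < l)%N -> gl_rep pr (delta_mx k l) *m v = 0].

Definition dominant (lam : 'I_m -> int) : bool :=
  [forall i : 'I_m, forall j : 'I_m, (i <= j)%N ==> (lam j <= lam i)].

(** The sum of the irreducible subrepresentations of highest weight [lam]. *)
Definition isotypic N (pr : 'M[C]_m -> 'M[C]_N) (lam : 'I_m -> int) :
    set 'cV[C]_N :=
  [set v | exists (s : nat) (W : 'I_s -> {vspace 'cV[C]_N}),
     (forall j, irreducible_sub pr (W j) /\ highest_weight pr (W j) lam) /\
     v \in (\sum_j W j)%VS].

(** In a multiplicity-free representation, the isotypic component is the unique
  subrepresentation of highest weight [lam]. *)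
Definition component N (pr : 'M[C]_m -> 'M[C]_N) (lam : 'I_m -> int) :
    set 'cV[C]_N :=
  if dominant lam then isotypic pr lam else [set 0].

Definition orth_proj N (S : set 'cV[C]_N) : 'M[C]_N :=
  xget 0 [set P | forall v, S (P *m v) /\
                  forall w, S w -> w ^t* *m (v - P *m v) = 0].

(** * Clifford homomorphisms

  V (x) C^m is C^(N * m), via the Kronecker product [*t].  The conjugate of C^m
  is C^m with the conjugate action, a vector being represented by its
  coordinates in the basis of the conjugates of the standard basis vectors. *)

Definition tens N (phi : 'cV[C]_N) (u : 'cV[C]_m) : 'cV[C]_(N * m) := phi *t u.

Definition tens_rep N (pr : 'M[C]_m -> 'M[C]_N) (g : 'M[C]_m) :
  'M[C]_(N * m) := pr g *t g.

Definition tens_conj_rep N (pr : 'M[C]_m -> 'M[C]_N) (g : 'M[C]_m) :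
  'M[C]_(N * m) := pr g *t map_mx Num.conj g.

Definition eps (k : 'I_m) : 'cV[C]_m := delta_mx k 0.
Definition conj_vec (u : 'cV[C]_m) : 'cV[C]_m := map_mx Num.conj u.

Definition mu (i : 'I_m) : 'I_m -> int := fun j => (j == i)%:R.

Definition Pi_plus N (pr : 'M[C]_m -> 'M[C]_N) (rho : 'I_m -> int) (i : 'I_m) :
    'M[C]_(N * m) :=
  orth_proj (component (tens_rep pr) (fun j => rho j + mu i j)).

Definition Pi_minus N (pr : 'M[C]_m -> 'M[C]_N) (rho : 'I_m -> int) (i : 'I_m) :
    'M[C]_(N * m) :=
  orth_proj (component (tens_conj_rep pr) (fun j => rho j - mu i j)).

(** The matrix of phi |-> P (phi (x) u), whose columns are the images of the
  basis vectors.  Its codomain is the whole tensor product rather than the range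
  of P; as this range carries the restricted hermitian product, the composite of
  such a map with the adjoint of another one does not depend on this choice. *)
Definition clifford N (P : 'M[C]_(N * m)) (u : 'cV[C]_m) : 'M[C]_(N * m, N) :=
  \matrix_(a, b) (P *m tens (delta_mx b 0) u) a 0.

Definition p_plus N (pr : 'M[C]_m -> 'M[C]_N) (rho : 'I_m -> int) (i : 'I_m)
    (u : 'cV[C]_m) := clifford (Pi_plus pr rho i) u.

Definition p_minus N (pr : 'M[C]_m -> 'M[C]_N) (rho : 'I_m -> int) (i : 'I_m)
    (ubar : 'cV[C]_m) := clifford (Pi_minus pr rho i) ubar.

(** Conformal weights; [i : 'I_m] is counted from 0, so that the index of the
  usual formulas - rho^i + i - 1 and rho^i + m - i is [i.+1]. *)
Definition w_plus (rho : 'I_m -> int) (i : 'I_m) : int :=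
  - rho i + (i.+1)%:Z - 1.
Definition w_minus (rho : 'I_m -> int) (i : 'I_m) : int :=
  rho i + m%:Z - (i.+1)%:Z.

End Representations.

(* Main.v *)
(** The block matrix M = (- e_lk) on V_rho (x) C^m satisfies
  Casimir (V_rho (x) C^m) = Casimir (V_rho) + m - 2 M, so M is scalar on every
  irreducible summand.  The last nonzero component of a highest weight vector of
  V_rho (x) C^m is a highest weight vector of V_rho, at which M is the conformal
  weight w_{+i}; hence the summands have highest weights rho + mu_i and M acts on
  them by w_{+i}.  These numbers are distinct, so M = sum_i w_{+i} Pi_{+i} and the
  blocks of M^q = sum_i w_{+i}^q Pi_{+i} are the elements e~^q_kl.  For the
  conjugate representation the same holds with the block matrix (e_kl) and the
  first nonzero component.

  To pass from the group to the Lie algebra, a continuous unitary representation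
  is shown to be Lipschitz at 1 (small powers argument), which makes its
  one-parameter subgroups differentiable and their generators additive. *)

Require Import Defs.
From HB Require Import structures.
From mathcomp Require Import all_boot all_order all_algebra.
From mathcomp Require Import all_classical all_reals all_analysis.
From mathcomp Require Import complex mxtens.
From mathcomp Require Import zify ring lra.

Import Order.TTheory GRing.Theory Num.Theory.
Import numFieldNormedType.Exports Normc.
Local Open Scope ring_scope.
Local Open Scope complex_scope.
Local Open Scope sesquilinear_scope.

Set Implicit Arguments.
Unset Strict Implicit.
Unset Printing Implicit Defensive.

(** In both cases [M] is minus the split Casimir operator, the sum over a, b of pi(e_ab) (x)
    tau(e_ba), where tau is the action on the second factor. This is where the cross term [2 M]
    comes from; the constant [m] is the Casimir eigenvalue of C^m and of its conjugate. Composing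
    block operators is matrix multiplication with entries in End(V), which keeps the noncommuting
    factors in order, so the blocks of a power of [M] are exactly the path sums that define the
    enveloping algebra elements. The statement speaks of subspaces invariant under the group, while
    [M] belongs to the Lie algebra, so invariance is carried both ways: downwards by differentiating
    (1 - P) pi(g) P = 0, upwards because the orthogonal projector on a stable subspace commutes with
    the Lie algebra action and exponentials fill U(m). A [component] is a mere set of vectors and
    [orth_proj] a choice. Identifying the components with eigenspaces of one hermitian operator
    yields subspaces, orthogonality and projectors together; at a non-dominant weight the eigenspace
    is zero. *)

(* Working over this name rather than over [R[i]] itself makes every matrix
   operation use the structure of a [numClosedFieldType]; with the several other
   structures of [R[i]] in play, unification does not terminate in practice. *)
Definition cplx (R : realType) : numClosedFieldType := R[i].

Definition rc (R : realType) (t : R) : cplx R := t%:C.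
Notation "t %:c" := (rc t) (at level 1, left associativity, format "t %:c").

HB.instance Definition _ (R : realType) :=
  GRing.RMorphism.copy (@rc R) (real_complex R).

Lemma rcM (R : realType) (s t : R) : (s * t)%:c = s%:c * t%:c.
Proof. exact: rmorphM. Qed.

Definition imag (R : realType) (t : R) : cplx R := 0 +i* t.

HB.lock Definition udiag (C : numClosedFieldType) n (P : 'M[C]_n)
    (d : 'rV[C]_n) : 'M[C]_n := P ^t* *m diag_mx d *m P.

Lemma scale_lincomb (K : pzRingType) (V : lmodType K) (a s t : K) (A B : V) :
  a *: (s *: A - t *: B) = (a * s) *: A - (a * t) *: B.
Proof. by rewrite scalerBr !scalerA. Qed.

Lemma mulmx_lincomb (K : comPzRingType) p q r s (A : 'M[K]_(p, q))
    (B : 'M[K]_(r, s)) (D E : 'M[K]_(q, r)) (c : K) :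
  A *m (D + c *: E) *m B = A *m D *m B + c *: (A *m E *m B).
Proof. by rewrite mulmxDr mulmxDl -scalemxAr -scalemxAl. Qed.

(** * Adjoints and unitary diagonalisation *)

Section UnitaryDiag.
Local Close Scope complex_scope.
Variable C : numClosedFieldType.

Lemma unitaryV n (g : 'M[C]_n) : g \is unitarymx -> g ^t* *m g = 1%:M.
Proof. by rewrite -trmxC_unitary => /unitarymxP; rewrite trmxCK. Qed.

Lemma adj_mul p q r (A : 'M[C]_(p, q)) (B : 'M[C]_(q, r)) :
  (A *m B) ^t* = B ^t* *m A ^t*.
Proof. by rewrite trmx_mul map_mxM. Qed.

Lemma adjD p q (A B : 'M[C]_(p, q)) : (A + B) ^t* = A ^t* + B ^t*.
Proof. by rewrite linearD map_mxD. Qed.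

Lemma adjN p q (A : 'M[C]_(p, q)) : (- A) ^t* = - A ^t*.
Proof. by rewrite linearN map_mxN. Qed.

Lemma adjB p q (A B : 'M[C]_(p, q)) : (A - B) ^t* = A ^t* - B ^t*.
Proof. by rewrite adjD adjN. Qed.

Lemma adjZ p q (a : C) (A : 'M[C]_(p, q)) : (a *: A) ^t* = a^* *: A ^t*.
Proof. by apply/matrixP => i j; rewrite !mxE rmorphM. Qed.

Lemma adj1 n : (1%:M : 'M[C]_n) ^t* = 1%:M.
Proof. by rewrite trmx1 map_mx1. Qed.

Lemma adj0 p q : (0 : 'M[C]_(p, q)) ^t* = 0.
Proof. by rewrite trmx0 map_mx0. Qed.

Lemma adj_sum p q I (r : seq I) P (F : I -> 'M[C]_(p, q)) :
  (\sum_(i <- r | P i) F i) ^t* = \sum_(i <- r | P i) (F i) ^t*.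
Proof. by elim/big_rec2: _ => [|i x y _ <-]; rewrite ?adj0 ?adjD. Qed.

Variable n : nat.
Implicit Types (P A g : 'M[C]_n) (d : 'rV[C]_n).

(** Iterated, it bounds the displacement of [A] under conjugation by a power of [g] through the
    displacement under [g] itself. *)
Lemma conj_telescope P g A : (P *m g) *m A *m (P *m g) ^t* - A =
  P *m (g *m A *m g ^t* - A) *m P ^t* + (P *m A *m P ^t* - A).
Proof. by rewrite adj_mul mulmxBr mulmxBl !mulmxA addrA subrK. Qed.

Lemma unitary_mul_adj P g :
  P \is unitarymx -> g \is unitarymx -> P *m g ^t* \is unitarymx.
Proof. by move=> Pu gu; rewrite mul_unitarymx // trmxC_unitary. Qed.

Lemma udiagE P d i j : udiag P d i j = \sum_a ((P a i)^* * P a j) * d 0 a.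
Proof.
rewrite unlock mxE; apply: eq_bigr => a _.
by rewrite mul_mx_diag !mxE mulrAC.
Qed.

Lemma udiagM P d e : P \is unitarymx ->
  udiag P d *m udiag P e = udiag P (\row_j (d 0 j * e 0 j)).
Proof.
move=> Pu; rewrite unlock !mulmxA; congr (_ *m _).
rewrite -[_ *m P *m _]mulmxA (unitarymxP Pu) mulmx1 -mulmxA.
by rewrite mulmx_diag.
Qed.

Lemma udiag1 P : P \is unitarymx -> udiag P (const_mx 1) = 1%:M.
Proof. by move=> Pu; rewrite unlock diag_const_mx mulmx1 unitaryV. Qed.

Lemma udiag_exp P d k : P \is unitarymx ->
  (udiag P d) ^+ k = udiag P (\row_j d 0 j ^+ k).
Proof.
move=> Pu; elim: k => [|k IHk].
  rewrite expr0 -[LHS](udiag1 Pu); congr udiag.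
  by apply/rowP => j; rewrite !mxE expr0.
rewrite exprS IHk -[_ * _]/(_ *m _) udiagM //; congr udiag.
by apply/rowP => j; rewrite !mxE exprS.
Qed.

Lemma udiag_adj P d : (udiag P d) ^t* = udiag P (map_mx Num.conj d).
Proof.
by rewrite unlock !adj_mul trmxCK mulmxA tr_diag_mx map_diag_mx.
Qed.

Lemma udiagZ P a d : a *: udiag P d = udiag P (a *: d).
Proof. by rewrite unlock linearZ -scalemxAr -scalemxAl. Qed.

Lemma udiagB P d e : udiag P d - udiag P e = udiag P (d - e).
Proof. by rewrite unlock linearB mulmxBr mulmxBl. Qed.

Lemma udiag_inj P d e : P \is unitarymx -> udiag P d = udiag P e -> d = e.
Proof.
move=> Pu /(congr1 (fun X => P *m X *m P ^t*)).
rewrite unlock !mulmxA (unitarymxP Pu) !mul1mx.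
rewrite -!mulmxA (unitarymxP Pu) !mulmx1 => /matrixP de.
by apply/rowP => j; have := de j j; rewrite !mxE eqxx !mulr1n.
Qed.

Lemma udiag_conj P g d : udiag (P *m g ^t*) d = g *m udiag P d *m g ^t*.
Proof. by rewrite unlock adj_mul trmxCK !mulmxA. Qed.

Lemma normal_udiag A : A *m A ^t* = A ^t* *m A ->
  exists P d, P \is unitarymx /\ A = udiag P d.
Proof.
move=> /normalmxP/orthomx_spectralP AE.
exists (spectralmx A), (spectral_diag A).
have Pu := spectral_unitarymx A.
by rewrite unlock -invmx_unitary.
Qed.

Lemma skew_udiag A : A ^t* = - A -> exists P d,
  [/\ P \is unitarymx, A = udiag P d & forall j, (d 0 j)^* = - d 0 j].
Proof.
move=> skewA; have [|P [d [Pu AE]]] := normal_udiag (A := A).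
  by rewrite skewA mulmxN mulNmx.
exists P, d; split=> // j.
have : udiag P (map_mx Num.conj d) = udiag P (-1 *: d).
  by rewrite -udiag_adj -udiagZ -AE skewA scaleN1r.
by move/(udiag_inj Pu)/rowP/(_ j); rewrite !mxE mulN1r.
Qed.

Lemma unitary_udiag g : g \is unitarymx -> exists P d,
  [/\ P \is unitarymx, g = udiag P d & forall j, d 0 j * (d 0 j)^* = 1].
Proof.
move=> gu; have [|P [d [Pu gE]]] := normal_udiag (A := g).
  by rewrite (unitarymxP gu) unitaryV.
exists P, d; split=> // j.
have : udiag P (\row_j (d 0 j * (d 0 j)^*)) = udiag P (const_mx 1).
  rewrite udiag1 // -(unitarymxP gu) gE udiag_adj udiagM //; congr udiag.
  by apply/rowP => i; rewrite !mxE.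
by move/(udiag_inj Pu)/rowP/(_ j); rewrite !mxE.
Qed.

End UnitaryDiag.

(** * Norms and first order expansions of matrix valued functions *)

Section Norm.
Variable R : realType.
Local Notation C := (cplx R).

(** The entrywise sum norm, with values in R rather than R[i]. Unlike the maximum norm it is
    submultiplicative, and it is exactly multiplicative on Kronecker products. *)
Definition nrm p q (A : 'M[C]_(p, q)) : R := \sum_i \sum_j normc (A i j).

Lemma normc_ge0 (x : C) : 0 <= normc x.
Proof. by case: x => a b; exact: sqrtr_ge0. Qed.

Lemma normcR (t : R) : normc t%:c = `|t|.
Proof. by rewrite /= expr0n addr0 sqrtr_sqr. Qed.

Lemma nrm_ge0 p q (A : 'M[C]_(p, q)) : 0 <= nrm A.
Proof. by apply: sumr_ge0 => i _; apply: sumr_ge0 => j _; exact: normc_ge0. Qed.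

Lemma normc_le_nrm p q (A : 'M[C]_(p, q)) i j : normc (A i j) <= nrm A.
Proof.
rewrite /nrm (bigD1 i) //= (bigD1 j) //= -addrA lerDl addr_ge0 //.
  by apply: sumr_ge0 => *; exact: normc_ge0.
by apply: sumr_ge0 => *; apply: sumr_ge0 => *; exact: normc_ge0.
Qed.

Lemma nrm_le0 p q (A : 'M[C]_(p, q)) : nrm A <= 0 -> A = 0.
Proof.
move=> A0; apply/matrixP => i j; rewrite mxE; apply: eq0_normc.
by apply/le_anti; rewrite normc_ge0 (le_trans (normc_le_nrm A i j)).
Qed.

Lemma nrm0 p q : nrm (0 : 'M[C]_(p, q)) = 0.
Proof.
by rewrite /nrm big1 // => i _; rewrite big1 // => j _; rewrite mxE normc0.
Qed.

Lemma nrmD p q (A B : 'M[C]_(p, q)) : nrm (A + B) <= nrm A + nrm B.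
Proof.
rewrite /nrm -big_split ler_sum //= => i _; rewrite -big_split ler_sum //= => j _.
by rewrite mxE le_normcD.
Qed.

Lemma nrmZ p q (a : C) (A : 'M[C]_(p, q)) : nrm (a *: A) = normc a * nrm A.
Proof.
rewrite /nrm mulr_sumr; apply: eq_bigr => i _; rewrite mulr_sumr.
by apply: eq_bigr => j _; rewrite mxE normcM.
Qed.

Lemma nrmN p q (A : 'M[C]_(p, q)) : nrm (- A) = nrm A.
Proof.
by apply: eq_bigr => i _; apply: eq_bigr => j _; rewrite mxE normcN.
Qed.

Lemma nrmB p q (A B : 'M[C]_(p, q)) : nrm (A - B) <= nrm A + nrm B.
Proof. by rewrite -(nrmN B) nrmD. Qed.

Lemma nrmC p q (A B : 'M[C]_(p, q)) : nrm (A - B) = nrm (B - A).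
Proof. by rewrite -nrmN opprB. Qed.

Lemma nrm_sum p q (I : Type) (r : seq I) P (F : I -> 'M[C]_(p, q)) :
  nrm (\sum_(i <- r | P i) F i) <= \sum_(i <- r | P i) nrm (F i).
Proof.
elim/big_rec2: _ => [|i x y _ le_yx]; first by rewrite nrm0.
by rewrite (le_trans (nrmD _ _))// lerD2l.
Qed.

Lemma normc_sum (I : Type) (r : seq I) (P : pred I) (F : I -> C) :
  normc (\sum_(i <- r | P i) F i) <= \sum_(i <- r | P i) normc (F i).
Proof.
elim/big_rec2: _ => [|i x y _ le_yx]; first by rewrite normc0.
by rewrite (le_trans (le_normcD _ _))// lerD2l.
Qed.

Lemma nrmM p q r (A : 'M[C]_(p, q)) (B : 'M[C]_(q, r)) :
  nrm (A *m B) <= nrm A * nrm B.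
Proof.
rewrite /nrm mulr_suml ler_sum // => i _.
have -> : (\sum_j normc (A i j)) * (\sum_i \sum_j normc (B i j)) =
  \sum_k \sum_j \sum_l normc (A i j) * normc (B l k).
  rewrite [RHS]exchange_big /= mulr_suml; apply: eq_bigr => j _.
  rewrite [in LHS]exchange_big mulr_sumr; apply: eq_bigr => k _.
  by rewrite mulr_sumr.
rewrite ler_sum // => k _; rewrite mxE (le_trans (normc_sum _ _ _)) //.
rewrite ler_sum // => j _; rewrite normcM (bigD1 j) //= lerDl.
by apply: sumr_ge0 => l _; rewrite mulr_ge0 ?normc_ge0.
Qed.

Lemma nrm_tr p q (A : 'M[C]_(p, q)) : nrm (A^T) = nrm A.
Proof.
rewrite /nrm exchange_big; apply: eq_bigr => i _.
by apply: eq_bigr => j _; rewrite mxE.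
Qed.

Lemma normc_conj (x : C) : normc x^* = normc x.
Proof. by case: x => a b; rewrite /= sqrrN. Qed.

Lemma nrm_conj p q (A : 'M[C]_(p, q)) : nrm (map_mx Num.conj A) = nrm A.
Proof.
rewrite /nrm; apply: eq_bigr => i _; apply: eq_bigr => j _; rewrite mxE.
exact: normc_conj.
Qed.

Lemma nrm_adj p q (A : 'M[C]_(p, q)) : nrm (A ^t*) = nrm A.
Proof. by rewrite nrm_conj nrm_tr. Qed.

Lemma nrm_tens p q r s (A : 'M[C]_(p, q)) (B : 'M[C]_(r, s)) :
  nrm (A *t B) = nrm A * nrm B.
Proof.
rewrite /nrm mulr_sum; apply: eq_bigr => i _; rewrite mulr_sum.
by apply: eq_bigr => j _; rewrite mxE normcM.
Qed.

(** Rows of a unitary matrix have length 1, so each of the [n * n] entries has modulus at most 1.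
    All constants [(N * N)%:R] and [(m * m)%:R] below come from this crude bound. *)
Lemma nrm_unitary n (U : 'M[C]_n) : U \is unitarymx -> nrm U <= (n * n)%:R.
Proof.
move=> /unitarymxP UU.
have entry i j : normc (U i j) <= 1.
  have /matrixP/(_ i i) := UU; rewrite !mxE eqxx => /(congr1 (@complex.Re R)).
  rewrite raddf_sum /= (bigD1 j) //= => s1.
  have sq k : complex.Re (U i k * (U ^t*) k i) = normc (U i k) ^+ 2.
    rewrite !mxE; case: (U i k) => a b /=.
    rewrite sqr_sqrtr ?addr_ge0 ?sqr_ge0 //; ring.
  have : normc (U i j) ^+ 2 <= 1.
    rewrite -s1 sq lerDl; apply: sumr_ge0 => k _; rewrite sq sqr_ge0 //.
  by rewrite expr_le1 // normc_ge0.
have -> : (n * n)%:R = \sum_(i < n) \sum_(j < n) 1 :> R.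
  by rewrite !sumr_const !card_ord -mulrnA.
by apply: ler_sum => i _; apply: ler_sum.
Qed.

End Norm.

Ltac mx_ring :=
  rewrite ?(mulmxDl, mulmxDr, mulmxBl, mulmxBr, mulmxN, mulNmx)
    -?scalemxAl -?scalemxAr ?mulmxA ?scalerA;
  repeat match goal with |- context [@mulmx ?R ?p ?q ?r ?a ?b] =>
    let X := fresh "X" in set X := (@mulmx R p q r a b); clearbody X end;
  apply/matrixP => ? ?; rewrite !mxE; ring.

(** The algebra behind [gamma_slopes]: [A], [B], [U], [V] are the values of a one-parameter group at
    s, t, a small step u and a multiple of u near t, and [x], [y] count the steps. The first three
    terms are errors; the last one measures how far t x - s y is from 0. *)
Lemma slope_identity (K : comNzRingType) p q (I A B U V : 'M[K]_(p, q)) s t x y :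
  t *: (A - I) - s *: (B - I) = t *: (A - I - x *: (U - I)) -
    s *: (V - I - y *: (U - I)) - s *: (B - V) + (t * x - s * y) *: (U - I).
Proof. by mx_ring. Qed.

Section Jet.
Variable R : realType.
Local Notation C := (cplx R).

(** f(t) = A + t B + O(t^2) with a constant valid on all of [-1, 1]. The uniform quadratic remainder
    turns products, adjoints and uniqueness into explicit estimates. *)
Definition jet p q (f : R -> 'M[C]_(p, q)) (A B : 'M[C]_(p, q)) : Prop :=
  exists K, forall t, `|t| <= 1 -> nrm (f t - A - t%:c *: B) <= K * t ^+ 2.

Lemma jet_ext p q (f g : R -> 'M[C]_(p, q)) A B :
  (forall t, f t = g t) -> jet f A B -> jet g A B.
Proof. by move=> fg [K fK]; exists K => t t1; rewrite -fg fK. Qed.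

Lemma jet_cst p q (A : 'M[C]_(p, q)) : jet (fun=> A) A 0.
Proof. by exists 0 => t _; rewrite subrr scaler0 subr0 nrm0 mul0r. Qed.

Lemma jetD p q (f g : R -> 'M[C]_(p, q)) A B A' B' :
  jet f A B -> jet g A' B' -> jet (fun t => f t + g t) (A + A') (B + B').
Proof.
move=> [K fK] [L gL]; exists (K + L) => t t1.
rewrite mulrDl (le_trans _ (lerD (fK t t1) (gL t t1))) //.
apply: le_trans (nrmD _ _); rewrite le_eqVlt; apply/orP; left; apply/eqP.
by congr nrm; mx_ring.
Qed.

Lemma jetN p q (f : R -> 'M[C]_(p, q)) A B :
  jet f A B -> jet (fun t => - f t) (- A) (- B).
Proof.
move=> [K fK]; exists K => t t1.
by rewrite scalerN -!opprD nrmN fK.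
Qed.

Lemma jetM p q r (f : R -> 'M[C]_(p, q)) (g : R -> 'M[C]_(q, r)) A B A' B' :
  jet f A B -> jet g A' B' ->
  jet (fun t => f t *m g t) (A *m A') (A *m B' + B *m A').
Proof.
move=> [K fK] [L gL].
(* The three summands bound t^2 B B', (A + t B) r2 and r1 g(t), the last one because |g(t)| <= |A'|
   + |B'| + L on [-1, 1]. *)
exists (nrm B * nrm B' + (nrm A + nrm B) * L + K * (nrm A' + nrm B' + L)) => t t1.
have t2 : 0 <= t ^+ 2 <= 1.
  by rewrite sqr_ge0 -(ger0_norm (sqr_ge0 t)) normrX expr_le1.
set r1 := f t - A - t%:c *: B; set r2 := g t - A' - t%:c *: B'.
have ft : f t = (A + t%:c *: B) + r1 by rewrite /r1; mx_ring.
have gt : g t = (A' + t%:c *: B') + r2 by rewrite /r2; mx_ring.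
have lin p' q' (X Y : 'M[C]_(p', q')) : nrm (X + t%:c *: Y) <= nrm X + nrm Y.
  rewrite (le_trans (nrmD _ _)) // lerD2l nrmZ normcR.
  by rewrite ler_piMl // nrm_ge0.
have K0 : 0 <= K.
  by have := fK 1; rewrite normr1 expr1n mulr1 => /(_ (lexx _)); apply: le_trans (nrm_ge0 _).
have L0 : 0 <= L.
  by have := gL 1; rewrite normr1 expr1n mulr1 => /(_ (lexx _)); apply: le_trans (nrm_ge0 _).
have -> : f t *m g t - A *m A' - t%:c *: (A *m B' + B *m A') =
   (t ^+ 2)%:c *: (B *m B') + (A + t%:c *: B) *m r2 + r1 *m g t.
  transitivity ((A + t%:c *: B + r1) *m g t - A *m A' -
      t%:c *: (A *m B' + B *m A')); first by rewrite -ft.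
  transitivity ((A + t%:c *: B) *m (A' + t%:c *: B' + r2) + r1 *m g t - A *m A' -
      t%:c *: (A *m B' + B *m A')); first by rewrite -gt mulmxDl.
  by rewrite rmorphXn /=; clearbody r1 r2; mx_ring.
rewrite 2!mulrDl.
apply: le_trans (nrmD _ _) _; apply: lerD; last first.
  rewrite (le_trans (nrmM _ _)) // mulrAC ler_pM ?nrm_ge0 ?fK //.
  rewrite gt (le_trans (nrmD _ _)) // lerD // (le_trans (gL t t1)) //.
  by rewrite ler_piMr //; case/andP: t2.
apply: le_trans (nrmD _ _) _; apply: lerD.
  rewrite nrmZ normcR ger0_norm; last by case/andP: t2.
  by rewrite mulrC ler_wpM2r ?nrmM //; case/andP: t2.
rewrite (le_trans (nrmM _ _)) // -mulrA ler_pM ?nrm_ge0 //.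
exact: gL.
Qed.

Lemma jetMl p q r (f : R -> 'M[C]_(p, q)) (M : 'M[C]_(r, p)) A B :
  jet f A B -> jet (fun t => M *m f t) (M *m A) (M *m B).
Proof. by move=> /(jetM (jet_cst M)); rewrite mul0mx addr0. Qed.

Lemma jetMr p q r (f : R -> 'M[C]_(p, q)) (M : 'M[C]_(q, r)) A B :
  jet f A B -> jet (fun t => f t *m M) (A *m M) (B *m M).
Proof. by move=> fAB; have := jetM fAB (jet_cst M); rewrite mulmx0 add0r. Qed.

Lemma jetM1 n (f g : R -> 'M[C]_n) A B :
  jet f 1%:M A -> jet g 1%:M B -> jet (fun t => f t *m g t) 1%:M (A + B).
Proof. by move=> fA gB; have := jetM fA gB; rewrite mul1mx !mulmx1 mul1mx addrC. Qed.

(** The bound on [s] keeps [s * t] in [-1, 1], the range that a jet controls. Larger factors are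
    recovered in [diffZ] by inverting them. *)
Lemma jet_scale p q (f : R -> 'M[C]_(p, q)) A B (s : R) :
  `|s| <= 1 -> jet f A B -> jet (fun t => f (s * t)) A (s%:c *: B).
Proof.
move=> s1 [K fK].
have K0 : 0 <= K.
  by have := fK 1; rewrite normr1 expr1n mulr1 => /(_ (lexx _)); apply: le_trans (nrm_ge0 _).
exists K => t t1; rewrite scalerA -rmorphM (mulrC t).
rewrite (le_trans (fK _ _)) ?normrM ?mulr_ile1 //.
by rewrite exprMn ler_wpM2l // ler_piMl ?sqr_ge0 // -real_normK ?num_real // expr_le1.
Qed.

Lemma jet_adj p q (f : R -> 'M[C]_(p, q)) A B :
  jet f A B -> jet (fun t => (f t) ^t*) (A ^t*) (B ^t*).
Proof.
move=> [K fK]; exists K => t /fK; rewrite -nrm_adj; congr (nrm _ <= _).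
apply/matrixP => i j; rewrite !mxE !rmorphB rmorphM /=.
by congr (_ - _ * _); exact: conjc_real.
Qed.

(** The origin of all brackets: [f] contributes A Y, and its adjoint, with first order term - A,
    contributes - Y A. *)
Lemma jet_conj_skew n (f : R -> 'M[C]_n) A Y : jet f 1%:M A -> A ^t* = - A ->
  jet (fun t => f t *m Y *m (f t) ^t*) Y (A *m Y - Y *m A).
Proof.
move=> fA skewA; have := jetM (jetMr Y fA) (jet_adj fA).
by rewrite adj1 !mul1mx !mulmx1 skewA mulmxN [- _ + _]addrC.
Qed.

Lemma jet_conj_unitary p n (f : R -> 'M[C]_n) A (U : 'M[C]_(p, n)) :
  jet f 1%:M A -> U \is unitarymx ->
  jet (fun t => U *m f t *m U ^t*) 1%:M (U *m A *m U ^t*).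
Proof.
move=> fA Uu; have := jetMr (U ^t*) (jetMl U fA).
by rewrite mulmx1 (unitarymxP Uu).
Qed.

Lemma jet_conj p q (f : R -> 'M[C]_(p, q)) A B :
  jet f A B ->
  jet (fun t => map_mx Num.conj (f t)) (map_mx Num.conj A) (map_mx Num.conj B).
Proof.
move=> [K fK]; exists K => t /fK; rewrite -nrm_conj; congr (nrm _ <= _).
apply/matrixP => i j; rewrite !mxE !rmorphB rmorphM /=.
by congr (_ - _ * _); exact: conjc_real.
Qed.

Lemma jet_tens1 p q r s (f : R -> 'M[C]_(p, q)) (M : 'M[C]_(r, s)) A B :
  jet f A B -> jet (fun t => f t *t M) (A *t M) (B *t M).
Proof.
move=> [K fK]; exists (K * nrm M) => t /fK fKt.
rewrite mulrAC (le_trans _ (ler_wpM2r (nrm_ge0 M) fKt)) // -nrm_tens.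
by rewrite le_eqVlt; apply/orP; left; apply/eqP; congr nrm; mx_ring.
Qed.

Lemma jet_1tens p q r s (f : R -> 'M[C]_(p, q)) (M : 'M[C]_(r, s)) A B :
  jet f A B -> jet (fun t => M *t f t) (M *t A) (M *t B).
Proof.
move=> [K fK]; exists (K * nrm M) => t /fK fKt.
rewrite mulrAC (le_trans _ (ler_wpM2r (nrm_ge0 M) fKt)) // mulrC -nrm_tens.
by rewrite le_eqVlt; apply/orP; left; apply/eqP; congr nrm; mx_ring.
Qed.

Lemma le_lin_eq0 (a K : R) :
  (forall t, 0 < t -> t <= 1 -> a <= K * t) -> a <= 0.
Proof.
move=> aK; rewrite leNgt; apply/negP => a0.
have K0 : 0 < K by rewrite (lt_le_trans a0) // -[K]mulr1 aK.
pose t := Num.min 1 (a / (2 * K)).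
have t0 : 0 < t by rewrite lt_min ltr01 divr_gt0 // mulr_gt0.
have := aK t t0; rewrite {1}/t ge_min lexx => /(_ isT).
have : K * t <= K * (a / (2 * K)) by rewrite (ler_wpM2l (ltW K0)) // /t ge_min lexx orbT.
have -> : K * (a / (2 * K)) = a / 2 by field; rewrite gt_eqF.
by move=> h1 h2; have := le_trans h2 h1; lra.
Qed.

Lemma jet_uniq p q (f : R -> 'M[C]_(p, q)) A B A' B' :
  jet f A B -> jet f A' B' -> A = A' /\ B = B'.
Proof.
move=> /jetN fAB fAB'; have [K DK] := jetD fAB' fAB.
have A0 : A' - A = 0.
  apply: nrm_le0.
  have := DK 0; rewrite normr0 scale0r subrr sub0r subr0 nrmN.
  by rewrite expr0n mulr0; apply; exact: ler01.
have AA : A = A' by apply/eqP; rewrite eq_sym -subr_eq0 A0.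
split=> //; apply/eqP; rewrite eq_sym -subr_eq0; apply/eqP/nrm_le0.
apply: (@le_lin_eq0 _ K) => t t0 t1.
have := DK t; rewrite (ger0_norm (ltW t0)) => /(_ t1).
rewrite A0 subrr subr0 sub0r nrmN nrmZ normcR (ger0_norm (ltW t0)) expr2 mulrA (mulrC t).
by rewrite ler_pM2r.
Qed.

End Jet.

(** * Comparison of the sum norm with the topology used in the definitions *)

Section Topology.
Variable R : realType.
Local Notation C := (cplx R).
Local Open Scope classical_set_scope.

Lemma ball_nrm p q (A B : 'M[C]_(p, q)) (e : R) :
  0 < e -> nrm (A - B) < e -> ball A e%:C B.
Proof.
move=> e0 AB; split; first by rewrite ltcR.
move=> i j; rewrite /ball /= normc_def ltcR.
have := le_lt_trans (normc_le_nrm (A - B) i j) AB.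
by rewrite !mxE; case: (A i j - B i j).
Qed.

Lemma nrm_ball p q (A B : 'M[C]_(p, q)) (e : R) :
  ball A e%:C B -> nrm (A - B) <= (p * q)%:R * e.
Proof.
move=> [e0 AB].
have -> : (p * q)%:R * e = \sum_(i < p) \sum_(j < q) e.
  by rewrite !sumr_const !card_ord -mulrnA -[RHS]mulr_natl mulnC.
apply: ler_sum => i _; apply: ler_sum => j _; rewrite !mxE.
by have := AB i j; rewrite /ball /= normc_def ltcR; case: (A i j - B i j) => a b /ltW.
Qed.

Lemma cvg_nrm p q (T : Type) (F : set_system T) (FF : Filter F)
    (f : T -> 'M[C]_(p, q)) (A : 'M[C]_(p, q)) :
  (forall e : R, 0 < e -> \forall t \near F, nrm (A - f t) < e) -> f @ F --> A.
Proof.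
move=> H; apply/cvg_ballP => e e0.
have eR : e = (complex.Re e)%:C by rewrite RRe_real // gtr0_real.
have {}e0 : 0 < complex.Re e by rewrite -ltcR -eR.
by have := H _ e0; apply: filterS => t; rewrite eR; exact: ball_nrm.
Qed.

Lemma jet_lim p q (f : R -> 'M[C]_(p, q)) A B :
  jet f A B -> lim ((t^-1)%:c *: (f t - A) @[t --> (0 : R)^']) = B.
Proof.
move=> [K fK]; apply: cvg_lim; first exact: norm_hausdorff.
apply: cvg_nrm => e e0.
have K1 : 0 < `|K| + 1 by rewrite ltr_wpDl.
apply/nbhs_ballP; exists (Num.min 1 (e / (`|K| + 1))) => /=.
  by rewrite lt_min ltr01 divr_gt0.
move=> t; rewrite /ball /= sub0r normrN lt_min => /andP[t1 te] t0.
have -> : B - (t^-1)%:c *: (f t - A) = - (t^-1)%:c *: (f t - A - t%:c *: B).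
  rewrite [RHS]scalerBr scalerA mulNr -rmorphM mulVf // rmorph1.
  by rewrite !scaleNr scale1r opprK addrC.
rewrite nrmZ normcN normcR normfV.
have nt : 0 < `|t| by rewrite normr_gt0.
rewrite mulrC ltr_pdivrMr //.
apply: (le_lt_trans (fK t (ltW t1))).
rewrite -(real_normK (num_real t)) expr2 mulrA ltr_pM2r //.
apply: (@le_lt_trans _ _ ((`|K| + 1) * `|t|)).
  by rewrite ler_pM2r // (le_trans (ler_norm K)) // lerDl.
by rewrite mulrC -ltr_pdivlMr.
Qed.

Lemma within_continuous_nrm p q r s (S : set 'M[C]_(p, q))
    (f : 'M[C]_(p, q) -> 'M[C]_(r, s)) (A : 'M[C]_(p, q)) :
  {within S, continuous f} -> S A ->
  forall e : R, 0 < e -> exists2 d : R, 0 < d &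
    forall X, S X -> nrm (X - A) < d -> nrm (f X - f A) < e.
Proof.
move=> /subspace_continuousP cf SA e e0.
(* Passing from a ball to [nrm] costs a factor r s; the added 1 keeps the inequality strict and the
   denominator nonzero for empty matrices. *)
set e' := e / ((r * s)%:R + 1).
have rs0 : 0 < (r * s)%:R + 1 :> R by rewrite ltr_wpDl.
have e'0 : 0 < e' by rewrite divr_gt0.
have /cvg_ballP /(_ (e'%:C)) := cf A SA.
rewrite ltcR => /(_ e'0) /nbhs_ballP [d0 /= d00 H].
have dR : d0 = (complex.Re d0)%:C by rewrite RRe_real // gtr0_real.
exists (complex.Re d0); first by rewrite -ltcR -dR.
move=> X SX XA; have := H X; rewrite dR => /(_ (ball_nrm _ _)).
rewrite nrmC => /(_ _ XA); rewrite -ltcR -dR => /(_ d00 SX) /nrm_ball.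
rewrite nrmC => /le_lt_trans; apply.
by rewrite /e' mulrCA -ltr_pdivlMl // mulVf ?gt_eqF // ltr_pdivrMr // mul1r ltrDl.
Qed.

Lemma normc_le_ReIm (z : C) : normc z <= `|complex.Re z| + `|complex.Im z|.
Proof.
rewrite {1}(complexE z) (le_trans (le_normcD _ _)) // lerD // ?normcM normcR //.
by rewrite /= expr0n add0r expr1n sqrtr1 mul1r.
Qed.

(** Reduces a complex matrix limit to real sequences, for which the power series of cosine and sine
    are available. *)
Lemma limn_mx p q (u : nat -> 'M[C]_(p, q)) (L : 'M[C]_(p, q)) :
  (forall i j, (fun n => complex.Re (u n i j)) @ \oo --> complex.Re (L i j)) ->
  (forall i j, (fun n => complex.Im (u n i j)) @ \oo --> complex.Im (L i j)) ->
  limn u = L.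
Proof.
move=> cRe cIm; apply: cvg_lim; first exact: norm_hausdorff.
apply: cvg_nrm => e e0.
set e' := e / ((p * q)%:R + 1).
have pq0 : 0 < (p * q)%:R + 1 :> R by rewrite ltr_wpDl.
have e'0 : 0 < e' / 2 by rewrite !divr_gt0.
have H : \forall n \near \oo, forall i j,
   `|complex.Re (L i j) - complex.Re (u n i j)| < e' / 2 /\
   `|complex.Im (L i j) - complex.Im (u n i j)| < e' / 2.
  apply: filter_forall => i; apply: filter_forall => j.
  near=> n; split; near: n.
    by have /cvgr_dist_lt := cRe i j; apply.
  by have /cvgr_dist_lt := cIm i j; apply.
apply: filterS H => n H.
apply: (@le_lt_trans _ _ ((p * q)%:R * e')); last first.
  by rewrite /e' mulrCA -ltr_pdivlMl // mulVf ?gt_eqF // ltr_pdivrMr // mul1r ltrDl.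
have -> : (p * q)%:R * e' = \sum_(i < p) \sum_(j < q) e'.
  by rewrite !sumr_const !card_ord -mulrnA -[RHS]mulr_natl mulnC.
apply: ler_sum => i _; apply: ler_sum => j _; rewrite !mxE.
have [h1 h2] := H i j; rewrite (le_trans (normc_le_ReIm _)) // !raddfB /=.
by rewrite [leRHS]splitr lerD // ltW.
Unshelve. all: by end_near. Qed.

End Topology.

(** * The exponential of a skew-hermitian matrix *)

Section Cis.
Variable R : realType.
Local Notation C := (cplx R).
Local Open Scope classical_set_scope.

Definition cis (x : R) : C := cos x +i* sin x.

Lemma cis0 : cis 0 = 1.
Proof. by rewrite /cis cos0 sin0. Qed.

Lemma cisD x y : cis (x + y) = cis x * cis y.
Proof.
apply/eqP; rewrite /cis cosD sinD eq_complex /=.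
by apply/andP; split; apply/eqP; ring.
Qed.

Lemma conjc_cis x : (cis x)^* = cis (- x).
Proof. by rewrite /cis cosN sinN. Qed.

Lemma cis_surj (z : C) : z * z^* = 1 -> exists x, z = cis x.
Proof.
case: z => a b /eqP; rewrite eq_complex /= => /andP[/eqP ab _].
have {}ab : a ^+ 2 + b ^+ 2 = 1 by rewrite -ab; ring.
have a1 : -1 <= a <= 1.
  rewrite -ler_norml -(expr_le1 (n := 2)) // real_normK ?num_real //.
  by rewrite -ab lerDl sqr_ge0.
have cosa : cos (acos a) = a by rewrite acosK // in_itv.
have sina : sin (acos a) = `|b|.
  by rewrite sin_acos // -ab [_ + b ^+ 2]addrC addrK sqrtr_sqr.
have [b0|b0] := leP 0 b.
  by exists (acos a); rewrite /cis cosa sina ger0_norm.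
by exists (- acos a); rewrite /cis cosN sinN cosa sina ltr0_norm ?opprK.
Qed.

Let MVT0 (f df : R -> R) (x : R) : 0 <= x ->
  (forall x : R, is_derive x 1 f (df x)) ->
  exists2 c, 0 <= c <= x & f x - f 0 = df c * x.
Proof.
move=> x0 fdf; have [|c] := @MVT_segment R f df _ _ x0 (fun x _ => fdf x).
  apply: continuous_subspaceT => y.
  by apply/differentiable_continuous/derivable1_diffP; apply: ex_derive.
by rewrite in_itv /= subr0; exists c.
Qed.

(** Real and imaginary part contribute x^2 each. For x >= 0 the mean value theorem gives |cos x - 1|
    = x |sin c| and |sin x - x| = x |cos c - 1|, and applied once more it bounds both second factors
    by c <= x. Negative x follow by conjugation. *)
Lemma cis_approx x : normc (cis x - 1 - imag x) <= 2 * x ^+ 2.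
Proof.
have pos (y : R) : 0 <= y -> normc (cis y - 1 - imag y) <= 2 * y ^+ 2.
  move=> y0; apply: le_trans (normc_le_ReIm _) _.
  have cos_le (z : R) : 0 <= z -> `|cos z - 1| <= z.
    move=> z0; have [c _] := @MVT0 (@cos R) (fun x : R => - sin x) _ z0 (fun=> _).
    rewrite cos0 => ->; rewrite normrM (ger0_norm z0) ler_piMl // normrN.
    exact: sin_max.
  have sin_le (z : R) : 0 <= z -> `|sin z| <= z.
    move=> z0; have [c _] := @MVT0 (@sin R) (@cos R) _ z0 (fun=> _).
    rewrite sin0 subr0 => ->; rewrite normrM (ger0_norm z0) ler_piMl //.
    exact: cos_max.
  rewrite mulr2n mulrDl mul1r lerD //.
    rewrite /= oppr0 addr0.
    have [c /andP[c0 cy]] := @MVT0 (@cos R) (fun x : R => - sin x) _ y0 (fun=> _).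
    rewrite cos0 => ->; rewrite normrM (ger0_norm y0) expr2 ler_wpM2r // normrN.
    by rewrite (le_trans (sin_le _ c0)).
  rewrite /= subr0.
  have dsin (z : R) : is_derive z 1 (@sin R - id) (cos z - 1).
    exact: is_deriveB.
  have [c /andP[c0 cy]] := MVT0 y0 dsin.
  rewrite !fctE /= sin0 subrr subr0 => ->; rewrite normrM (ger0_norm y0) expr2.
  by rewrite ler_wpM2r // (le_trans (cos_le _ c0)).
have [/pos//|/ltW x0] := leP 0 x.
have := pos (- x); rewrite oppr_ge0 sqrrN => /(_ x0).
rewrite -normc_conj; congr (normc _ <= _); apply/eqP.
rewrite /cis cosN sinN eq_complex /=.
by apply/andP; split; apply/eqP; ring.
Qed.

Definition cis_coeff (x : R) (k : nat) : C := (k`!%:R)^-1 * (imag x) ^+ k.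

Lemma cis_coeffE x k : cis_coeff x k = cos_coeff x k +i* sin_coeff x k.
Proof.
have fE : (k`!%:R : C)^-1 = ((k`!%:R)^-1)%:C by rewrite fmorphV rmorph_nat.
have evn n : ('i : R[i]) ^+ n.*2 = ((-1) ^+ n)%:C.
  by rewrite -mul2n exprM sqr_i rmorphXn rmorphN1.
have iE : imag x = 'i * x%:C by rewrite /imag; simpc.
rewrite /cis_coeff fE iE exprMn -rmorphXn /= /cos_coeff /sin_coeff /=.
have -> : ('i : R[i]) ^+ k = ((~~ odd k)%:R * (-1) ^+ k./2) +i* ((odd k)%:R * (-1) ^+ k.-1./2).
  rewrite -[in LHS](odd_double_half k); case: (boolP (odd k)) => ok.
    rewrite add1n exprS evn; apply/eqP; rewrite eq_complex /= -divn2.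
    have -> : (k.-1./2 = k./2)%N.
      by rewrite -[in LHS](odd_double_half k) ok /= doubleK.
    by rewrite !mul0r mulr0 subr0 !mul1r add0r divn2 !eqxx.
  rewrite add0n evn; apply/eqP; rewrite eq_complex /=.
  by rewrite mul0r mul1r !eqxx.
apply/eqP; rewrite eq_complex /= !(mul0r, mulr0, subr0, addr0) -exprnP.
by apply/andP; split; apply/eqP; ring.
Qed.

Lemma cvg_Re_cis x : (fun n => complex.Re (series (cis_coeff x) n)) @ \oo --> cos x.
Proof.
rewrite (_ : (fun n => _) = series (cos_coeff x)).
  by rewrite unlock; exact: is_cvg_series_cos_coeff.
apply/funext => n; rewrite !seriesEnat /= raddf_sum /=.
by apply: eq_bigr => i _; rewrite cis_coeffE.
Qed.

Lemma cvg_Im_cis x : (fun n => complex.Im (series (cis_coeff x) n)) @ \oo --> sin x.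
Proof.
rewrite (_ : (fun n => _) = series (sin_coeff x)).
  by rewrite unlock; exact: is_cvg_series_sin_coeff.
apply/funext => n; rewrite !seriesEnat /= raddf_sum /=.
by apply: eq_bigr => i _; rewrite cis_coeffE.
Qed.

End Cis.

Section Exponential.
Variables (R : realType) (m : nat).
Local Notation C := (cplx R).
Local Open Scope classical_set_scope.
Local Notation exp := (@expmx R m : 'M[C]_m -> 'M[C]_m).
Implicit Types (X P g : 'M[C]_m) (th : 'I_m -> R).

Lemma cvg_bigsum (I : Type) (r : seq I) (u : I -> nat -> R) (l : I -> R) :
  (forall i, u i @ \oo --> l i) ->
  (fun n => \sum_(i <- r) u i n) @ \oo --> \sum_(i <- r) l i.
Proof.
move=> ul; elim: r => [|i r IHr].
  by under eq_fun do rewrite big_nil; rewrite big_nil; exact: cvg_cst.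
by under eq_fun do rewrite big_cons; rewrite big_cons; exact: cvgD.
Qed.

Lemma rc_imag (t x : R) : t%:c * imag x = imag (t * x).
Proof.
apply/eqP; rewrite eq_complex /=.
by apply/andP; split; apply/eqP; ring.
Qed.

Lemma conj_imag (x : R) : (imag x)^*%R = - imag x.
Proof. by apply/eqP; rewrite eq_complex /= oppr0 !eqxx. Qed.

Lemma adjZR p q (t : R) (A : 'M[C]_(p, q)) : (t%:c *: A) ^t* = t%:c *: A ^t*.
Proof. by rewrite adjZ; congr (_ *: _); exact: conjc_real. Qed.

Lemma skew_scale (t : R) X : X ^t* = - X -> (t%:c *: X) ^t* = - (t%:c *: X).
Proof. by move=> skewX; rewrite adjZR skewX scalerN. Qed.

Lemma nrm_udiag P d : nrm (udiag P d) <= nrm P ^+ 2 * \sum_j normc (d 0 j).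
Proof.
rewrite unlock; apply: le_trans (nrmM _ _) _; rewrite expr2 mulrAC ler_wpM2r ?nrm_ge0 //.
apply: le_trans (nrmM _ _) _; rewrite nrm_adj ler_wpM2l ?nrm_ge0 //.
apply: ler_sum => i _; rewrite (bigD1 i) //= mxE eqxx mulr1n big1 ?addr0 //.
by move=> j ji; rewrite mxE eq_sym (negbTE ji) normc0.
Qed.

Lemma skew_spectral X : X ^t* = - X -> exists P th, P \is unitarymx /\
  X = udiag P (\row_j (imag (th j))).
Proof.
move=> /skew_udiag[P [d [Pu XE dskew]]].
exists P, (fun j => complex.Im (d 0 j)); split; first exact: Pu.
rewrite XE; congr udiag; apply/rowP => j; rewrite mxE.
have := dskew j; case: (d 0 j) => a b /eqP; rewrite eq_complex /= => /andP[/eqP aE _].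
have -> : a = 0 by lra.
apply/eqP; rewrite eq_complex /=.
by apply/andP; split; apply/eqP; ring.
Qed.

Lemma cvg_Re_cis_mul (w : C) x : (fun n => complex.Re
  (w * series (cis_coeff x) n)) @ \oo --> complex.Re (w * cis x).
Proof.
case: w => a b.
have ReM (z : C) : complex.Re ((a +i* b : C) * z) =
    a * complex.Re z - b * complex.Im z by case: z.
under eq_fun do rewrite ReM; rewrite ReM.
by apply: cvgB; apply: cvgM; [exact: cvg_cst|exact: cvg_Re_cis|
  exact: cvg_cst|exact: cvg_Im_cis].
Qed.

Lemma cvg_Im_cis_mul (w : C) x : (fun n => complex.Im
  (w * series (cis_coeff x) n)) @ \oo --> complex.Im (w * cis x).
Proof.
case: w => a b.
have ImM (z : C) : complex.Im ((a +i* b : C) * z) =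
    a * complex.Im z + b * complex.Re z by case: z.
under eq_fun do rewrite ImM; rewrite ImM.
by apply: cvgD; apply: cvgM; [exact: cvg_cst|exact: cvg_Im_cis|
  exact: cvg_cst|exact: cvg_Re_cis].
Qed.

(** Each entry of a partial sum is a fixed linear combination, with coefficients conj(P a i) P a j,
    of the scalar exponential series at the eigenvalues, whose parts converge to cosine and sine. *)
Lemma expmx_udiag P th : P \is unitarymx ->
  exp (udiag P (\row_j (imag (th j)))) = udiag P (\row_j cis (th j)).
Proof.
move=> Pu; rewrite /expmx.
have entry n i j : (series (fun k => (k`!%:R : C)^-1 *:
    (udiag P (\row_j (imag (th j)))) ^+ k) n) i j =
    \sum_a ((P a i)^*%R * P a j) * series (cis_coeff (th a)) n.
  rewrite seriesEnat /= summxE.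
  under [RHS]eq_bigr do rewrite seriesEnat /= mulr_sumr.
  rewrite exchange_big /=; apply: eq_bigr => k _.
  rewrite (udiag_exp _ _ Pu) mxE udiagE mulr_sumr; apply: eq_bigr => a _.
  by rewrite !mxE mulrCA.
apply: limn_mx => i j; rewrite udiagE raddf_sum /=;
  under eq_fun do rewrite entry raddf_sum /=; apply: cvg_bigsum => a; rewrite mxE.
  exact: cvg_Re_cis_mul.
exact: cvg_Im_cis_mul.
Qed.

Lemma expmx_spectral X : X ^t* = - X -> exists P th,
  [/\ P \is unitarymx, X = udiag P (\row_j (imag (th j))) &
      forall t, exp (t%:c *: X) = udiag P (\row_j cis (t * th j))].
Proof.
move=> /skew_spectral[P [th [Pu XE]]]; exists P, th; split; [exact: Pu|exact: XE|].
move=> t; rewrite -(@expmx_udiag P (fun j => t * th j) Pu) XE udiagZ.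
congr (exp (udiag P _)); apply/rowP => j; by rewrite !mxE rc_imag.
Qed.

Lemma expmxD X (s t : R) : X ^t* = - X ->
  exp ((s + t)%:c *: X) = exp (s%:c *: X) *m exp (t%:c *: X).
Proof.
move=> /expmx_spectral[P [th [Pu _ E]]]; rewrite !E (udiagM _ _ Pu); congr udiag.
by apply/rowP => j; rewrite !mxE mulrDl cisD.
Qed.

Lemma expmx0 X : X ^t* = - X -> exp (0%:c *: X) = 1%:M.
Proof.
move=> /expmx_spectral[P [th [Pu _ E]]]; rewrite E -(udiag1 Pu); congr udiag.
by apply/rowP => j; rewrite !mxE mul0r cis0.
Qed.

Lemma expmx_adj X (t : R) : X ^t* = - X ->
  (exp (t%:c *: X)) ^t* = exp ((- t)%:c *: X).
Proof.
move=> /expmx_spectral[P [th [Pu _ E]]]; rewrite !E udiag_adj; congr udiag.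
by apply/rowP => j; rewrite !mxE mulNr -conjc_cis.
Qed.

Lemma expmx_unitary X (t : R) : X ^t* = - X -> exp (t%:c *: X) \is unitarymx.
Proof.
move=> skewX; apply/unitarymxP.
by rewrite expmx_adj // -expmxD // subrr expmx0.
Qed.

Lemma expmx_jet X : X ^t* = - X -> jet (fun t => exp (t%:c *: X)) 1%:M X.
Proof.
move=> /expmx_spectral[P [th [Pu XE E]]].
exists (nrm P ^+ 2 * \sum_j 2 * (th j) ^+ 2) => t _.
rewrite E -(udiag1 Pu) XE udiagZ !udiagB; apply: le_trans (nrm_udiag _ _) _.
rewrite -mulrA ler_wpM2l ?sqr_ge0 // mulr_suml; apply: ler_sum => j _.
rewrite !mxE -mulrA -exprMn [_ * t]mulrC rc_imag.
exact: cis_approx.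
Qed.

(** The eigenvalues of [g] have modulus 1, hence imaginary logarithms, which are placed in the same
    eigenbasis. *)
Lemma expmx_surj g : g \is unitarymx -> exists X, X ^t* = - X /\ g = exp X.
Proof.
move=> /unitary_udiag[P [d [Pu gE d1]]].
have [th thE] := choice (fun j => cis_surj (d1 j)).
exists (udiag P (\row_j (imag (th j)))); split.
  rewrite udiag_adj -scaleN1r udiagZ; congr udiag; apply/rowP => j; rewrite !mxE.
  by rewrite conj_imag mulN1r.
rewrite (expmx_udiag _ Pu) gE; congr udiag.
by apply/rowP => j; rewrite mxE thE.
Qed.

Lemma expmx_conj g X (t : R) : g \is unitarymx -> X ^t* = - X ->
  exp (t%:c *: (g *m X *m g ^t*)) = g *m exp (t%:c *: X) *m g ^t*.
Proof.
move=> gu /expmx_spectral[P [th [Pu XE E]]].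
have Pgu := unitary_mul_adj Pu gu.
rewrite (E t) XE.
rewrite -(udiag_conj P g).
rewrite -(udiag_conj P g).
rewrite udiagZ.
rewrite -(@expmx_udiag _ (fun j => t * th j) Pgu).
congr (exp (udiag _ _)); apply/rowP => j; by rewrite !mxE rc_imag.
Qed.

End Exponential.

(** * The differential of a continuous unitary representation *)

Section OneParameter.
Variables (R : realType) (N : nat).
Local Notation C := (cplx R).
Implicit Types (T g : 'M[C]_N).

Lemma unitary_exp g k : g \is unitarymx -> g ^+ k \is unitarymx.
Proof.
move=> gu; elim: k => [|k IHk]; last by rewrite exprS mul_unitarymx.
by apply/unitarymxP; rewrite expr0 adj1 mulmx1.
Qed.

Lemma pow_sub1 T n : T ^+ n - 1%:M = (T - 1%:M) *m \sum_(k < n) T ^+ k.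
Proof.
elim: n => [|n IHn]; first by rewrite expr0 subrr big_ord0 mulmx0.
rewrite big_ord_recr /= mulmxDr -IHn exprS mulmxBl mul1mx.
by rewrite [X in _ = X]addrC addrA subrK.
Qed.

Lemma nrm_pow_unitary g n : g \is unitarymx ->
  nrm (g ^+ n - 1%:M) <= n%:R * (N * N)%:R * nrm (g - 1%:M).
Proof.
move=> gu; rewrite pow_sub1 (le_trans (nrmM _ _)) // mulrC.
rewrite ler_wpM2r ?nrm_ge0 // (le_trans (nrm_sum _ _ _)) //.
apply: (@le_trans _ _ (\sum_(k < n) (N * N)%:R)).
  by apply: ler_sum => k _; exact: (nrm_unitary (unitary_exp k gu)).
by rewrite sumr_const card_ord -[leLHS]mulr_natl.
Qed.

(** In T^n - 1 = n (T - 1) + (T - 1) sum_k (T^k - 1) the correction is at most half of n |T - 1|, so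
    it can be absorbed on the left. *)
Lemma small_powers T n : (forall k, (k <= n)%N -> nrm (T ^+ k - 1%:M) <= 2^-1) ->
  n%:R * nrm (T - 1%:M) <= 1.
Proof.
move=> Tn.
have E : (n%:R)%:c *: (T - 1%:M) =
    (T ^+ n - 1%:M) - (T - 1%:M) *m \sum_(k < n) (T ^+ k - 1%:M).
  rewrite pow_sub1 -mulmxBr -sumrB.
  under [in RHS]eq_bigr do rewrite opprB addrC subrK.
  by rewrite sumr_const card_ord -[1%:M *+ n]scaler_nat -scalemxAr mulmx1 rmorph_nat.
have : n%:R * nrm (T - 1%:M) <= 2^-1 + nrm (T - 1%:M) * (n%:R * 2^-1).
  rewrite -[X in X * _ <= _]ger0_norm // -normcR -[normc _]/(normc (n%:R%:c : C)).
  rewrite -nrmZ E (le_trans (nrmB _ _)) // lerD ?Tn //.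
  rewrite (le_trans (nrmM _ _)) // ler_wpM2l ?nrm_ge0 //.
  rewrite (le_trans (nrm_sum _ _ _)) // mulr_natl -[X in _ *+ X]card_ord -sumr_const.
  by apply: ler_sum => k _; rewrite Tn // ltnW.
by rewrite mulrCA => ?; lra.
Qed.

Variable gamma : R -> 'M[C]_N.
Hypothesis gammaD : forall s t, gamma (s + t) = gamma s *m gamma t.
Hypothesis gamma0 : gamma 0 = 1%:M.
Variable K : R.
Hypothesis gammaK : forall t, `|t| <= 1 -> nrm (gamma t - 1%:M) <= K * `|t|.

Let K_ge0 : 0 <= K.
Proof.
by have := gammaK (t := 1); rewrite normr1 mulr1 lexx => /(_ isT); exact: le_trans (nrm_ge0 _).
Qed.

(** Each further step adds the error (gamma(n u) - 1)(gamma(u) - 1), of size at most K^2 (n u) u;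
    these errors sum to at most K^2 (n u)^2. *)
Let gamma_multiple u n : 0 <= u -> n%:R * u <= 1 ->
  nrm (gamma (n%:R * u) - 1%:M - n%:R%:c *: (gamma u - 1%:M)) <=
  K ^+ 2 * (n%:R * u) ^+ 2.
Proof.
move=> u0; elim: n => [|n IHn] nu.
  by rewrite mul0r gamma0 subrr rmorph0 scale0r subr0 nrm0 expr0n mulr0.
have nu1 : n%:R * u <= 1.
  by rewrite (le_trans _ nu) // ler_wpM2r // ler_nat.
have nu0 : 0 <= n%:R * u by rewrite mulr_ge0.
have u1 : u <= 1.
  by rewrite (le_trans _ nu) // ler_peMl // ler1n.
have -> : gamma (n.+1%:R * u) - 1%:M - n.+1%:R%:c *: (gamma u - 1%:M) =
    (gamma (n%:R * u) - 1%:M - n%:R%:c *: (gamma u - 1%:M)) +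
    (gamma (n%:R * u) - 1%:M) *m (gamma u - 1%:M).
  rewrite -natr1 mulrDl mul1r gammaD rmorphD rmorph1 /=.
  move: (gamma _) (gamma u) (n%:R%:c) => A B c.
  rewrite mulmxBr mulmxBl mulmx1 mul1mx.
  by mx_ring.
rewrite (le_trans (nrmD _ _)) //.
have h1 := IHn nu1.
have h2 : nrm ((gamma (n%:R * u) - 1%:M) *m (gamma u - 1%:M)) <= K * (n%:R * u) * (K * u).
  rewrite (le_trans (nrmM _ _)) // ler_pM ?nrm_ge0 //.
    by rewrite -[in leRHS](ger0_norm nu0) gammaK // ger0_norm.
  by rewrite -[in leRHS](ger0_norm u0) gammaK // ger0_norm.
apply: (le_trans (lerD h1 h2)); rewrite -natr1.
have -> : K ^+ 2 * ((n%:R + 1) * u) ^+ 2 = K ^+ 2 * (n%:R * u) ^+ 2 +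
   K * (n%:R * u) * (K * u) + (K * u) ^+ 2 * (n%:R + 1) by ring.
by rewrite lerDl mulr_ge0 ?sqr_ge0.
Qed.

Lemma le_archi (a b c : R) :
  (forall n : nat, (0 < n)%N -> a <= b + c / n%:R) -> a <= b.
Proof.
move=> H; rewrite -subr_le0; apply: (@le_lin_eq0 _ _ (`|c| + 1)) => t t0 _.
have [n nt] : exists n : nat, t^-1 < n.+1%:R.
  by exists (Num.truncn t^-1); rewrite truncnS_gt.
have := H n.+1 isT; rewrite -lerBlDl => /le_trans; apply.
apply: (@le_trans _ _ (`|c| * t)).
  rewrite (le_trans (ler_norm _)) // normrM ler_wpM2l // normfV ger0_norm //.
  by rewrite invf_ple ?posrE // ltW.
by rewrite ler_wpM2r ?ltW // ltrDl.
Qed.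

(* Both [gamma s] and [gamma t] are compared with multiples of [gamma u - 1] for a
   small common step [u = s / n], up to a remainder that vanishes as [n] grows. *)
Let gamma_slopes s t : 0 < s <= 1 -> 0 < t <= 1 ->
  nrm (t%:c *: (gamma s - 1%:M) - s%:c *: (gamma t - 1%:M)) <=
  K ^+ 2 * (s * t * (s + t)).
Proof.
move=> /andP[s0 s1] /andP[t0 t1].
have s0' := ltW s0; have t0' := ltW t0.
pose B := nrm (1%:M : 'M[C]_N) + K.
have B0 : 0 <= B by rewrite addr_ge0 ?nrm_ge0.
have gammaB r : `|r| <= 1 -> nrm (gamma r) <= B.
  move=> r1; rewrite -[gamma r](subrK 1%:M) addrC (le_trans (nrmD _ _)) //.
  rewrite lerD2l (le_trans (gammaK r1)) // ler_piMr //.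
(* With u = s / n, the part of t left over after whole steps costs s B K u + s K u, which is this
   constant divided by n. *)
apply: (@le_archi _ _ ((B * K + K) * s ^+ 2)) => n n0.
have n0' : 0 < n%:R :> R by rewrite ltr0n.
pose u := s / n%:R.
have u0 : 0 < u by rewrite divr_gt0.
have u0' := ltW u0.
have su : s = n%:R * u by rewrite /u mulrC divfK ?gt_eqF.
have u1 : u <= 1.
  by rewrite (le_trans _ s1) // su ler_peMl // ler1n.
pose k := Num.truncn (t / u).
have ku : k%:R * u <= t.
  by rewrite -ler_pdivlMr // truncn_le ?divr_ge0.
have ku' : t - k%:R * u <= u.
  have : t / u < k.+1%:R by rewrite truncnS_gt.
  rewrite ltr_pdivrMr // -natr1 mulrDl mul1r => /ltW; lra.
have ku0 : 0 <= t - k%:R * u by rewrite subr_ge0.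
have hs : nrm (gamma s - 1%:M - n%:R%:c *: (gamma u - 1%:M)) <= K ^+ 2 * s ^+ 2.
  by rewrite su gamma_multiple // -su.
have ht1 : nrm (gamma (k%:R * u) - 1%:M - k%:R%:c *: (gamma u - 1%:M)) <= K ^+ 2 * t ^+ 2.
  apply: le_trans (gamma_multiple u0' (le_trans ku t1)) _.
  rewrite ler_wpM2l ?sqr_ge0 // lerXn2r ?nnegrE ?mulr_ge0 //.
have ht2 : nrm (gamma t - gamma (k%:R * u)) <= B * (K * u).
  have -> : gamma t - gamma (k%:R * u) =
      gamma (k%:R * u) *m (gamma (t - k%:R * u) - 1%:M).
    by rewrite mulmxBr mulmx1 -gammaD [k%:R * u + _]addrC subrK.
  rewrite (le_trans (nrmM _ _)) // ler_pM ?nrm_ge0 //.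
    by rewrite gammaB // ger0_norm ?mulr_ge0 // (le_trans ku).
  rewrite (le_trans (gammaK _)) ?ger0_norm ?(le_trans ku') //.
  by rewrite ler_wpM2l.
have hv : nrm (gamma u - 1%:M) <= K * u.
  by rewrite -[in leRHS](ger0_norm u0') gammaK // ger0_norm.
have -> : t%:c *: (gamma s - 1%:M) - s%:c *: (gamma t - 1%:M) =
    t%:c *: (gamma s - 1%:M - n%:R%:c *: (gamma u - 1%:M)) -
    s%:c *: (gamma (k%:R * u) - 1%:M - k%:R%:c *: (gamma u - 1%:M)) -
    s%:c *: (gamma t - gamma (k%:R * u)) +
    (n%:R * (t - k%:R * u))%:c *: (gamma u - 1%:M).
  have -> : n%:R * (t - k%:R * u) = t * n%:R - s * k%:R by rewrite su; ring.
  rewrite rmorphB !rmorphM /=.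
  exact: slope_identity.
have nZ r (A : 'M[C]_N) a : 0 <= r -> nrm A <= a -> nrm (r%:c *: A) <= r * a.
  by move=> r0 Aa; rewrite nrmZ -[normc _]/(normc r%:C) normcR ger0_norm // ler_wpM2l.
apply: (@le_trans _ _ (t * (K ^+ 2 * s ^+ 2) + s * (K ^+ 2 * t ^+ 2) +
    s * (B * (K * u)) + n%:R * (t - k%:R * u) * (K * u))).
  rewrite (le_trans (nrmD _ _)) // lerD ?nZ ?mulr_ge0 //.
  rewrite (le_trans (nrmB _ _)) // lerD ?nZ //.
  by rewrite (le_trans (nrmB _ _)) // lerD ?nZ.
have h : n%:R * (t - k%:R * u) * (K * u) <= s * (K * u).
  by rewrite ler_wpM2r ?mulr_ge0 // su ler_wpM2l.
have -> : K ^+ 2 * (s * t * (s + t)) + (B * K + K) * s ^+ 2 / n%:R =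
   t * (K ^+ 2 * s ^+ 2) + s * (K ^+ 2 * t ^+ 2) + s * (B * (K * u)) + s * (K * u).
  by rewrite /u; ring.
by rewrite lerD2l.
Qed.

(** The left end of any interval [f s - c s, f s + c s] lies below the right end of any other, so
    the supremum of the left ends belongs to all of them. *)
Lemma lim0_of_slopes (f : R -> R) (c : R) :
  (forall s t, 0 < s <= 1 -> 0 < t <= 1 -> `|f s - f t| <= c * (s + t)) ->
  exists L, forall s, 0 < s <= 1 -> `|f s - L| <= c * s.
Proof.
move=> fc.
pose S : set R := [set f s - c * s | s in [set s | 0 < s <= 1]]%classic.
have S0 : (S !=set0)%classic.
  by exists (f 1 - c * 1), 1 => //=; rewrite ltr01 lexx.
have Sub t : 0 < t <= 1 -> ubound S (f t + c * t).
  move=> t01 _ [s s01 <-]; have := fc s t s01 t01.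
  by rewrite ler_norml mulrDr => /andP[_]; lra.
exists (sup S) => s s01; rewrite ler_norml; apply/andP; split.
  by have := @ge_sup _ S _ S0 (Sub s s01); lra.
have : f s - c * s <= sup S.
  apply: ub_le_sup; last by exists s.
  by exists (f s + c * s); exact: Sub.
by lra.
Qed.

(* The slopes [(gamma s - 1) / s] and [(gamma t - 1) / t] differ by at most
   [K ^ 2 (s + t)], so they converge at a linear rate; no integration or matrix
   logarithm is needed. *)
Lemma one_parameter_jet : exists A, jet gamma 1%:M A.
Proof.
pose q (s : R) : 'M[C]_N := s^-1%:c *: (gamma s - 1%:M).
have qc s t : 0 < s <= 1 -> 0 < t <= 1 -> nrm (q s - q t) <= K ^+ 2 * (s + t).
  move=> s01 t01; have [/andP[s0 _] /andP[t0 _]] := (s01, t01).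
  have -> : q s - q t = (s * t)^-1%:c *:
      (t%:c *: (gamma s - 1%:M) - s%:c *: (gamma t - 1%:M)).
    have e1 : (s * t)^-1%:c * t%:c = s^-1%:c.
      by rewrite -rcM; congr rc; field; rewrite !gt_eqF.
    have e2 : (s * t)^-1%:c * s%:c = t^-1%:c.
      by rewrite -rcM; congr rc; field; rewrite !gt_eqF.
    by rewrite scale_lincomb e1 e2.
  rewrite nrmZ -[normc _]/(normc (s * t)^-1%:C) normcR ger0_norm; last first.
    by rewrite invr_ge0 mulr_ge0 ?ltW.
  rewrite mulrC ler_pdivrMr ?mulr_gt0 //.
  apply: le_trans (gamma_slopes s01 t01) _.
  by rewrite le_eqVlt; apply/orP; left; apply/eqP; ring.
have normRe (z : C) : `|complex.Re z| <= normc z.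
  case: z => a b /=; rewrite -sqrtr_sqr ler_wsqrtr // lerDl sqr_ge0 //.
have normIm (z : C) : `|complex.Im z| <= normc z.
  case: z => a b /=; rewrite -sqrtr_sqr ler_wsqrtr // lerDr sqr_ge0 //.
have entry s t (i j : 'I_N) : (q s - q t) i j = q s i j - q t i j by rewrite !mxE.
have LRe (ij : 'I_N * 'I_N) : exists L, forall s, 0 < s <= 1 ->
    `|complex.Re (q s ij.1 ij.2) - L| <= K ^+ 2 * s.
  apply: lim0_of_slopes => s t s01 t01; apply: le_trans (qc _ _ s01 t01).
  by rewrite -raddfB -entry (le_trans (normRe _)) // normc_le_nrm.
have LIm (ij : 'I_N * 'I_N) : exists L, forall s, 0 < s <= 1 ->
    `|complex.Im (q s ij.1 ij.2) - L| <= K ^+ 2 * s.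
  apply: lim0_of_slopes => s t s01 t01; apply: le_trans (qc _ _ s01 t01).
  by rewrite -raddfB -entry (le_trans (normIm _)) // normc_le_nrm.
have [a aP] := choice LRe; have [b bP] := choice LIm.
pose A : 'M[C]_N := \matrix_(i, j) (a (i, j) +i* b (i, j) : R[i]).
pose L := (N * N)%:R * (K ^+ 2 + K ^+ 2).
have pos s : 0 <= s <= 1 -> nrm (gamma s - 1%:M - s%:c *: A) <= L * s ^+ 2.
  rewrite le_eqVlt => /andP[/orP[/eqP<- _|s0 s1]].
    by rewrite gamma0 subrr rmorph0 scale0r subr0 nrm0 expr0n mulr0.
  have s01 : 0 < s <= 1 by rewrite s0.
  have -> : gamma s - 1%:M - s%:c *: A = s%:c *: (q s - A).
    by rewrite scalerBr /q scalerA -rmorphM /= mulfV ?gt_eqF // rmorph1 scale1r.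
  rewrite nrmZ -[normc _]/(normc s%:C) normcR gtr0_norm // expr2 mulrCA ler_pM2l //.
  have -> : L * s = \sum_(i < N) \sum_(j < N) (K ^+ 2 * s + K ^+ 2 * s).
    by rewrite !sumr_const !card_ord -mulrnA -[RHS]mulr_natl /L -mulrA mulrDl.
  apply: ler_sum => i _; apply: ler_sum => j _; rewrite (le_trans (normc_le_ReIm _)) //.
  have -> : (q s - A) i j = q s i j - (a (i, j) +i* b (i, j) : R[i]).
    by rewrite !mxE.
  rewrite !raddfB /=.
  by apply: lerD; [exact: (aP (i, j))|exact: (bP (i, j))].
exists A, ((nrm (1%:M : 'M[C]_N) + K) * L + K * nrm A + L) => t.
have L0 : 0 <= L by rewrite mulr_ge0 // addr_ge0 ?sqr_ge0.
have [t0|t0] := leP 0 t.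
  rewrite ger0_norm // => t1; apply: le_trans (pos t _) _; first by rewrite t0.
  by rewrite ler_wpM2r ?sqr_ge0 // lerDr addr_ge0 // mulr_ge0 ?addr_ge0 ?nrm_ge0.
move=> t1'; have t1 : - t <= 1 by rewrite -ltr0_norm.
have nt0 : 0 <= - t by rewrite oppr_ge0 ltW.
(* A negative time is reduced to [- t] by inverting [gamma]. The factor [gamma t] that then stands
   before t A differs from 1 by at most K |t|, which again costs O(t^2). *)
have gtt : gamma t *m gamma (- t) = 1%:M by rewrite -gammaD subrr.
have -> : gamma t - 1%:M - t%:c *: A =
    - (gamma t *m (gamma (- t) - 1%:M - (- t)%:c *: A)) +
    t%:c *: ((gamma t - 1%:M) *m A).
  rewrite mulmxBr mulmxBr gtt mulmx1 rmorphN /=.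
  rewrite scaleNr mulmxN -scalemxAr mulmxBl mul1mx scalerBr.
  by mx_ring.
have gt1 := gammaK t1'.
have sq : t ^+ 2 = (- t) ^+ 2 by rewrite sqrrN.
have h1 : nrm (gamma t *m (gamma (- t) - 1%:M - (- t)%:c *: A)) <=
    (nrm (1%:M : 'M[C]_N) + K) * (L * t ^+ 2).
  rewrite (le_trans (nrmM _ _)) // ler_pM ?nrm_ge0 //.
    rewrite -[gamma t](subrK 1%:M) addrC (le_trans (nrmD _ _)) // lerD2l.
    by rewrite (le_trans gt1) // ler_piMr.
  by rewrite sq pos // nt0.
have h2 : nrm (t%:c *: ((gamma t - 1%:M) *m A)) <= K * nrm A * t ^+ 2.
  rewrite nrmZ -[normc _]/(normc t%:C) normcR.
  have -> : K * nrm A * t ^+ 2 = `|t| * (K * `|t| * nrm A).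
    by rewrite -(real_normK (num_real t)); ring.
  by rewrite ler_wpM2l // (le_trans (nrmM _ _)) // ler_wpM2r ?nrm_ge0.
apply: le_trans (nrmD _ _) _; rewrite nrmN; apply: le_trans (lerD h1 h2) _.
rewrite -subr_ge0 [X in 0 <= X](_ : _ = L * t ^+ 2); last by ring.
by rewrite mulr_ge0 ?sqr_ge0.
Qed.

End OneParameter.

Section Differential.
Variables (R : realType) (m N : nat).
Local Notation C := (cplx R).
Variable pr : 'M[C]_m -> 'M[C]_N.
Local Notation exp := (@expmx R m : 'M[C]_m -> 'M[C]_m).
Local Notation diff := (@diff_rep R m N pr : 'M[C]_m -> 'M[C]_N).
Implicit Types (X Y g h : 'M[C]_m).

(** The form of [unitary_rep] suited to estimates: continuity is expressed at 1, in epsilon-delta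
    terms for [nrm]. The tensor product representations are shown to satisfy it as well. *)
Definition urep : Prop :=
  [/\ pr 1%:M = 1%:M,
      forall g h, g \is unitarymx -> h \is unitarymx ->
        pr (g *m h) = pr g *m pr h,
      forall g, g \is unitarymx -> pr g \is unitarymx &
      forall e, 0 < e -> exists2 d, 0 < d & forall g, g \is unitarymx ->
        nrm (g - 1%:M) < d -> nrm (pr g - 1%:M) < e].

Hypothesis prU : urep.

Lemma urep1 : pr 1%:M = 1%:M. Proof. by case: prU. Qed.

Lemma urepM g h : g \is unitarymx -> h \is unitarymx ->
  pr (g *m h) = pr g *m pr h.
Proof. by case: prU => _ + _ _; apply. Qed.

Lemma urep_unitary g : g \is unitarymx -> pr g \is unitarymx.
Proof. by case: prU => _ _ + _; apply. Qed.

Lemma urep_exp g k : g \is unitarymx -> pr (g ^+ k) = pr g ^+ k.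
Proof.
move=> gu; elim: k => [|k IHk]; first by rewrite !expr0 urep1.
by rewrite !exprS (urepM gu (unitary_exp k gu)) IHk.
Qed.

Lemma unitary1 n : (1%:M : 'M[C]_n) \is unitarymx.
Proof. by apply/unitarymxP; rewrite adj1 mulmx1. Qed.

(* If g is close to 1 then so are its first [1 / |g - 1|] powers, hence those of
   [pr g], which forces [pr g] to be within [O(|g - 1|)] of 1. *)
Lemma urep_lipschitz : exists2 K, 0 <= K & forall g, g \is unitarymx ->
  nrm (pr g - 1%:M) <= K * nrm (g - 1%:M).
Proof.
have [_ _ _ /(_ 2^-1)] := prU; rewrite invr_gt0 ltr0n => /(_ isT) [d d0 dP].
pose M : R := (m * m)%:R + 1; pose B : R := (N * N)%:R + (N * N)%:R.
have M0 : 0 < M by rewrite ltr_wpDl.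
have B0 : 0 <= B by rewrite addr_ge0.
exists ((1 + B) * (2 * M / d)).
  by rewrite mulr_ge0 ?addr_ge0 // divr_ge0 ?mulr_ge0 // ltW.
move=> g gu; set r := nrm (g - 1%:M).
have [r0|r0] := leP r 0.
  have -> : g = 1%:M by apply/eqP; rewrite -subr_eq0; apply/eqP/nrm_le0.
  by rewrite urep1 subrr nrm0 mulr_ge0 ?nrm_ge0 // mulr_ge0 ?addr_ge0 // divr_ge0 ?mulr_ge0 // ltW.
(* For k <= x one has |g^k - 1| <= k M r <= d / 2 < d, so (pr g)^k stays within 1/2 of 1. Rounding x
   down to [n] loses at most one multiple of |pr g - 1|, which [B] bounds. *)
pose x := d / (2 * M * r); pose n := Num.truncn x.
have Mr0 : 0 < 2 * M * r by rewrite !mulr_gt0.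
have x0 : 0 <= x by rewrite divr_ge0 // ltW.
have pB : nrm (pr g - 1%:M) <= B.
  rewrite (le_trans (nrmB _ _)) // lerD //; first exact: (nrm_unitary (urep_unitary gu)).
  exact: (nrm_unitary (unitary1 _)).
have small k : (k <= n)%N -> nrm (pr g ^+ k - 1%:M) <= 2^-1.
  move=> kn; rewrite -urep_exp //; apply/ltW/dP; first exact: unitary_exp.
  apply: (le_lt_trans (nrm_pow_unitary k gu)); rewrite -/r.
  have kx : k%:R <= x by rewrite (@le_trans _ _ n%:R) ?ler_nat // truncn_le.
  have : k%:R * (2 * M * r) <= d by rewrite -ler_pdivlMr.
  have : k%:R * (m * m)%:R * r <= k%:R * M * r.
    by rewrite (ler_wpM2r (ltW r0)) // ler_wpM2l // lerDl.
  by rewrite mulrA => h1 h2; have := d0; lra.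
have h : x * nrm (pr g - 1%:M) <= 1 + B.
  have h1 := small_powers small.
  have h2 : x <= n%:R + 1 by rewrite natr1 ltW // truncnS_gt.
  apply: (@le_trans _ _ ((n%:R + 1) * nrm (pr g - 1%:M))).
    by rewrite ler_wpM2r ?nrm_ge0.
  by rewrite mulrDl mul1r lerD.
have -> : (1 + B) * (2 * M / d) * r = (1 + B) / x.
  by rewrite /x; field; rewrite !gt_eqF.
by rewrite ler_pdivlMr ?divr_gt0 // mulrC.
Qed.

Lemma expmx_lip X : X ^t* = - X ->
  exists2 K, 0 <= K & forall t, `|t| <= 1 -> nrm (exp (t%:c *: X) - 1%:M) <= K * `|t|.
Proof.
move=> /expmx_jet[K KP].
have K0 : 0 <= K.
  by have := KP 1; rewrite normr1 expr1n mulr1 => /(_ (lexx _)); apply: le_trans (nrm_ge0 _).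
exists (K + nrm X) => [|t t1]; first by rewrite addr_ge0 ?nrm_ge0.
rewrite -[_ - _](subrK (t%:c *: X)) (le_trans (nrmD _ _)) //.
rewrite mulrDl lerD //; last by rewrite nrmZ -[normc _]/(normc t%:C) normcR mulrC.
rewrite (le_trans (KP t t1)) // -(real_normK (num_real t)) expr2 mulrA ler_piMr //.
by rewrite mulr_ge0.
Qed.

(** The Lipschitz bounds of [pr] and of the exponential compose to the hypothesis of
    [one_parameter_jet]; [jet_lim] then identifies the generator with the limit in [diff_rep]. *)
Lemma diff_jet X : X ^t* = - X ->
  jet (fun t => pr (exp (t%:c *: X))) 1%:M (diff X).
Proof.
move=> skewX; have [K K0 KP] := urep_lipschitz; have [L L0 LP] := expmx_lip skewX.
have [s t|||A AP] := @one_parameter_jet R N (fun t => pr (exp (t%:c *: X))) _ _ (K * L).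
- by rewrite expmxD // urepM //; exact: expmx_unitary.
- by rewrite expmx0 // urep1.
- move=> t t1; rewrite (le_trans (KP _ (expmx_unitary t skewX))) // -mulrA.
  by rewrite ler_wpM2l // LP.
suff -> : diff X = A by exact: AP.
by have := jet_lim AP; rewrite -urep1.
Qed.

Lemma diff_uniq X A : X ^t* = - X ->
  jet (fun t => pr (exp (t%:c *: X))) 1%:M A -> diff X = A.
Proof. by move=> /diff_jet h1 h2; have [_] := jet_uniq h1 h2. Qed.

Lemma diffZ (s : R) X : X ^t* = - X -> diff (s%:c *: X) = s%:c *: diff X.
Proof.
move=> skewX.
have small r Y : Y ^t* = - Y -> `|r| <= 1 -> diff (r%:c *: Y) = r%:c *: diff Y.
  move=> skewY r1; apply: (diff_uniq (skew_scale r skewY)).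
  apply: jet_ext (jet_scale r1 (diff_jet skewY)) => t /=.
  by rewrite scalerA mulrC rcM.
have [/small|s1] := leP `|s| 1; first exact.
have s0 : s != 0 by rewrite -normr_gt0 (lt_trans _ s1).
have sE : s^-1%:c *: (s%:c *: X) = X by rewrite scalerA -rcM mulVf // scale1r.
have := small s^-1 (s%:c *: X) (skew_scale s skewX).
rewrite normfV invf_le1 ?(lt_trans _ s1) // ltW // sE => /(_ isT) ->.
by rewrite scalerA -rcM mulfV // scale1r.
Qed.

(** The curve exp(tX) exp(tY) exp(-t(X + Y)) is 1 + O(t^2), and the Lipschitz bound preserves this
    under [pr]. The first order term of its image, diff X + diff Y + diff(-(X + Y)), is therefore
    0. *)
Lemma diffD X Y : X ^t* = - X -> Y ^t* = - Y -> diff (X + Y) = diff X + diff Y.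
Proof.
move=> skewX skewY.
have skewXY : (- (X + Y)) ^t* = - - (X + Y) by rewrite adjN adjD skewX skewY -opprD.
have skewD : (X + Y) ^t* = - (X + Y) by rewrite adjD skewX skewY opprD.
pose h t := exp (t%:c *: X) *m exp (t%:c *: Y) *m exp (t%:c *: (- (X + Y))).
have [[uX uY] uXY] := (fun t => expmx_unitary t skewX, fun t => expmx_unitary t skewY,
  fun t => expmx_unitary t skewXY).
have uh t : h t \is unitarymx by exact: (mul_unitarymx (mul_unitarymx (uX t) (uY t)) (uXY t)).
have jh : jet h 1%:M 0.
  have := jetM1 (jetM1 (expmx_jet skewX) (expmx_jet skewY)) (expmx_jet skewXY).
  by rewrite subrr.
have jph : jet (fun t => pr (h t)) 1%:M 0.
  have [K K0 KP] := urep_lipschitz; have [L LP] := jh; exists (K * L) => t t1.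
  rewrite scaler0 subr0 -mulrA (le_trans (KP _ (uh t))) // ler_wpM2l //.
  by have := LP t t1; rewrite scaler0 subr0.
have jpp := jetM1 (jetM1 (diff_jet skewX) (diff_jet skewY)) (diff_jet skewXY).
have {jpp} := jet_uniq (jet_ext _ jpp) jph; case=> [t|_ D0].
  by rewrite /h (urepM (mul_unitarymx (uX t) (uY t)) (uXY t)) (urepM (uX t) (uY t)).
have := diffZ (-1) skewD; rewrite rmorphN1 !scaleN1r => E.
by apply/eqP; rewrite eq_sym -subr_eq0 -E D0.
Qed.

Lemma diffN X : X ^t* = - X -> diff (- X) = - diff X.
Proof. by move=> skewX; have := diffZ (-1) skewX; rewrite rmorphN1 !scaleN1r. Qed.

Lemma skewB X Y : X ^t* = - X -> Y ^t* = - Y -> (X - Y) ^t* = - (X - Y).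
Proof. by move=> skewX skewY; rewrite adjB skewX skewY opprD. Qed.

Lemma diffB X Y : X ^t* = - X -> Y ^t* = - Y -> diff (X - Y) = diff X - diff Y.
Proof.
move=> skewX skewY; rewrite -(diffN skewY); apply: diffD => //.
by rewrite adjN skewY.
Qed.

Lemma diff_conj g X : g \is unitarymx -> X ^t* = - X ->
  diff (g *m X *m g ^t*) = pr g *m diff X *m (pr g) ^t*.
Proof.
move=> gu skewX.
have skewg : (g *m X *m g ^t*) ^t* = - (g *m X *m g ^t*).
  by rewrite !adj_mul trmxCK skewX mulNmx mulmxN mulmxA.
have gu' : g ^t* \is unitarymx by rewrite trmxC_unitary.
have prV : (pr g) ^t* = pr (g ^t*).
  have e : pr (g ^t*) *m pr g = 1%:M by rewrite -(urepM gu' gu) (unitaryV gu) urep1.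
  by rewrite -[LHS]mul1mx -e -mulmxA (unitarymxP (urep_unitary gu)) mulmx1.
apply: (diff_uniq skewg).
have := jet_conj_unitary (diff_jet skewX) (urep_unitary gu).
apply: jet_ext => t; have ut := expmx_unitary t skewX.
by rewrite prV -(urepM gu ut) -(urepM (mul_unitarymx gu ut) gu') -expmx_conj.
Qed.

(** The Lipschitz constant of [pr] survives the limit t -> 0. It allows [diff] to be applied to a
    jet of skew-hermitian matrices, as [diff_bracket] requires. *)
Lemma diff_bound : exists2 K, 0 <= K & forall X, X ^t* = - X ->
  nrm (diff X) <= K * nrm X.
Proof.
have [K K0 KP] := urep_lipschitz; exists K => // X skewX.
have [L LP] := diff_jet skewX; have [M MP] := expmx_jet skewX.
rewrite -subr_le0; apply: (@le_lin_eq0 _ _ (L + K * M)) => t t0 t1.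
have nt : `|t| = t by rewrite ger0_norm // ltW.
have {LP}h1 := LP t; have {MP}h2 := MP t; rewrite nt t1 in h1 h2.
have {h1} h1 := h1 isT; have {h2} h2 := h2 isT.
have h3 := KP _ (expmx_unitary t skewX).
have nZ p (A : 'M[C]_p) : nrm (t%:c *: A) = t * nrm A.
  by rewrite nrmZ -[normc _]/(normc t%:C) normcR nt.
have h4 : nrm (exp (t%:c *: X) - 1%:M) <= M * t ^+ 2 + t * nrm X.
  rewrite -[X in nrm X](subrK (t%:c *: X)) (le_trans (nrmD _ _)) // nZ.
  by rewrite lerD2r.
have h5 : t * nrm (diff X) <= nrm (pr (exp (t%:c *: X)) - 1%:M) + L * t ^+ 2.
  rewrite -nZ -[X in nrm X](subKr (pr (exp (t%:c *: X)) - 1%:M)).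
  by rewrite (le_trans (nrmB _ _)) // lerD2l.
have h6 := ler_wpM2l K0 h4.
rewrite -(ler_pM2l t0).
have -> : t * (nrm (diff X) - K * nrm X) = t * nrm (diff X) - K * (t * nrm X) by ring.
have -> : t * ((L + K * M) * t) = L * t ^+ 2 + K * (M * t ^+ 2) by ring.
by move: h6; rewrite mulrDr; lra.
Qed.

Lemma diff_adj X : X ^t* = - X -> (diff X) ^t* = - diff X.
Proof.
move=> skewX; rewrite -(diffN skewX).
have skewN : (- X) ^t* = - - X by rewrite adjN skewX.
apply/esym/(diff_uniq skewN); have := jet_adj (diff_jet skewX); rewrite adj1.
apply: jet_ext => t; have ut := expmx_unitary t skewX.
have ut' : (exp (t%:c *: X)) ^t* \is unitarymx by rewrite trmxC_unitary.
have -> : t%:c *: - X = (- t)%:c *: X by rewrite rmorphN scaleNr scalerN.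
rewrite -expmx_adj // -[LHS]mul1mx -urep1 -(unitaryV ut) (urepM ut' ut) -mulmxA.
by rewrite (unitarymxP (urep_unitary ut)) mulmx1.
Qed.

Lemma skew_bracket X Y : X ^t* = - X -> Y ^t* = - Y ->
  (X *m Y - Y *m X) ^t* = - (X *m Y - Y *m X).
Proof.
move=> skewX skewY; rewrite adjB !adj_mul skewX skewY !mulNmx !mulmxN !opprK.
by rewrite opprB.
Qed.

(** Both sides are the first order term of diff(exp(tX) Y exp(-tX)): once by differentiating inside
    [diff], once after rewriting it as conjugation of diff Y by pr(exp(tX)). *)
Lemma diff_bracket X Y : X ^t* = - X -> Y ^t* = - Y ->
  diff (X *m Y - Y *m X) = diff X *m diff Y - diff Y *m diff X.
Proof.
move=> skewX skewY.
have skewE t : (exp (t%:c *: X) *m Y *m (exp (t%:c *: X)) ^t*) ^t* =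
     - (exp (t%:c *: X) *m Y *m (exp (t%:c *: X)) ^t*).
  by rewrite !adj_mul trmxCK skewY mulNmx mulmxN mulmxA.
have [L LP] := jet_conj_skew Y (expmx_jet skewX) skewX.
have [K K0 KP] := diff_bound.
have jd : jet (fun t => diff (exp (t%:c *: X) *m Y *m (exp (t%:c *: X)) ^t*))
    (diff Y) (diff (X *m Y - Y *m X)).
  exists (K * L) => t t1; rewrite -mulrA.
  have skewXY := skew_bracket skewX skewY.
  have skewtXY := skew_scale t skewXY.
  move: (LP t t1) (skewE t); move: (_ *m _ ^t*) => F LPt skewF.
  rewrite -(diffZ t skewXY) -(diffB skewF skewY).
  rewrite -(diffB (skewB skewF skewY) skewtXY).
  apply: le_trans (KP _ (skewB (skewB skewF skewY) skewtXY)) _.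
  by rewrite ler_wpM2l.
have jp := jet_conj_skew (diff Y) (diff_jet skewX) (diff_adj skewX).
apply/esym; have {jp} := jet_uniq (jet_ext _ jp) jd; case=> // t.
by rewrite -(diff_conj (expmx_unitary t skewX) skewY).
Qed.

End Differential.

(** * Complex linear extension of the differential to gl(m, C) *)

Section Complexification.
Variable R : realType.
Local Notation C := (cplx R).

Definition ic : C := imag 1.

Lemma ic2 : ic * ic = -1.
Proof.
apply/eqP; rewrite eq_complex /=.
by apply/andP; split; apply/eqP; ring.
Qed.

Lemma conj_ic : ic^*%R = - ic.
Proof. exact: conj_imag. Qed.

Lemma cplxE (a : C) : exists x y : R, a = x%:c + ic * y%:c.
Proof.
case: a => x y; exists x, y; apply/eqP; rewrite eq_complex /=.
by apply/andP; split; apply/eqP; ring.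
Qed.

Lemma ic_neq0 : ic != 0.
Proof. by apply/eqP => ic0; have /eqP := ic2; rewrite ic0 mul0r eq_sym oppr_eq0 oner_eq0. Qed.

Lemma conj2V : (2^-1 : C)^*%R = 2^-1.
Proof. by rewrite fmorphV rmorph_nat. Qed.

Lemma half_double p q (Z : 'M[C]_(p, q)) : 2^-1 *: (Z + Z) = Z.
Proof.
by rewrite -mulr2n -[Z *+ 2]scaler_nat scalerA mulVf ?scale1r // pnatr_eq0.
Qed.

Lemma skew_parts m (Z : 'M[C]_m) :
  [/\ (2^-1 *: (Z - Z ^t*)) ^t* = - (2^-1 *: (Z - Z ^t*)),
      ((2 * ic)^-1 *: (Z + Z ^t*)) ^t* = - ((2 * ic)^-1 *: (Z + Z ^t*)) &
      Z = 2^-1 *: (Z - Z ^t*) + ic *: ((2 * ic)^-1 *: (Z + Z ^t*))].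
Proof.
split.
- by rewrite adjZ adjB trmxCK conj2V -scalerN opprB.
- have h : (2 * ic)^*%R = - (2 * ic).
    by rewrite -mulrN -conj_ic -[in RHS](rmorph_nat (@Num.conj C) 2) -rmorphM.
  by rewrite adjZ adjD trmxCK fmorphV /= h invrN scaleNr addrC.
- rewrite scalerA invfM mulrCA mulfV ?ic_neq0 // mulr1 -scalerDr.
  have -> : Z - Z ^t* + (Z + Z ^t*) = Z + Z by rewrite addrCA subrK.
  by rewrite half_double.
Qed.

End Complexification.

Section GlRep.
Variables (R : realType) (m N : nat).
Local Notation C := (cplx R).
Variable pr : 'M[C]_m -> 'M[C]_N.
Local Notation exp := (@expmx R m : 'M[C]_m -> 'M[C]_m).
Local Notation diff := (@diff_rep R m N pr : 'M[C]_m -> 'M[C]_N).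
Local Notation gl := (@gl_rep R m N pr : 'M[C]_m -> 'M[C]_N).
Local Notation ic := (ic R).
Implicit Types (X Y Z S T g h : 'M[C]_m).
Hypothesis prU : urep pr.

Lemma gl_rep_skew S T : S ^t* = - S -> T ^t* = - T ->
  gl (S + ic *: T) = diff S + ic *: diff T.
Proof.
move=> skewS skewT; set Z := S + ic *: T.
have -> : gl Z = diff (2^-1 *: (Z - Z ^t*)) + ic *: diff ((2 * ic)^-1 *: (Z + Z ^t*)).
  exact: erefl.
have ZE : Z ^t* = - S + ic *: T.
  by rewrite adjD adjZ skewS skewT conj_ic scaleNr scalerN opprK.
have -> : 2^-1 *: (Z - Z ^t*) = S.
  by rewrite ZE /Z opprD opprK addrACA subrr addr0 half_double.
have -> : (2 * ic)^-1 *: (Z + Z ^t*) = T; last by [].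
rewrite ZE /Z addrACA subrr add0r invfM mulrC -scalerA half_double scalerA.
by rewrite mulVf ?scale1r // ic_neq0.
Qed.

Let skewD S T : S ^t* = - S -> T ^t* = - T -> (S + T) ^t* = - (S + T).
Proof. by move=> skewS skewT; rewrite adjD skewS skewT opprD. Qed.

Let skewN S : S ^t* = - S -> (- S) ^t* = - - S.
Proof. by move=> skewS; rewrite adjN skewS. Qed.

Lemma gl_rep_cart Z : exists S T,
  [/\ S ^t* = - S, T ^t* = - T, Z = S + ic *: T & gl Z = diff S + ic *: diff T].
Proof.
have [skewS skewT ZE] := skew_parts Z.
exists (2^-1 *: (Z - Z ^t*)), ((2 * ic)^-1 *: (Z + Z ^t*)).
by split; [exact: skewS|exact: skewT|exact: ZE|exact: erefl].
Qed.

Lemma gl_repD Z Z' : gl (Z + Z') = gl Z + gl Z'.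
Proof.
have [S [T [sS sT -> ->]]] := gl_rep_cart Z.
have [S' [T' [sS' sT' -> ->]]] := gl_rep_cart Z'.
rewrite addrACA -scalerDr (gl_rep_skew (skewD sS sS') (skewD sT sT')).
by rewrite (diffD prU sS sS') (diffD prU sT sT') scalerDr addrACA.
Qed.

Lemma scale_cart p q (x y : R) (A B : 'M[C]_(p, q)) :
  (x%:c + ic * y%:c) *: (A + ic *: B) =
  (x%:c *: A - y%:c *: B) + ic *: (x%:c *: B + y%:c *: A).
Proof.
apply/matrixP => i j; rewrite !mxE; apply/eqP; rewrite -subr_eq0; apply/eqP.
transitivity ((ic * ic + 1) * (y%:c * B i j)); last by rewrite ic2 addNr mul0r.
by move: x%:c y%:c ic (A i j) (B i j) => *; ring.
Qed.

Lemma gl_repZ (a : C) Z : gl (a *: Z) = a *: gl Z.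
Proof.
have [x [y ->]] := cplxE a.
have [S [T [sS sT -> ->]]] := gl_rep_cart Z.
have [xS xT] := (skew_scale x sS, skew_scale x sT).
have [yS yT] := (skew_scale y sS, skew_scale y sT).
rewrite !scale_cart (gl_rep_skew (skewB xS yT) (skewD xT yS)).
rewrite (diffB prU xS yT) (diffD prU xT yS).
by rewrite (diffZ prU x sS) (diffZ prU x sT) (diffZ prU y sS) (diffZ prU y sT).
Qed.

Lemma bracket_cart n (A B A' B' : 'M[C]_n) :
  (A + ic *: B) *m (A' + ic *: B') - (A' + ic *: B') *m (A + ic *: B) =
  ((A *m A' - A' *m A) - (B *m B' - B' *m B)) +
  ic *: ((A *m B' - B' *m A) + (B *m A' - A' *m B)).
Proof.
rewrite !mulmxDl !mulmxDr -!scalemxAl -!scalemxAr !scalerA ic2 !scaleN1r.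
move: (A *m A') (A' *m A) (B *m B') (B' *m B) (A *m B') (B' *m A) (B *m A') (A' *m B).
by move=> *; apply/matrixP => i j; rewrite !mxE; ring.
Qed.

Lemma gl_rep_bracket Z Z' :
  gl (Z *m Z' - Z' *m Z) = gl Z *m gl Z' - gl Z' *m gl Z.
Proof.
have [S [T [sS sT -> ->]]] := gl_rep_cart Z.
have [S' [T' [sS' sT' -> ->]]] := gl_rep_cart Z'.
have b1 := skew_bracket sS sS'; have b2 := skew_bracket sT sT'.
have b3 := skew_bracket sS sT'; have b4 := skew_bracket sT sS'.
rewrite !bracket_cart (gl_rep_skew (skewB b1 b2) (skewD b3 b4)).
rewrite (diffB prU b1 b2) (diffD prU b3 b4).
rewrite (diff_bracket prU sS sS') (diff_bracket prU sT sT').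
by rewrite (diff_bracket prU sS sT') (diff_bracket prU sT sS').
Qed.

Lemma gl_rep_adj Z : gl (Z ^t*) = (gl Z) ^t*.
Proof.
have [S [T [sS sT -> ->]]] := gl_rep_cart Z.
have e p (A B : 'M[C]_p) : A ^t* = - A -> B ^t* = - B ->
    (A + ic *: B) ^t* = - A + ic *: B.
  by move=> sA sB; rewrite adjD adjZ sA sB conj_ic scaleNr scalerN opprK.
rewrite (e _ _ _ sS sT) (gl_rep_skew (skewN sS) sT) (diffN prU sS).
by rewrite (e _ _ _ (diff_adj prU sS) (diff_adj prU sT)).
Qed.

Lemma diff0 : diff 0 = 0.
Proof.
have s0 : (0 : 'M[C]_m) ^t* = - 0 by rewrite adj0 oppr0.
by have := diffD prU s0 s0; rewrite addr0 => /esym/eqP; rewrite -subr_eq0 addrK => /eqP.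
Qed.

Lemma gl_rep_diff X : X ^t* = - X -> gl X = diff X.
Proof.
move=> sX; have s0 : (0 : 'M[C]_m) ^t* = - 0 by rewrite adj0 oppr0.
by have := gl_rep_skew sX s0; rewrite diff0 !scaler0 !addr0.
Qed.

(** A linear condition on the group passes to first order terms. With [A = 1 - P] and [B = P] it
    takes invariant subspaces of the group to stable subspaces of the Lie algebra. *)
Lemma gl_rep_sub0 p q (A : 'M[C]_(p, N)) (B : 'M[C]_(N, q)) :
  (forall g, g \is unitarymx -> A *m pr g *m B = 0) ->
  forall Z, A *m gl Z *m B = 0.
Proof.
move=> AB0.
have AX0 X : X ^t* = - X -> A *m diff X *m B = 0.
  move=> sX; have j0 := jet_cst (0 : 'M[C]_(p, q)).
  have := jetMr B (jetMl A (diff_jet prU sX)).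
  have e t : A *m pr (exp (t%:c *: X)) *m B = 0 by exact: AB0 (expmx_unitary t sX).
  by move=> /(jet_ext e) j1; have [_ ->] := jet_uniq j1 j0.
move=> Z; have [S [T [sS sT _ ->]]] := gl_rep_cart Z.
move: (AX0 _ sS) (AX0 _ sT); move: (diff S) (diff T) => D E D0 E0.
by rewrite mulmx_lincomb D0 E0 scaler0 addr0.
Qed.

Lemma nrm_conj_pow (g Q : 'M[C]_N) k : g \is unitarymx ->
  nrm (g ^+ k *m Q *m (g ^+ k) ^t* - Q) <=
  k%:R * ((N * N)%:R * nrm (g *m Q *m g ^t* - Q) * (N * N)%:R).
Proof.
move=> gu; elim: k => [|k IHk].
  by rewrite expr0 adj1 mulmx1 mul1mx subrr nrm0 mul0r.
have -> : g ^+ k.+1 *m Q *m (g ^+ k.+1) ^t* - Q =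
    g ^+ k *m (g *m Q *m g ^t* - Q) *m (g ^+ k) ^t* +
    (g ^+ k *m Q *m (g ^+ k) ^t* - Q).
  by rewrite exprSr; exact: conj_telescope.
rewrite (le_trans (nrmD _ _)) // -natr1 mulrDl mul1r addrC lerD //.
have gk := unitary_exp k gu.
have gk' : (g ^+ k) ^t* \is unitarymx by rewrite trmxC_unitary.
rewrite (le_trans (nrmM _ _)) // ler_pM ?nrm_ge0 //; last exact: (nrm_unitary gk').
by rewrite (le_trans (nrmM _ _)) // ler_wpM2r ?nrm_ge0 //; exact: (nrm_unitary gk).
Qed.

(* Conjugation of [Q] by [pr (exp (t X))] has vanishing first order term, so
   splitting [exp X] into [n] equal factors moves [Q] by [n * O(1 / n^2)]. *)
Lemma gl_rep_comm (Q : 'M[C]_N) : (forall Z, gl Z *m Q = Q *m gl Z) ->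
  forall g, g \is unitarymx -> pr g *m Q = Q *m pr g.
Proof.
move=> comQ g /expmx_surj[X [sX gE]].
have gu : g \is unitarymx.
  by rewrite gE -[X]scale1r -(rmorph1 (@rc R)); exact: expmx_unitary.
suff E : pr g *m Q *m (pr g) ^t* = Q.
  by rewrite -[in RHS]E -mulmxA (unitaryV (urep_unitary prU gu)) mulmx1.
apply/eqP; rewrite -subr_eq0; apply/eqP/nrm_le0.
have := jet_conj_skew Q (diff_jet prU sX) (diff_adj prU sX).
rewrite -gl_rep_diff // comQ subrr => -[L LP].
apply: (@le_archi _ _ _ ((N * N)%:R * L * (N * N)%:R)) => n n0; rewrite add0r.
have n0' : 0 < n%:R :> R by rewrite ltr0n.
pose u := exp (n%:R^-1%:c *: X).
have uu : u \is unitarymx by exact: expmx_unitary.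
have un k : exp ((k%:R / n%:R)%:c *: X) = u ^+ k.
  elim: k => [|k IHk]; first by rewrite mul0r expr0 expmx0.
  by rewrite -natr1 mulrDl mul1r expmxD // IHk exprSr.
have -> : pr g = pr u ^+ n.
  by rewrite -(urep_exp prU n uu) -un mulfV ?gt_eqF // rmorph1 scale1r gE.
apply: (le_trans (nrm_conj_pow _ _ (urep_unitary prU uu))).
have := LP n%:R^-1; rewrite scaler0 subr0 -/u ger0_norm ?invr_ge0 //.
rewrite invf_le1 // ler1n => /(_ n0) h.
apply: (@le_trans _ _ (n%:R * ((N * N)%:R * (L * n%:R^-1 ^+ 2) * (N * N)%:R))).
  by rewrite ler_wpM2l // ler_wpM2r // ler_wpM2l.
rewrite le_eqVlt; apply/orP; left; apply/eqP; field.
by rewrite gt_eqF.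
Qed.

End GlRep.

(** * Highest weight theory of hermitian gl(m)-actions *)

Section HermitianSpace.
Variable C : numClosedFieldType.
Local Close Scope complex_scope.

Definition inner n (u v : 'cV[C]_n) : C := (u ^t* *m v) 0 0.

Section Inner.
Variable n : nat.
Implicit Types u v w : 'cV[C]_n.

Lemma innerE u v : inner u v = \sum_i (u i 0)^* * v i 0.
Proof. by rewrite /inner mxE; apply: eq_bigr => i _; rewrite !mxE. Qed.

Lemma inner_mx u v : u ^t* *m v = (inner u v)%:M.
Proof. exact: mx11_scalar. Qed.

Lemma innerDr u v w : inner u (v + w) = inner u v + inner u w.
Proof. by rewrite /inner mulmxDr mxE. Qed.

Lemma innerZr u a v : inner u (a *: v) = a * inner u v.
Proof. by rewrite /inner -scalemxAr mxE. Qed.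

Lemma innerZl u a v : inner (a *: u) v = a^* * inner u v.
Proof. by rewrite /inner adjZ -scalemxAl mxE. Qed.

Lemma innerBr u v w : inner u (v - w) = inner u v - inner u w.
Proof. by rewrite innerDr -scaleN1r innerZr mulN1r. Qed.

Lemma inner0r u : inner u 0 = 0.
Proof. by rewrite /inner mulmx0 mxE. Qed.

Lemma inner_adj (A : 'M[C]_n) u v : inner u (A *m v) = inner (A ^t* *m u) v.
Proof. by rewrite /inner adj_mul trmxCK mulmxA. Qed.

Lemma innerC u v : inner u v = (inner v u)^*.
Proof.
rewrite !innerE rmorph_sum; apply: eq_bigr => i _.
by rewrite rmorphM /= conjCK mulrC.
Qed.

Lemma inner_ge0 u : 0 <= inner u u.
Proof. by rewrite innerE; apply: sumr_ge0 => i _; rewrite mulrC mul_conjC_ge0. Qed.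

Lemma inner_eq0 u : (inner u u == 0) = (u == 0).
Proof.
apply/eqP/eqP => [|->]; last exact: inner0r.
rewrite innerE => /eqP; rewrite psumr_eq0 => [/allP u0|i _]; last first.
  by rewrite mulrC mul_conjC_ge0.
apply/colP => i; have := u0 i (mem_index_enum i).
by rewrite mulrC mul_conjC_eq0 mxE => /eqP.
Qed.

Lemma colmx_ext p (A B : 'M[C]_(p, n)) : (forall v : 'cV_n, A *m v = B *m v) -> A = B.
Proof.
move=> AB; apply/matrixP => i j; have /matrixP/(_ i 0) := AB (delta_mx j 0).
by rewrite -!colE !mxE.
Qed.

(** Gram-Schmidt: a new generator [x] adds the rank one projector on [w], its part orthogonal to the
    span already treated. *)
Lemma orth_projector (W : {vspace 'cV[C]_n}) : exists P : 'M[C]_n,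
  [/\ P ^t* = P, forall v, P *m v \in W & forall v, v \in W -> P *m v = v].
Proof.
have [s <-] : exists s, span s = W by exists (vbasis W); exact: span_basis (vbasisP W).
elim: s => [|x s [P [Padj PW PE]]].
  exists 0; split=> [|v|v]; rewrite ?adj0 ?mul0mx ?mem0v //.
  by rewrite span_nil memv0 => /eqP ->.
have sub y : y \in (span s) -> y \in (span (x :: s)).
  by move=> ys; rewrite span_cons; apply: subvP ys; exact: addvSr.
have xin : x \in (span (x :: s)) by apply: memv_span; exact: mem_head.
pose w := x - P *m x.
have PP (y : 'cV[C]_n) : P *m (P *m y) = P *m y by exact: PE (PW y).
have Pw : P *m w = 0 by rewrite mulmxBr PP subrr.
have [w0|w0] := eqVneq w 0.
  exists P; split=> [//|v|v]; first exact: sub.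
  have xs : x \in (span s) by move/eqP: w0; rewrite subr_eq0 => /eqP ->.
  by rewrite span_cons => /memv_addP[y /vlineP[a ->] [z zs ->]]; apply: PE; rewrite memvD ?memvZ.
have ww0 : inner w w != 0 by rewrite inner_eq0.
exists (P + (inner w w)^-1 *: (w *m w ^t*)).
have PvE v : (P + (inner w w)^-1 *: (w *m w ^t*)) *m v =
    P *m v + ((inner w w)^-1 * inner w v) *: w.
  by rewrite mulmxDl -scalemxAl -mulmxA inner_mx mul_mx_scalar scalerA.
have win : w \in (span (x :: s)) by rewrite memvB // sub.
split=> [|v|v].
- rewrite adjD adjZ adj_mul trmxCK Padj fmorphV /=.
  by rewrite -innerC.
- by rewrite PvE; apply: memvD; [exact/sub/PW|exact: memvZ].
rewrite span_cons => vW.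
have [a [z [zs ->]]] : exists (a : C) z, z \in span s /\ v = a *: x + z.
  by move: vW => /memv_addP[y /vlineP[a ->] [z zs ->]]; exists a, z.
rewrite PvE mulmxDr -scalemxAr (innerDr _ (a *: x)) innerZr.
have -> : inner w z = 0 by rewrite -(PE z zs) inner_adj Padj Pw /inner adj0 mul0mx mxE.
have -> : inner w x = inner w w.
  by rewrite -[in LHS](subrK (P *m x) x) -/w innerDr (inner_adj P) Padj Pw /inner adj0 mul0mx [X in _ + X]mxE addr0.
rewrite (PE z zs) addr0 mulrCA mulVf // mulr1.
by rewrite addrAC -scalerDr /w [P *m x + _]addrC subrK.
Qed.

End Inner.

(** A subspace of maximal dimension inside [Q] exhausts [Q], since a missing vector could be
    adjoined. Conditions such as eigenvalue equations thereby define subspaces. *)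
Lemma pred_vspace (V : vectType C) (Q : V -> Prop) : Q 0 ->
  (forall a u v, Q u -> Q v -> Q (a *: u + v)) ->
  exists W : {vspace V}, forall v, v \in W <-> Q v.
Proof.
move=> Q0 Qlin.
pose sub (d : nat) := `[< exists W : {vspace V}, \dim W = d /\ forall v, v \in W -> Q v >].
have ex0 : exists d, sub d.
  by exists 0%N; apply/asboolP; exists 0%VS; rewrite dimv0; split=> // v; rewrite memv0 => /eqP ->.
have bound d : sub d -> (d <= \dim (fullv : {vspace V}))%N.
  by move=> /asboolP[W [<- _]]; rewrite dimvS ?subvf.
case: (ex_maxnP ex0 bound) => d /asboolP[W [dW WQ]] dmax.
exists W => v; split=> [/WQ//|Qv]; apply: contrapT => /negP vW.
have /dmax : sub (\dim (<[v]> + W)%VS).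
  apply/asboolP; exists (<[v]> + W)%VS; split=> // x.
  by move=> /memv_addP[y /vlineP[a ->] [z /WQ Qz ->]]; exact: Qlin.
rewrite -dW leqNgt => /negP; apply.
rewrite ltn_neqAle dimvS ?addvSr // andbT.
apply: contraNneq vW => dE.
have /eqP -> : W == (<[v]> + W)%VS by rewrite eqEdim addvSr dE /=.
by apply: subvP (addvSl _ _) _ _; exact: memv_line.
Qed.

End HermitianSpace.

Section HighestWeight.
Variables (C : numClosedFieldType) (m N : nat).
Local Close Scope complex_scope.
Variable F : 'I_m -> 'I_m -> 'M[C]_N.
Implicit Types (a b c d i j k : 'I_m) (u v x : 'cV[C]_N) (l : 'I_m -> C)
  (W U : {vspace 'cV[C]_N}).

(** [F a b] stands for the image of the matrix unit e_ab: the relations are those of gl(m), and the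
    first condition says that u(m) acts by skew-hermitian operators. *)
Definition gl_action : Prop :=
  (forall a b, (F a b) ^t* = F b a) /\
  (forall a b c d, F a b *m F c d - F c d *m F a b =
     (b == c)%:R *: F a d - (d == a)%:R *: F c b).

Definition hwv l v : Prop :=
  [/\ v != 0, forall k, F k k *m v = l k *: v &
      forall j k, (j < k)%N -> F j k *m v = 0].

Definition stable W : Prop := forall a b v, v \in W -> F a b *m v \in W.

Definition simple W : Prop :=
  [/\ W <> 0%VS, stable W &
      forall U, stable U -> (U <= W)%VS -> U = 0%VS \/ U = W].

Definition casimir : 'M[C]_N := \sum_a \sum_b F a b *m F b a.

Hypothesis FP : gl_action.

Lemma act_adj a b : (F a b) ^t* = F b a. Proof. by case: FP. Qed.

Lemma act_bracket a b c d : F a b *m F c d - F c d *m F a b =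
  (b == c)%:R *: F a d - (d == a)%:R *: F c b.
Proof. by case: FP. Qed.

Lemma act_swap a b c d : F a b *m F c d = F c d *m F a b +
  ((b == c)%:R *: F a d - (d == a)%:R *: F c b).
Proof. by rewrite -act_bracket addrC subrK. Qed.

Lemma act_swapv a b c d v : F a b *m (F c d *m v) = F c d *m (F a b *m v) +
  ((b == c)%:R *: (F a d *m v) - (d == a)%:R *: (F c b *m v)).
Proof.
by rewrite mulmxA act_swap mulmxDl mulmxBl -!scalemxAl !mulmxA.
Qed.

Lemma sum_pick (V : lmodType C) (G : 'I_m -> V) c :
  \sum_b (b == c)%:R *: G b = G c.
Proof.
rewrite (bigD1 c) //= eqxx scale1r big1 ?addr0 // => b /negbTE ->.
by rewrite scale0r.
Qed.

(** The bracket formula leaves four single sums, which cancel in pairs. *)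
Lemma casimir_comm c d : casimir *m F c d = F c d *m casimir.
Proof.
apply/eqP; rewrite -subr_eq0 /casimir mulmx_suml mulmx_sumr -sumrB; apply/eqP.
transitivity (\sum_a \sum_b
   (((a == c)%:R *: (F a b *m F b d) - (d == b)%:R *: (F a b *m F c a)) +
    ((b == c)%:R *: (F a d *m F b a) - (d == a)%:R *: (F c b *m F b a)))).
  apply: eq_bigr => a _; rewrite mulmx_suml mulmx_sumr -sumrB.
  apply: eq_bigr => b _.
  have -> : F a b *m F b a *m F c d - F c d *m (F a b *m F b a) =
      F a b *m (F b a *m F c d - F c d *m F b a) +
      (F a b *m F c d - F c d *m F a b) *m F b a.
    by rewrite mulmxBr mulmxBl !mulmxA addrA subrK.
  rewrite !act_bracket mulmxBr mulmxBl -!scalemxAr -!scalemxAl.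
  by [].
under eq_bigr do rewrite big_split /= !sumrB.
rewrite big_split /= !sumrB.
have -> : \sum_a \sum_b (a == c)%:R *: (F a b *m F b d) = \sum_b F c b *m F b d.
  by under eq_bigr do rewrite -scaler_sumr; rewrite sum_pick.
have -> : \sum_a \sum_b (d == b)%:R *: (F a b *m F c a) = \sum_a F a d *m F c a.
  by apply: eq_bigr => a _; under eq_bigr do rewrite eq_sym; rewrite sum_pick.
have -> : \sum_a \sum_b (b == c)%:R *: (F a d *m F b a) = \sum_a F a d *m F c a.
  by apply: eq_bigr => a _; rewrite sum_pick.
have -> : \sum_a \sum_b (d == a)%:R *: (F c b *m F b a) = \sum_b F c b *m F b d.
  under eq_bigr do rewrite eq_sym -scaler_sumr.
  by rewrite sum_pick.
by rewrite addrC addrA subrK subrr.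
Qed.

(** With the raising factor moved to the right, each F_ab F_ba acts on [v] by a scalar. *)
Lemma casimir_hwv l v : hwv l v -> exists c : C, casimir *m v = c *: v.
Proof.
move=> [_ lv up].
have H a b : exists e, F a b *m (F b a *m v) = e *: v.
  have [ab|ba|/val_inj ab] := ltngtP a b.
  - exists (l a - l b); rewrite act_swapv (up _ _ ab) mulmx0 add0r !eqxx !scale1r.
    by rewrite !lv -scalerBl.
  - by exists 0; rewrite (up _ _ ba) mulmx0 scale0r.
  - by exists (l a * l a); rewrite -ab !lv -scalemxAr lv scalerA.
have [e eP] := choice (fun ab : 'I_m * 'I_m => H ab.1 ab.2).
exists (\sum_a \sum_b e (a, b)).
rewrite /casimir mulmx_suml scaler_suml; apply: eq_bigr => a _.
rewrite mulmx_suml scaler_suml; apply: eq_bigr => b _.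
by rewrite -mulmxA (eP (a, b)).
Qed.

Lemma hwv_real l v k : hwv l v -> (l k)^* = l k.
Proof.
move=> [v0 lv _]; have : inner v (F k k *m v) = inner (F k k *m v) v.
  by rewrite inner_adj act_adj.
by rewrite lv innerZr innerZl => /mulIf <- //; rewrite inner_eq0.
Qed.

(** For a < b, the squared length of the lowered vector F_ba v is (l a - l b) times that of [v]. *)
Lemma hwv_dominant l v a b : hwv l v -> (a <= b)%N -> l b <= l a.
Proof.
move=> [v0 lv up]; rewrite leq_eqVlt => /orP[/eqP/val_inj -> //|ab].
have : 0 <= inner (F b a *m v) (F b a *m v) by exact: inner_ge0.
rewrite inner_adj act_adj act_swapv (up _ _ ab) mulmx0 add0r !eqxx !scale1r.
rewrite !lv -scalerBl innerC innerZr rmorphM /= -innerC.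
have vv : 0 < inner v v by rewrite lt0r inner_eq0 v0 inner_ge0.
rewrite pmulr_lge0 // rmorphB /=.
by rewrite !(@hwv_real l v) ?subr_ge0 //; split.
Qed.

(** The span of [v] under words in lowering operators alone, which [generated_orth] can test through
    raising adjoints. *)
Inductive generated v : 'cV[C]_N -> Prop :=
| GenBase : generated v v
| Gen0 : generated v 0
| GenLin e x y : generated v x -> generated v y -> generated v (e *: x + y)
| GenLower a b x : (b < a)%N -> generated v x -> generated v (F a b *m x).

Lemma generatedZ v e x : generated v x -> generated v (e *: x).
Proof. by move=> vx; rewrite -[e *: x]addr0; apply: GenLin => //; exact: Gen0. Qed.

Lemma generatedD v x y : generated v x -> generated v y -> generated v (x + y).
Proof. by move=> vx; rewrite -[x]scale1r; exact: GenLin. Qed.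

(** Any operator is commuted past the lowering ones until it meets [v]; the commutator terms act on
    the shorter word [x], to which the induction hypothesis applies. *)
Lemma generated_act l v x : hwv l v -> generated v x ->
  forall a b, generated v (F a b *m x).
Proof.
move=> [_ lv up]; elim=> {x} [||e x y _ IHx _ IHy|c d x dc vx IHx] a b.
- have [ab|ba|/val_inj ab] := ltngtP a b.
  + by rewrite up //; exact: Gen0.
  + by apply: GenLower => //; exact: GenBase.
  + by rewrite -ab lv; apply: generatedZ; exact: GenBase.
- by rewrite mulmx0; exact: Gen0.
- by rewrite mulmxDr -scalemxAr; exact: GenLin.
rewrite act_swapv; apply: generatedD; first exact: GenLower.
by rewrite addrC -scaleNr; apply: GenLin => //; exact: generatedZ.
Qed.

(* A highest weight vector orthogonal to [v] is orthogonal to everything that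
   lowering operators produce from [v], since their adjoints are raising. *)
Lemma generated_orth l u v x : hwv l u -> inner u v = 0 -> generated v x ->
  inner u x = 0.
Proof.
move=> [_ _ up] uv; elim=> {x} [||e x y _ IHx _ IHy|a b x ba _ _] //.
- exact: inner0r.
- by rewrite innerDr innerZr IHx IHy mulr0 addr0.
by rewrite inner_adj act_adj up // /inner adj0 mul0mx mxE.
Qed.

(** Irreducibility as an induction principle: the vectors of [W] that satisfy [Q] form a nonzero
    stable subspace. *)
Lemma simple_sub W (Q : 'cV[C]_N -> Prop) : simple W -> Q 0 ->
  (forall e x y, Q x -> Q y -> Q (e *: x + y)) ->
  (forall a b x, x \in W -> Q x -> Q (F a b *m x)) ->
  (exists v, [/\ v \in W, v != 0 & Q v]) -> forall x, x \in W -> Q x.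
Proof.
move=> [_ stW simW] Q0 Qlin QF [v [vW v0 Qv]] x xW.
have [|e y z [yW Qy] [zW Qz]|U UP] :=
    @pred_vspace C _ (fun y : 'cV[C]_N => y \in W /\ Q y).
- by split; rewrite ?mem0v.
- by split; [rewrite memvD ?memvZ|exact: Qlin].
have stU : stable U.
  by move=> a b y /UP[yW Qy]; apply/UP; split; [exact: stW|exact: QF].
have UW : (U <= W)%VS by apply/subvP => y /UP[].
have [U0|UE] := simW U stU UW.
  have : v \in U by apply/UP.
  by rewrite U0 memv0 (negbTE v0).
by have /UP[] : x \in U by rewrite UE.
Qed.

(** If <u, v> is nonzero, the hermitian F_jj give both the same weight. Otherwise [u] is orthogonal
    to everything generated by [v], which is all of [W], hence to itself. *)
Lemma hwv_unique W l l' u v : simple W -> u \in W -> v \in W ->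
  hwv l u -> hwv l' v -> l =1 l'.
Proof.
move=> simW uW vW hu hv j.
have [uv0|uv0] := eqVneq (inner u v) 0.
  have [u0 _ _] := hu; have [v0 _ _] := hv.
  have vgen : generated v u.
    apply: (simple_sub simW) uW.
    - exact: Gen0.
    - by move=> *; exact: GenLin.
    - by move=> a b x _ vx; exact: generated_act hv vx a b.
    - by exists v; split=> //; exact: GenBase.
  by have /eqP := generated_orth hu uv0 vgen; rewrite inner_eq0 (negbTE u0).
have [_ lu _] := hu; have [_ lv _] := hv.
have : inner u (F j j *m v) = inner (F j j *m u) v by rewrite inner_adj act_adj.
by rewrite lu lv innerZr innerZl (hwv_real j hu) => /mulIf ->.
Qed.

Lemma casimir_simple W l v : simple W -> v \in W -> hwv l v ->
  exists c : C, forall x, x \in W -> casimir *m x = c *: x.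
Proof.
move=> simW vW hv; have [c vc] := casimir_hwv hv; exists c.
have [v0 _ _] := hv.
apply: (simple_sub simW).
- by rewrite mulmx0 scaler0.
- by move=> e x y xc yc; rewrite mulmxDr -scalemxAr xc yc scalerDr !scalerA mulrC.
- by move=> a b x _ xc; rewrite mulmxA casimir_comm -mulmxA xc scalemxAr.
- by exists v.
Qed.

End HighestWeight.

(** * Existence of highest weight vectors and complete reducibility *)

Section Eigenvectors.
Variable C : numClosedFieldType.
Local Close Scope complex_scope.

(** Cayley-Hamilton with the characteristic polynomial split into linear factors. As a chain of
    applications of [A - z] it never leaves a stable subspace containing [v], and the last nonzero
    vector of the chain is an eigenvector. *)
Lemma char_poly_annihilates n (A : 'M[C]_n) (v : 'cV[C]_n) :
  exists rs : seq C, foldl (fun w z => A *m w - z *: w) v rs = 0.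
Proof.
case: n A v => [|n] A v; first by exists [::]; apply/matrixP => -[].
have [rs pE] := closed_field_poly_normal (char_poly A).
have := Cayley_Hamilton A.
rewrite pE (monicP (char_poly_monic A)) scale1r rmorph_prod /= => prod0.
exists rs; have : (\prod_(z <- rs) horner_mx A ('X - z%:P)) *m v = 0.
  by rewrite prod0 mul0mx.
move=> {pE prod0} prod0; rewrite -[RHS]prod0 {prod0}.
elim: rs v => [|z rs IHrs] v; first by rewrite big_nil mul1mx.
have step : A *m v - z *: v = horner_mx A ('X - z%:P) *m v.
  by rewrite rmorphB /= horner_mx_X horner_mx_C mulmxBl mul_scalar_mx.
rewrite big_cons /= IHrs step mulmxA; congr (_ *m _).
rewrite -[_ *m _]/(_ * _) -rmorph_prod /= -!rmorphM /=.
by rewrite mulrC.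
Qed.

Lemma eigenvector_in N (A : 'M[C]_N) (W : {vspace 'cV[C]_N}) :
  W <> 0%VS -> (forall x, x \in W -> A *m x \in W) ->
  exists e v, [/\ v \in W, v != 0 & A *m v = e *: v].
Proof.
move=> /eqP; rewrite -vpick0; set v := vpick W => v0 AW.
have vW : v \in W := memv_pick W.
have [rs] := char_poly_annihilates A v.
elim: rs v v0 vW => [|z rs IHrs] v v0 vW /=; first by move=> /eqP; rewrite (negbTE v0).
have [/eqP Av _|Av] := eqVneq (A *m v - z *: v) 0.
  by exists z, v; split=> //; apply/eqP; rewrite -subr_eq0.
by apply: IHrs => //; rewrite memvB ?memvZ // AW.
Qed.

End Eigenvectors.

Section HighestWeightExists.
Variables (C : numClosedFieldType) (m N : nat).
Local Close Scope complex_scope.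
Variable F : 'I_m -> 'I_m -> 'M[C]_N.
Implicit Types (a b i j k : 'I_m) (u v x : 'cV[C]_N) (l : 'I_m -> C)
  (W U : {vspace 'cV[C]_N}).
Hypothesis FP : gl_action F.

Lemma cartan_comm j k v : F j j *m (F k k *m v) = F k k *m (F j j *m v).
Proof.
rewrite (act_swapv FP); have [->|jk] := eqVneq j k.
  by rewrite subrr addr0.
by rewrite !scale0r subr0 addr0.
Qed.

Lemma joint_eigenvector W : W <> 0%VS -> (forall k x, x \in W -> F k k *m x \in W) ->
  exists l v, [/\ v \in W, v != 0 & forall k, F k k *m v = l k *: v].
Proof.
move=> W0 WF.
suff [v [vW v0 vl]] : exists v, [/\ v \in W, v != 0 &
    forall k, k \in enum 'I_m -> exists e : C, F k k *m v = e *: v].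
  have [l lP] := choice (fun k => vl k (mem_enum _ k)).
  by exists l, v.
elim: (enum 'I_m) W W0 WF => [|k ks IHks] W W0 WF.
  exists (vpick W); split=> //; first exact: memv_pick.
  by rewrite vpick0; apply/eqP.
have [e [v [vW v0 ve]]] := eigenvector_in W0 (WF k).
have [||W' W'P] := @pred_vspace C _ (fun y : 'cV[C]_N => y \in W /\ F k k *m y = e *: y).
- by rewrite mem0v mulmx0 scaler0.
- move=> c x y [xW xe] [yW ye]; split; first by rewrite memvD ?memvZ.
  by rewrite mulmxDr -scalemxAr xe ye scalerDr !scalerA mulrC.
have [|j x /W'P[xW xe]|u [/W'P[uW ue] u0 uP]] := IHks W'.
- by move=> W'0; have /W'P : v \in W /\ F k k *m v = e *: v by []; rewrite W'0 memv0 (negbTE v0).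
- by apply/W'P; split; [exact: WF|rewrite cartan_comm xe -scalemxAr].
exists u; split=> // j; rewrite in_cons => /orP[/eqP ->|/uP//].
by exists e.
Qed.

(* Raising operators strictly increase the eigenvalue of [H], which has at most
   [N] of them. *)
Lemma hwv_exists W : W <> 0%VS -> stable F W -> exists l v, v \in W /\ hwv F l v.
Proof.
move=> W0 stW.
(* The coefficients strictly decrease in [k], so adding mu a - mu b with a < b, which is the effect
   of F_ab on weights, increases [h]. *)
pose h l := \sum_(k < m) (m - k)%:R * l k.
pose H := \sum_(k < m) (m - k)%:R *: F k k.
have hH l v : v != 0 -> (forall k, F k k *m v = l k *: v) ->
    root (char_poly H^T) (h l).
  move=> v0 vl; rewrite -eigenvalue_root_char; apply/eigenvalueP.
  exists v^T; last by rewrite trmx_eq0.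
  rewrite -trmx_mul -linearZ /=; congr trmx.
  rewrite /H /h mulmx_suml scaler_suml; apply: eq_bigr => k _.
  by rewrite -scalemxAl vl scalerA.
suff Hn n : (exists l v, v \in W /\ hwv F l v) \/
    (exists rs l v, [/\ size rs = n, uniq rs, all (root (char_poly H^T)) rs,
      (forall r, r \in rs -> r < h l) & [/\ v \in W, v != 0 &
      forall k, F k k *m v = l k *: v]]).
  have [//|[rs [l [v [srs urs rrs _ _]]]]] := Hn N.+1.
  have := max_poly_roots (monic_neq0 (char_poly_monic _)) rrs urs.
  by rewrite srs size_char_poly ltnn.
elim: n => [|n [|[rs [l [v [srs urs rrs rsl [vW v0 vl]]]]]]].
- right; have [l [v lv]] := joint_eigenvector W0 (fun k => stW k k).
  by exists [::], l, v.
- by left.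
have [[a [b [ab Fv]]]|nex] := pselect (exists a b, (a < b)%N /\ F a b *m v != 0); last first.
  left; exists l, v; split=> //; split=> // a b ab; apply: contrapT => /eqP Fv.
  by apply: nex; exists a, b.
right; exists (h l :: rs), (fun k => l k + ((k == a)%:R - (b == k)%:R)), (F a b *m v).
have hl : h l < h (fun k => l k + ((k == a)%:R - (b == k)%:R)).
  have pick (c : 'I_m) : \sum_(k < m) (m - k)%:R * (k == c)%:R = (m - c)%:R :> C.
    rewrite (bigD1 c) //= eqxx mulr1 big1 ?addr0 // => k /negbTE ->.
    by rewrite mulr0.
  rewrite /h; under [ltRHS]eq_bigr => k _ do rewrite mulrDr mulrBr [b == k]eq_sym.
  rewrite big_split /= sumrB !pick ltrDl subr_gt0 ltr_nat.
  by rewrite ltn_sub2l.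
split=> [/=||||].
- by rewrite srs.
- by rewrite /= urs andbT; apply/negP => /rsl; rewrite ltxx.
- by rewrite /= rrs andbT (hH l v).
- by move=> r; rewrite in_cons => /orP[/eqP ->//|/rsl rl]; exact: lt_trans hl.
split=> // [|k]; first exact: stW.
rewrite (act_swapv FP) vl -scalemxAr scalerDl scalerBl; congr (_ + (_ - _)).
  by have [->|] := eqVneq k a; rewrite ?scale0r.
by have [->|] := eqVneq b k; rewrite ?scale0r.
Qed.

(** The orthogonal complement of [U] in [W]; it is stable because the adjoint of F_ab is F_ba. *)
Lemma stable_complement W U : stable F W -> stable F U ->
  exists U', [/\ stable F U', (U' <= W)%VS,
    forall x, x \in U' -> x \in U -> x = 0 &
    forall x, x \in W -> (U <= W)%VS -> exists y z, [/\ y \in U, z \in U' & x = y + z]].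
Proof.
move=> stW stU; have [P [Padj PU PE]] := orth_projector U.
have [||U' U'P] := @pred_vspace C _ (fun y : 'cV[C]_N => y \in W /\ P *m y = 0).
- by rewrite mem0v mulmx0.
- move=> c x y [xW xe] [yW ye]; split; first by rewrite memvD ?memvZ.
  by rewrite mulmxDr -scalemxAr xe ye scaler0 addr0.
exists U'; split.
- move=> a b x /U'P[xW Px]; apply/U'P; split; first exact: stW.
  apply/eqP; rewrite -inner_eq0 inner_adj Padj (PE _ (PU _)) inner_adj (act_adj FP).
  by rewrite -(PE _ (stU b a _ (PU _))) -{1}Padj -inner_adj Px inner0r.
- by apply/subvP => x /U'P[].
- by move=> x /U'P[_ Px] /PE; rewrite Px.
move=> x xW UW; exists (P *m x), (x - P *m x); split=> //; last by rewrite addrC subrK.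
have PxW : P *m x \in W by exact: subvP UW _ (PU x).
by apply/U'P; split; [rewrite memvB|rewrite mulmxBr (PE _ (PU x)) subrr].
Qed.

Lemma simple_in W : W <> 0%VS -> stable F W -> exists U, simple F U /\ (U <= W)%VS.
Proof.
have [n] := ubnP (\dim W); elim: n W => // n IHn W; rewrite ltnS => dW W0 stW.
have [simW|nsimW] := pselect (simple F W); first by exists W; rewrite subvv.
have [U [stU UW [U0 UneqW]]] : exists U, [/\ stable F U, (U <= W)%VS & U <> 0%VS /\ U <> W].
  apply: contrapT => nex; apply: nsimW; split=> // U stU UW.
  apply: contrapT => nor; apply: nex; exists U; split=> //; split=> UE; apply: nor.
    by left.
  by right.
have [|V [simV VU]] := IHn U _ U0 stU; last by exists V; rewrite (subv_trans VU).
rewrite (leq_trans _ dW) // ltn_neqAle dimvS // andbT; apply/eqP => dE.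
by apply: UneqW; apply/eqP; rewrite eqEdim UW dE /=.
Qed.

(** Simple subspaces are split off one at a time. The predicates [comp] only have to absorb the
    simple subspace just found, so they may be given as bare sets of vectors. *)
Lemma isotypic_decomposition (comp : 'I_m -> 'cV[C]_N -> Prop) :
  (forall i, comp i 0) ->
  (forall U l v, simple F U -> v \in U -> hwv F l v ->
    exists i, forall x y, x \in U -> comp i y -> comp i (x + y)) ->
  forall W, stable F W -> forall x, x \in W ->
    exists y : 'I_m -> 'cV[C]_N, (forall i, comp i (y i)) /\ x = \sum_i y i.
Proof.
move=> comp0 compD W; have [n] := ubnP (\dim W).
elim: n W => // n IHn W; rewrite ltnS => dW stW x xW.
have [/eqP W0|/eqP W0] := eqVneq W 0%VS.
  exists (fun=> 0); split=> //; rewrite big1 //.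
  by move: xW; rewrite (eqP W0) memv0 => /eqP.
have [U [simU UW]] := simple_in W0 stW.
have [U0 stU _] := simU.
have [U' [stU' U'W UU' dec]] := stable_complement stW stU.
have [y [z [yU zU' xE]]] := dec x xW UW.
have [l [v [vU hv]]] := hwv_exists U0 stU.
have [i iP] := compD U l v simU vU hv.
have [|z' [z'P zE]] := IHn U' _ stU' z zU'.
  rewrite (leq_trans _ dW) // ltn_neqAle dimvS // andbT; apply/eqP => dE.
  have U'E : U' = W by apply/eqP; rewrite eqEdim U'W dE /=.
  have [v0 _ _] := hv; move/eqP: v0; apply; apply: UU' => //.
  by rewrite U'E; exact: subvP UW _ vU.
exists (fun j => (if j == i then y else 0) + z' j); split=> [j|].
  have [->|_] := eqVneq j i; first exact: iP.
  by rewrite add0r.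
by rewrite big_split /= -zE -big_mkcond big_pred1_eq.
Qed.

End HighestWeightExists.

(** * Tensor products with the natural representation and its conjugate *)

Section Blocks.
Variables (C : numClosedFieldType) (m N L : nat).
Local Close Scope complex_scope.
Variable J : 'I_m -> 'M[C]_(L, N).
Hypothesis JJ : forall i j, (J i) ^t* *m J j = (i == j)%:R%:M.
Hypothesis JJ1 : \sum_i J i *m (J i) ^t* = 1%:M.
Implicit Types (G H : 'I_m -> 'I_m -> 'M[C]_N) (a b i j k l : 'I_m).

(** [J k] plays the role of phi |-> phi (x) eps_k. Thus [G k l] is the block in row k and column l
    of an operator on V (x) C^m, and [diag_blk A] is A (x) 1. *)
Definition blk G : 'M[C]_L := \sum_k \sum_l J k *m G k l *m (J l) ^t*.

Definition diag_blk (A : 'M[C]_N) : 'M[C]_L := \sum_j J j *m A *m (J j) ^t*.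

Lemma sum_delta (V : lmodType C) (f : 'I_m -> V) i :
  \sum_j (i == j)%:R *: f j = f i.
Proof. by under eq_bigr do rewrite eq_sym; rewrite sum_pick. Qed.

Lemma J_blk G k : (J k) ^t* *m blk G = \sum_l G k l *m (J l) ^t*.
Proof.
rewrite /blk mulmx_sumr -(sum_delta (fun k => \sum_l G k l *m (J l) ^t*) k).
apply: eq_bigr => i _; rewrite mulmx_sumr scaler_sumr; apply: eq_bigr => l _.
by rewrite -mulmxA mulmxA JJ mul_scalar_mx.
Qed.

Lemma J_blk_J G k l : (J k) ^t* *m blk G *m J l = G k l.
Proof.
rewrite J_blk mulmx_suml (bigD1 l) //= -mulmxA JJ eqxx mulmx1 big1 ?addr0 //.
by move=> i /negbTE il; rewrite -mulmxA JJ il raddf0 mulmx0.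
Qed.

Lemma blkM G H : blk G *m blk H = blk (fun k l => \sum_i G k i *m H i l).
Proof.
rewrite {1 3}/blk mulmx_suml; apply: eq_bigr => k _.
rewrite mulmx_suml.
transitivity (\sum_i \sum_l J k *m (G k i *m H i l) *m (J l) ^t*).
  apply: eq_bigr => i _; rewrite -mulmxA J_blk mulmx_sumr; apply: eq_bigr => l _.
  by rewrite !mulmxA.
rewrite exchange_big; apply: eq_bigr => l _.
by rewrite mulmx_sumr mulmx_suml.
Qed.

Lemma blk1 : blk (fun k l => (k == l)%:R%:M) = 1%:M.
Proof.
rewrite -JJ1 /blk; apply: eq_bigr => k _; rewrite (bigD1 k) //= eqxx mulmx1.
rewrite big1 ?addr0 // => l; rewrite eq_sym => /negbTE ->.
by rewrite raddf0 mulmx0 mul0mx.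
Qed.

Fixpoint blk_pow G q k l : 'M[C]_N :=
  if q is q'.+1 then \sum_i G k i *m blk_pow G q' i l else (k == l)%:R%:M.

Lemma blk_exp G q : blk G ^+ q = blk (blk_pow G q).
Proof.
elim: q => [|q IHq]; first by rewrite expr0 blk1.
by rewrite exprS IHq -[_ * _]/(_ *m _) blkM.
Qed.

Lemma blk_adj G : (forall k l, (G k l) ^t* = G l k) -> (blk G) ^t* = blk G.
Proof.
move=> GG; rewrite /blk adj_sum exchange_big; apply: eq_bigr => k _.
rewrite adj_sum; apply: eq_bigr => l _.
by rewrite !adj_mul trmxCK GG mulmxA.
Qed.

Lemma J_diag_blk A k : (J k) ^t* *m diag_blk A = A *m (J k) ^t*.
Proof.
rewrite /diag_blk mulmx_sumr -(sum_delta (fun k => A *m (J k) ^t*) k).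
by apply: eq_bigr => i _; rewrite -mulmxA mulmxA JJ mul_scalar_mx.
Qed.

Lemma diag_blk_J A k : diag_blk A *m J k = J k *m A.
Proof.
rewrite /diag_blk mulmx_suml -(sum_pick (fun k => J k *m A) k).
by apply: eq_bigr => i _; rewrite -mulmxA JJ mul_mx_scalar.
Qed.

Lemma diag_blkM A B : diag_blk A *m diag_blk B = diag_blk (A *m B).
Proof.
rewrite {1 3}/diag_blk mulmx_suml; apply: eq_bigr => i _.
by rewrite -mulmxA J_diag_blk !mulmxA.
Qed.

Lemma diag_blk_scalar c : diag_blk c%:M = c%:M.
Proof.
rewrite /diag_blk -[RHS]mulmx1 mul_scalar_mx -JJ1 scaler_sumr.
by apply: eq_bigr => i _; rewrite mul_mx_scalar -scalemxAl.
Qed.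

Lemma diag_blk_sum I (r : seq I) P (A : I -> 'M[C]_N) :
  diag_blk (\sum_(i <- r | P i) A i) = \sum_(i <- r | P i) diag_blk (A i).
Proof.
rewrite /diag_blk exchange_big; apply: eq_bigr => i _.
by rewrite mulmx_sumr mulmx_suml.
Qed.

Lemma J_inj (x : 'cV[C]_L) : (forall k, (J k) ^t* *m x = 0) -> x = 0.
Proof.
move=> Jx; rewrite -[x]mul1mx -JJ1 mulmx_suml big1 // => i _.
by rewrite -mulmxA Jx mulmx0.
Qed.

Variable F : 'I_m -> 'I_m -> 'M[C]_N.

(** [J a *m (J b) ^t*] is 1 (x) e_ab. On the conjugate of C^m the matrix unit e_ab acts by - e_ba,
    whence the swapped indices and the sign in the second definition. *)
Definition tens_act a b : 'M[C]_L := diag_blk (F a b) + J a *m (J b) ^t*.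
Definition tens_conj_act a b : 'M[C]_L := diag_blk (F a b) - J b *m (J a) ^t*.

Lemma sum_JJ : \sum_a \sum_(b < m) J a *m (J a) ^t* = m%:R%:M.
Proof.
under eq_bigr do rewrite sumr_const card_ord.
by rewrite sumrMnl JJ1 -raddfMn.
Qed.

(** In the expanded square each of the two cross sums equals - M, and the square of the second
    factor sums to m, the Casimir eigenvalue of C^m. *)
Lemma casimir_tens c : casimir F = c%:M ->
  casimir tens_act = (c + m%:R)%:M - 2 *: blk (fun k l => - F l k).
Proof.
move=> FE; rewrite /casimir.
transitivity (\sum_a \sum_b (diag_blk (F a b *m F b a) +
    (J b *m F a b *m (J a) ^t* + J a *m F b a *m (J b) ^t*) + J a *m (J a) ^t*)).
  apply: eq_bigr => a _; apply: eq_bigr => b _.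
  rewrite /tens_act mulmxDl !mulmxDr diag_blkM -!addrA; congr (_ + _).
  rewrite [diag_blk _ *m _]mulmxA diag_blk_J; congr (_ + _).
  rewrite -[J a *m _ *m diag_blk _]mulmxA J_diag_blk mulmxA; congr (_ + _).
  by rewrite mulmxA -[J a *m _ *m J b]mulmxA JJ eqxx mulmx1.
under eq_bigr do rewrite !big_split /=.
rewrite !big_split /= sum_JJ.
have -> : \sum_a \sum_b diag_blk (F a b *m F b a) = c%:M.
  by under eq_bigr do rewrite -diag_blk_sum; rewrite -diag_blk_sum -/(casimir F) FE diag_blk_scalar.
have e1 : \sum_a \sum_b J a *m F b a *m (J b) ^t* = - blk (fun k l => - F l k).
  rewrite /blk -sumrN; apply: eq_bigr => a _; rewrite -sumrN; apply: eq_bigr => b _.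
  by rewrite mulmxN mulNmx opprK.
rewrite e1 exchange_big /= e1 raddfD /= scaler_nat mulr2n opprD.
by rewrite addrAC.
Qed.

Lemma casimir_tens_conj c : casimir F = c%:M ->
  casimir tens_conj_act = (c + m%:R)%:M - 2 *: blk F.
Proof.
move=> FE; rewrite /casimir.
transitivity (\sum_a \sum_b (diag_blk (F a b *m F b a) -
    (J a *m F a b *m (J b) ^t* + J b *m F b a *m (J a) ^t*) + J b *m (J b) ^t*)).
  apply: eq_bigr => a _; apply: eq_bigr => b _.
  rewrite /tens_conj_act mulmxBl !mulmxBr diag_blkM opprB opprD -!addrA; congr (_ + _).
  rewrite [diag_blk _ *m _]mulmxA diag_blk_J; congr (_ + _).
  rewrite addrC -[J b *m _ *m diag_blk _]mulmxA J_diag_blk mulmxA; congr (_ + _).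
  by rewrite mulmxA -[J b *m _ *m J a]mulmxA JJ eqxx mulmx1.
under eq_bigr do rewrite big_split /= sumrB big_split /=.
rewrite big_split /= sumrB big_split /= [X in _ + X]exchange_big /= sum_JJ.
have -> : \sum_a \sum_b diag_blk (F a b *m F b a) = c%:M.
  by under eq_bigr do rewrite -diag_blk_sum; rewrite -diag_blk_sum -/(casimir F) FE diag_blk_scalar.
have e2 : \sum_a \sum_b J b *m F b a *m (J a) ^t* = blk F by rewrite exchange_big.
by rewrite e2 -/(blk F) [(c + _)%:M]raddfD /= scaler_nat mulr2n addrAC.
Qed.

Hypothesis FP : gl_action F.
Variables (rho : 'I_m -> int) (v0 : 'cV[C]_N).
Hypothesis simV : simple F fullv.
Hypothesis hv0 : hwv F (fun j => (rho j)%:~R) v0.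

Let weightE (l : 'I_m -> C) v : hwv F l v -> forall j, l j = (rho j)%:~R.
Proof. by move=> hv j; apply: (hwv_unique FP simV) hv hv0 j; exact: memvf. Qed.

Let muE k j : (mu k j)%:~R = (k == j)%:R :> C.
Proof. by rewrite /mu eq_sym; case: (k == j). Qed.

Lemma J_tens_act a b i (x : 'cV[C]_L) :
  (J i) ^t* *m (tens_act a b *m x) =
  F a b *m ((J i) ^t* *m x) + (i == a)%:R *: ((J b) ^t* *m x).
Proof.
rewrite mulmxA /tens_act mulmxDr J_diag_blk mulmxDl -!mulmxA; congr (_ + _).
by rewrite mulmxA JJ mul_scalar_mx.
Qed.

Lemma J_tens_conj_act a b i (x : 'cV[C]_L) :
  (J i) ^t* *m (tens_conj_act a b *m x) =
  F a b *m ((J i) ^t* *m x) - (i == b)%:R *: ((J a) ^t* *m x).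
Proof.
rewrite mulmxA /tens_conj_act mulmxBr J_diag_blk mulmxBl -!mulmxA; congr (_ - _).
by rewrite mulmxA JJ mul_scalar_mx.
Qed.

Let count_lt d : (d <= m)%N -> \sum_(i < m) (i < d)%:R = d%:R :> C.
Proof.
move=> dm.
by rewrite -natr_sum -big_mkcond /= (big_ord_narrow dm) sum1_card card_ord.
Qed.

Let sum_rho k : \sum_(i < m) (i == k)%:R * (rho k)%:~R = (rho k)%:~R :> C.
Proof.
by rewrite (bigD1 k) //= eqxx mul1r big1 ?addr0 // => i /negbTE ->; rewrite mul0r.
Qed.

(* The last nonzero component of a highest weight vector of the tensor product
   is a highest weight vector of the first factor. *)
Lemma hwv_tens (l : 'I_m -> C) (x : 'cV[C]_L) : hwv tens_act l x -> exists k,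
  [/\ (J k) ^t* *m x != 0, forall j, l j = (rho j + mu k j)%:~R &
      (J k) ^t* *m (blk (fun k l => - F l k) *m x) =
      (w_plus rho k)%:~R *: ((J k) ^t* *m x)].
Proof.
move=> [x0 lx up]; pose c k := (J k) ^t* *m x.
have [i0 ci0] : exists i, c i != 0.
  apply: contrapT => nex; move/eqP: x0; apply; apply: J_inj => i.
  by apply: contrapT => /eqP ci; apply: nex; exists i.
case: (@arg_maxnP _ i0 (fun i => c i != 0) val ci0) => k ck kmax.
have c0 j : (k < j)%N -> c j = 0.
  move=> kj; apply: contrapT => /eqP /kmax; by rewrite /= leqNgt kj.
have hk : hwv F (fun j => l j - (k == j)%:R) (c k).
  split=> [//|j|a b ab].
    have := J_tens_act j j k x; rewrite lx -scalemxAr -/(c k) -/(c j).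
    have -> : (k == j)%:R *: c j = (k == j)%:R *: c k.
      by have [->|] := eqVneq k j; rewrite ?scale0r.
    by rewrite scalerBl => ->; rewrite addrK.
  (* Another component enters only for a = k, and it is [c b] with b > k, which vanishes by the
     choice of [k]. *)
  have := J_tens_act a b k x; rewrite (up _ _ ab) mulmx0 -/(c k) -/(c b).
  have [ka|_] := eqVneq k a; last by rewrite scale0r addr0.
  have cb : c b = 0 by apply: c0; rewrite ka.
  by rewrite cb scaler0 addr0.
have lE j : l j = (rho j + mu k j)%:~R.
  have := weightE hk j; rewrite intrD => <-.
  by rewrite muE subrK.
exists k; split=> //.
rewrite mulmxA J_blk mulmx_suml.
(* For j < k, component j of e_jk x = 0 reads F_jk c_j = - c_k, so each such j contributes 1. With
   [k] counted from 0 this gives k - rho k, the conformal weight. *)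
have Gl j : - F j k *m (J j) ^t* *m x =
    ((j < k)%:R - (j == k)%:R * (rho k)%:~R) *: c k.
  rewrite -mulmxA mulNmx -/(c j); have [jk|kj|/val_inj ->] := ltngtP j k.
  - have := J_tens_act j k j x; rewrite (up _ _ jk) mulmx0 eqxx scale1r -/(c j) -/(c k).
    move=> /eqP; rewrite eq_sym addrC addr_eq0 => /eqP <-.
    have /negbTE -> : j != k by apply: contraTneq jk => ->; rewrite ltnn.
    by rewrite mul0r subr0 scale1r.
  - rewrite (c0 _ kj) mulmx0 oppr0.
    have /negbTE -> : j != k by apply: contraTneq kj => ->; rewrite ltnn.
    by rewrite mul0r subr0 scale0r.
  have [_ -> _] := hk.
  by rewrite eqxx lE intrD muE eqxx addrK mul1r sub0r scaleNr.
under eq_bigr do rewrite Gl.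
rewrite -scaler_suml sumrB; congr (_ *: _).
rewrite sum_rho.
rewrite (count_lt (ltnW (ltn_ord k))).
rewrite /w_plus !rmorphD !rmorphN /= -pmulrn -natr1.
by rewrite rmorph1; ring.
Qed.

(** The j-th conjugate basis vector has weight - mu j, so raising operators now increase the
    component index, and the first nonzero component is the one that they annihilate. *)
Lemma hwv_tens_conj (l : 'I_m -> C) (x : 'cV[C]_L) : hwv tens_conj_act l x ->
  exists k,
  [/\ (J k) ^t* *m x != 0, forall j, l j = (rho j - mu k j)%:~R &
      (J k) ^t* *m (blk F *m x) = (w_minus rho k)%:~R *: ((J k) ^t* *m x)].
Proof.
move=> [x0 lx up]; pose c k := (J k) ^t* *m x.
have [i0 ci0] : exists i, c i != 0.
  apply: contrapT => nex; move/eqP: x0; apply; apply: J_inj => i.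
  by apply: contrapT => /eqP ci; apply: nex; exists i.
case: (@arg_minnP _ i0 (fun i => c i != 0) val ci0) => k ck kmin.
have c0 j : (j < k)%N -> c j = 0.
  move=> jk; apply: contrapT => /eqP /kmin; by rewrite /= leqNgt jk.
have hk : hwv F (fun j => l j + (k == j)%:R) (c k).
  split=> [//|j|a b ab].
    have := J_tens_conj_act j j k x; rewrite lx -scalemxAr -/(c k) -/(c j).
    have -> : (k == j)%:R *: c j = (k == j)%:R *: c k.
      by have [->|] := eqVneq k j; rewrite ?scale0r.
    by rewrite scalerDl => ->; rewrite subrK.
  have := J_tens_conj_act a b k x; rewrite (up _ _ ab) mulmx0 -/(c k) -/(c a).
  have [kb|_] := eqVneq k b; last by rewrite scale0r subr0.
  have ca : c a = 0 by apply: c0; rewrite kb.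
  by rewrite ca scaler0 subr0.
have lE j : l j = (rho j - mu k j)%:~R.
  by have := weightE hk j; rewrite intrB => <-; rewrite muE addrK.
exists k; split=> //.
rewrite mulmxA J_blk mulmx_suml.
(* For j > k, component j of e_kj x = 0 reads F_kj c_j = c_k. The m - k - 1 such indices are counted
   as the complement of j < k + 1. *)
have Gl j : F k j *m (J j) ^t* *m x =
    ((j == k)%:R * (rho k)%:~R + (1 - (j < k.+1)%:R)) *: c k.
  rewrite -mulmxA -/(c j) ltnS; have [jk|kj|/val_inj ->] := ltngtP j k.
  - rewrite (c0 _ jk) mulmx0.
    have /negbTE -> : j != k by apply: contraTneq jk => ->; rewrite ltnn.
    by rewrite mul0r subrr addr0 scale0r.
  - have := J_tens_conj_act k j j x; rewrite (up _ _ kj) mulmx0 eqxx scale1r -/(c j) -/(c k).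
    move=> /esym/eqP; rewrite subr_eq0 => /eqP ->.
    have /negbTE -> : j != k by apply: contraTneq kj => ->; rewrite ltnn.
    by rewrite mul0r subr0 add0r scale1r.
  have [_ -> _] := hk.
  by rewrite eqxx lE intrB muE eqxx subrK mul1r subrr addr0.
under eq_bigr do rewrite Gl.
rewrite -scaler_suml big_split /= sumrB; congr (_ *: _).
rewrite sum_rho (count_lt (ltn_ord k)) sumr_const card_ord.
by rewrite /w_minus !rmorphD !rmorphN /= -!pmulrn; ring.
Qed.

End Blocks.

(** * Evaluation of the enveloping algebra elements as entries of block powers *)

Section PathSums.
Variables (A : pzRingType) (m : nat) (E : 'I_m -> 'I_m -> A).

Definition path_sum p (k l : 'I_m) : A :=
  \sum_(t : p.-tuple 'I_m) \prod_(j < p.+1) E (vertex k t l j) (vertex k t l j.+1).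

Lemma path_sum0 k l : path_sum 0 k l = E k l.
Proof.
rewrite /path_sum (big_pred1 [tuple]) => [|t]; last first.
  by apply/esym/eqP/val_inj; case: t => [[]].
by rewrite big_ord_recl big_ord0 mulr1.
Qed.

(** The bound keeps the index inside the sequence, where the two default values [k] and [i] of [nth]
    agree in effect. *)
Lemma vertexS k i (t : seq 'I_m) l j : (j <= (size t).+1)%N ->
  vertex k (i :: t) l j.+1 = vertex i t l j.
Proof.
by move=> jt; rewrite /vertex /=; apply: set_nth_default; rewrite /= size_rcons ltnS.
Qed.

Lemma path_sumS p k l : path_sum p.+1 k l = \sum_i E k i * path_sum p i l.
Proof.
pose h (it : 'I_m * p.-tuple 'I_m) : p.+1.-tuple 'I_m := [tuple of it.1 :: it.2].
have hbij : bijective h.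
  exists (fun t : p.+1.-tuple 'I_m => (thead t, [tuple of behead t])).
    by move=> [i t]; congr pair; apply: val_inj.
  by move=> t; rewrite /h /= -tuple_eta.
rewrite {1}/path_sum (reindex h); last exact: onW_bij.
rewrite /= -(pair_bigA _ (fun i (t : p.-tuple 'I_m) => \prod_(j < p.+2)
  E (vertex k (i :: t) l j) (vertex k (i :: t) l j.+1))) /=.
apply: eq_bigr => i _; rewrite mulr_sumr; apply: eq_bigr => t _.
rewrite [LHS]big_ord_recl; congr (_ * _).
apply: eq_bigr => j _; have jp := ltn_ord j.
by rewrite lift0 !vertexS ?size_tuple // ltnW.
Qed.

End PathSums.

Section Evaluation.
Variables (K : fieldType) (m n : nat) (f : 'M[K]_m -> 'M[K]_n).
Hypothesis fD : forall X Y, f (X + Y) = f X + f Y.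
Hypothesis fZ : forall a X, f (a *: X) = a *: f X.
Hypothesis fL : forall X Y, f (X *m Y - Y *m X) = f X *m f Y - f Y *m f X.
Local Notation U := (ugl K m).

Lemma env_ext_scal a : env_ext f (ugl_scal m a) = a%:M.
Proof. by rewrite env_ext_pi. Qed.

Lemma env_ext_gen X : env_ext f (ugl_gen X) = f X.
Proof. by rewrite env_ext_pi. Qed.

Lemma env_extD (x y : U) : env_ext f (x + y) = env_ext f x + env_ext f y.
Proof.
elim/ugl_ind: x => x; elim/ugl_ind: y => y.
by rewrite -[_ + _]/(ugl_add _ _) ugl_addE !env_ext_pi.
Qed.

Lemma env_extM (x y : U) : env_ext f (x * y) = env_ext f x *m env_ext f y.
Proof.
elim/ugl_ind: x => x; elim/ugl_ind: y => y.
by rewrite -[_ * _]/(ugl_mul _ _) ugl_mulE !env_ext_pi.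
Qed.

Lemma env_ext0 : env_ext f (0 : U) = 0.
Proof. by rewrite -[0]/(ugl_scal m 0) env_ext_scal raddf0. Qed.

Lemma env_ext1 : env_ext f (1 : U) = 1%:M.
Proof. exact: env_ext_scal. Qed.

Lemma env_extN (x : U) : env_ext f (- x) = - env_ext f x.
Proof. by apply/eqP; rewrite -addr_eq0 -env_extD addNr env_ext0. Qed.

Lemma env_ext_sum I (r : seq I) P (F : I -> U) :
  env_ext f (\sum_(i <- r | P i) F i) = \sum_(i <- r | P i) env_ext f (F i).
Proof. exact: (big_morph _ env_extD env_ext0). Qed.

Lemma env_ext_nat (b : bool) : env_ext f (b%:R : U) = b%:R%:M.
Proof. by case: b; [exact: env_ext1|rewrite env_ext0 raddf0]. Qed.

End Evaluation.

Section EvaluationPow.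
Variables (C : numClosedFieldType) (m n : nat) (f : 'M[C]_m -> 'M[C]_n).
Hypothesis fD : forall X Y, f (X + Y) = f X + f Y.
Hypothesis fZ : forall a X, f (a *: X) = a *: f X.
Hypothesis fL : forall X Y, f (X *m Y - Y *m X) = f X *m f Y - f Y *m f X.

Let e k l : ugl C m := ugl_e C k l.
Let fe k l : env_ext f (e k l) = f (delta_mx k l).
Proof. exact: env_ext_gen. Qed.

Let blk_pow1 (G : 'I_m -> 'I_m -> 'M[C]_n) k l : blk_pow G 1 k l = G k l.
Proof.
rewrite /= (bigD1 l) //= eqxx mulmx1 big1 ?addr0 // => i /negbTE ->.
by rewrite raddf0 mulmx0.
Qed.

Lemma env_ext_e_pow q k l :
  env_ext f (e_pow C q k l) = blk_pow (fun k l => f (delta_mx k l)) q k l.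
Proof.
case: q => [|p]; first exact: env_ext_nat.
rewrite -[e_pow _ _ _ _]/(path_sum e p k l).
elim: p k => [|p IHp] k; first by rewrite path_sum0 blk_pow1 fe.
rewrite path_sumS env_ext_sum //=; apply: eq_bigr => i _.
by rewrite env_extM // fe IHp.
Qed.

(** Reversing every edge makes the sum a path sum for (k, l) |-> e_lk, and the global sign is
    distributed as one factor - 1 per edge. *)
Lemma env_ext_etilde_pow q k l :
  env_ext f (etilde_pow C q k l) = blk_pow (fun k l => - f (delta_mx l k)) q k l.
Proof.
case: q => [|p]; first exact: env_ext_nat.
rewrite -[etilde_pow _ _ _ _]/((-1) ^+ p.+1 * path_sum (fun k l => e l k) p k l).
elim: p k => [|p IHp] k.
  by rewrite path_sum0 blk_pow1 expr1 mulN1r env_extN // fe.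
rewrite path_sumS exprS mulN1r mulNr mulr_sumr env_extN // env_ext_sum // -sumrN.
rewrite [RHS]/=; apply: eq_bigr => i _.
have -> : (-1) ^+ p.+1 * (e i k * path_sum (fun k l => e l k) p i l) =
    e i k * ((-1) ^+ p.+1 * path_sum (fun k l => e l k) p i l).
  by rewrite !mulrA; congr (_ * _); rewrite (commr_sign (e i k)).
by rewrite env_extM // fe IHp mulNmx.
Qed.

End EvaluationPow.

(** * The block calculus realised by Kronecker products *)

Section Embedding.
Variables (C : numClosedFieldType) (N m : nat).
Local Close Scope complex_scope.

(** The matrix of phi |-> phi (x) eps_k in the Kronecker basis; it supplies the isometries [J] of
    the block calculus. *)
Definition emb (k : 'I_m) : 'M[C]_(N * m, N) :=
  \matrix_(x, b) (((mxtens_unindex x).1 == b) && ((mxtens_unindex x).2 == k))%:R.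

Lemma sum_mxtens (f : 'I_(N * m) -> C) :
  \sum_x f x = \sum_i \sum_j f (mxtens_index (i, j)).
Proof.
rewrite pair_bigA /= (reindex (@mxtens_index N m)) /=.
  by apply: eq_bigr => -[].
exists (@mxtens_unindex N m) => x _; [exact: mxtens_indexK|exact: mxtens_unindexK].
Qed.

Lemma emb_index k i j b : emb k (mxtens_index (i, j)) b = ((i == b) && (j == k))%:R.
Proof. by rewrite mxE mxtens_indexK. Qed.

Lemma sum_pickM n (f : 'I_n -> C) c : \sum_b (b == c)%:R * f b = f c.
Proof.
rewrite (bigD1 c) //= eqxx mul1r big1 ?addr0 // => b /negbTE ->.
by rewrite mul0r.
Qed.

Lemma emb_adj_mul i j : (emb i) ^t* *m emb j = (i == j)%:R%:M.
Proof.
apply/matrixP => b c; rewrite !mxE sum_mxtens.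
transitivity (\sum_p (p == b)%:R * \sum_q (q == i)%:R * ((p == c) && (q == j))%:R : C).
  apply: eq_bigr => p _; rewrite mulr_sumr; apply: eq_bigr => q _.
  rewrite 2!mxE !emb_index rmorph_nat mulrA; congr (_ * _).
  by rewrite -natrM mulnb.
under eq_bigr do rewrite sum_pickM; rewrite sum_pickM andbC.
by case: (i == j); case: (b == c).
Qed.

Lemma emb_sum : \sum_i emb i *m (emb i) ^t* = 1%:M.
Proof.
apply/matrixP => x y; rewrite summxE [RHS]mxE.
transitivity (\sum_k ((mxtens_unindex x).2 == k)%:R * \sum_b
   ((mxtens_unindex x).1 == b)%:R *
   (((mxtens_unindex y).1 == b) && ((mxtens_unindex y).2 == k))%:R : C).
  apply: eq_bigr => k _; rewrite mxE mulr_sumr; apply: eq_bigr => b _.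
  rewrite !mxE rmorph_nat mulrA; congr (_ * _).
  by rewrite -natrM mulnb andbC.
under eq_bigr do under eq_bigr do rewrite eq_sym.
under eq_bigr do rewrite sum_pickM eq_sym.
rewrite sum_pickM; congr (nat_of_bool _)%:R.
apply/andP/eqP => [[/eqP e1 /eqP e2]|->]; last by rewrite !eqxx.
rewrite -[x]mxtens_unindexK -[y]mxtens_unindexK; congr mxtens_index.
by rewrite [LHS]surjective_pairing [RHS]surjective_pairing e1 e2.
Qed.

Lemma tens_emb (A : 'M[C]_N) (B : 'M[C]_m) k :
  (A *t B) *m emb k = \sum_q B q k *: (emb q *m A).
Proof.
apply/matrixP => x b; rewrite summxE; case: (mxtens_indexP x) => i p.
rewrite mxE sum_mxtens.
transitivity (A i b * B p k).
  transitivity (\sum_j (j == b)%:R * \sum_l (l == k)%:R * (A i j * B p l) : C).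
    apply: eq_bigr => j _; rewrite mulr_sumr; apply: eq_bigr => l _.
    by rewrite tensmxE emb_index -mulnb natrM mulrC mulrA.
  by under eq_bigr do rewrite sum_pickM; rewrite sum_pickM.
transitivity (\sum_q (q == p)%:R * \sum_c (c == i)%:R * (B q k * A c b) : C); last first.
  apply: eq_bigr => q _; rewrite !mxE !mulr_sumr; apply: eq_bigr => c _.
  rewrite emb_index -mulnb natrM [c == i]eq_sym [q == p]eq_sym; ring.
by under eq_bigr do rewrite sum_pickM; rewrite sum_pickM mulrC.
Qed.

Lemma emb_ext (A B : 'M[C]_(N * m)) : (forall k, A *m emb k = B *m emb k) -> A = B.
Proof.
move=> AB; rewrite -[A]mulmx1 -[B]mulmx1 -emb_sum !mulmx_sumr.
by apply: eq_bigr => i _; rewrite !mulmxA AB.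
Qed.

Lemma tens_1 (A : 'M[C]_N) : A *t (1%:M : 'M[C]_m) = diag_blk emb A.
Proof.
apply: emb_ext => k; rewrite tens_emb (diag_blk_J emb_adj_mul).
rewrite (bigD1 k) //= mxE eqxx scale1r big1 ?addr0 // => q /negbTE qk.
by rewrite mxE qk scale0r.
Qed.

Lemma tens11 : (1%:M : 'M[C]_N) *t (1%:M : 'M[C]_m) = 1%:M.
Proof. by rewrite tens_1 (diag_blk_scalar emb_sum). Qed.

Lemma tens_delta a b : (1%:M : 'M[C]_N) *t delta_mx a b = emb a *m (emb b) ^t*.
Proof.
apply: emb_ext => k; rewrite tens_emb -mulmxA emb_adj_mul mul_mx_scalar.
rewrite (bigD1 a) //= mxE eqxx /= mulmx1 big1 ?addr0 => [|q /negbTE qa].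
  by rewrite eq_sym.
by rewrite mxE qa scale0r.
Qed.

Lemma tens_oppdelta a b :
  (1%:M : 'M[C]_N) *t (- (delta_mx a b)^T) = - (emb b *m (emb a) ^t*).
Proof.
rewrite trmx_delta -tens_delta.
by apply/matrixP => i j; rewrite !mxE mulrN.
Qed.

Lemma tens_adj p q r s (A : 'M[C]_(p, q)) (B : 'M[C]_(r, s)) :
  (A *t B) ^t* = A ^t* *t B ^t*.
Proof. by rewrite trmx_tens map_mxT. Qed.

Lemma tens_unitary (A : 'M[C]_N) (B : 'M[C]_m) :
  A \is unitarymx -> B \is unitarymx -> A *t B \is unitarymx.
Proof.
move=> /unitarymxP Au /unitarymxP Bu; apply/unitarymxP.
by rewrite tens_adj tensmx_mul Au Bu tens11.
Qed.

End Embedding.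

(** * Tensor product representations and their differentials *)

Section TensorRep.
Variables (R : realType) (m N : nat).
Local Notation C := (cplx R).
Local Notation exp := (@expmx R m : 'M[C]_m -> 'M[C]_m).

Lemma urep_of_unitary_rep (pr : 'M[C]_m -> 'M[C]_N) :
  @unitary_rep R m N pr -> urep pr.
Proof.
move=> [pr1 prM pru prc]; split=> // e e0.
have [d d0 dP] := within_continuous_nrm prc (unitary1 R m) e0.
by exists d => // g gu gd; rewrite -pr1; exact: dP.
Qed.

Variables (pr : 'M[C]_m -> 'M[C]_N) (s : 'M[C]_m -> 'M[C]_m).
Hypothesis prU : urep pr.
Hypothesis sU : urep s.

(** Covers [tens_rep] and [tens_conj_rep] at once, with [s] the natural representation or its
    conjugate. *)
Definition tensor g : 'M[C]_(N * m) := pr g *t s g.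

Lemma tensor_urep : urep tensor.
Proof.
split.
- by rewrite /tensor (urep1 prU) (urep1 sU) tens11.
- by move=> g h gu hu; rewrite /tensor (urepM prU gu hu) (urepM sU gu hu) tensmx_mul.
- by move=> g gu; exact: tens_unitary (urep_unitary prU gu) (urep_unitary sU gu).
move=> e e0.
have [K K0 KP] := urep_lipschitz prU; have [L L0 LP] := urep_lipschitz sU.
pose M := K * (m * m)%:R + nrm (1%:M : 'M[C]_N) * L.
have M0 : 0 <= M by rewrite addr_ge0 // mulr_ge0 // nrm_ge0.
have M1 : 0 < M + 1 by rewrite ltr_wpDl.
exists (e / (M + 1)) => [|g gu]; first by rewrite divr_gt0.
rewrite ltr_pdivlMr // => gd.
have -> : tensor g - 1%:M = (pr g - 1%:M) *t s g + 1%:M *t (s g - 1%:M).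
  rewrite -tens11 /tensor; apply/matrixP => i j; rewrite !mxE.
  by move: (pr g _ _) (s g _ _) (_ == _)%:R (_ == _)%:R => *; ring.
apply: le_lt_trans (nrmD _ _) _; rewrite !nrm_tens.
apply: le_lt_trans gd; rewrite mulrDr mulr1.
apply: (@le_trans _ _ (K * nrm (g - 1%:M) * (m * m)%:R + nrm (1%:M : 'M[C]_N) * (L * nrm (g - 1%:M)))).
  apply: lerD.
    apply: ler_pM (nrm_ge0 _) (nrm_ge0 _) (KP _ gu) _.
    exact: (nrm_unitary (urep_unitary sU gu)).
  by apply: ler_wpM2l; [exact: nrm_ge0|exact: LP].
have -> : K * nrm (g - 1%:M) * (m * m)%:R + nrm (1%:M : 'M[C]_N) * (L * nrm (g - 1%:M)) =
  nrm (g - 1%:M) * M by rewrite /M; ring.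
by rewrite lerDl nrm_ge0.
Qed.

(** Leibniz rule: pr (x) s is the product of the curves pr (x) 1 and 1 (x) s through the identity,
    whose first order terms add. *)
Lemma diff_tensor X : X ^t* = - X ->
  @diff_rep R m (N * m) tensor X =
  @diff_rep R m N pr X *t 1%:M + 1%:M *t @diff_rep R m m s X.
Proof.
move=> sX; apply: (diff_uniq tensor_urep sX).
have := jetM1 (f := fun t => pr (exp (t%:c *: X)) *t (1%:M : 'M[C]_m))
  (g := fun t => (1%:M : 'M[C]_N) *t s (exp (t%:c *: X))).
rewrite -(tens11 C N m) => j; apply: jet_ext (j _ _ _ _).
- by move=> t; rewrite tensmx_mul mul1mx mulmx1.
- exact: jet_tens1 (diff_jet prU sX).
- exact: jet_1tens (diff_jet sU sX).
Qed.

Lemma gl_tensor Z :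
  @gl_rep R m (N * m) tensor Z =
  @gl_rep R m N pr Z *t 1%:M + 1%:M *t @gl_rep R m m s Z.
Proof.
have [S [T [sS sT ZE ->]]] := gl_rep_cart tensor Z; rewrite ZE.
rewrite (gl_rep_skew pr sS sT) (gl_rep_skew s sS sT).
rewrite (diff_tensor sS) (diff_tensor sT).
move: (diff_rep pr S) (diff_rep pr T) (diff_rep s S) (diff_rep s T) => A B D E.
apply/matrixP => i j; rewrite !mxE.
by move: (ic R) (A _ _) (B _ _) (D _ _) (E _ _) (_ == _)%:R (_ == _)%:R => *; ring.
Qed.

End TensorRep.

Section StandardReps.
Variables (R : realType) (m : nat).
Local Notation C := (cplx R).
Local Notation exp := (@expmx R m : 'M[C]_m -> 'M[C]_m).

Definition std_rep (g : 'M[C]_m) := g.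
Definition conj_rep (g : 'M[C]_m) : 'M[C]_m := map_mx Num.conj g.

Lemma std_urep : urep std_rep.
Proof. by split=> // e e0; exists e. Qed.

Lemma conj_urep : urep conj_rep.
Proof.
have c1 : conj_rep 1%:M = 1%:M by exact: map_mx1.
split=> [//|g h _ _|g gu|e e0]; first exact: map_mxM.
  by rewrite /conj_rep conjC_unitary.
exists e => // g _; rewrite -[X in _ -> nrm (_ - X) < _]c1.
by rewrite /conj_rep -map_mxB nrm_conj.
Qed.

Lemma gl_std Z : @gl_rep R m m std_rep Z = Z.
Proof.
have [S [T [sS sT -> ->]]] := gl_rep_cart std_rep Z.
by rewrite (diff_uniq std_urep sS (expmx_jet sS)) (diff_uniq std_urep sT (expmx_jet sT)).
Qed.

(** On skew-hermitian matrices conjugation coincides with - X^T, and it is this expression that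
    extends complex linearly. *)
Lemma gl_conj Z : @gl_rep R m m conj_rep Z = - Z^T.
Proof.
have dX X : X ^t* = - X -> @diff_rep R m m conj_rep X = - X^T.
  move=> sX; apply: (diff_uniq conj_urep sX).
  have -> : - X^T = map_mx Num.conj X.
    by rewrite -linearN /= -sX map_trmx trmxK.
  have := jet_conj (expmx_jet sX); rewrite map_mx1; exact.
have [S [T [sS sT -> ->]]] := gl_rep_cart conj_rep Z.
by rewrite (dX _ sS) (dX _ sT) linearD linearZ /= opprD scalerN.
Qed.

End StandardReps.

(** * Isotypic components as eigenspaces *)

Section Bridge.
Variables (R : realType) (m N : nat).
Local Notation C := (cplx R).
Variable pr : 'M[C]_m -> 'M[C]_N.
Local Notation gl := (@gl_rep R m N pr : 'M[C]_m -> 'M[C]_N).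
Hypothesis prU : urep pr.

Definition act (a b : 'I_m) : 'M[C]_N := gl (delta_mx a b).

Lemma gl_repN Z : gl (- Z) = - gl Z.
Proof. by rewrite -scaleN1r (gl_repZ prU) scaleN1r. Qed.

Lemma gl_rep_act Z : gl Z = \sum_a \sum_b Z a b *: act a b.
Proof.
have gl0 : gl 0 = 0 by rewrite -(scale0r 0) (gl_repZ prU) scale0r.
have glsum I (r : seq I) (G : I -> 'M[C]_m) :
    gl (\sum_(i <- r) G i) = \sum_(i <- r) gl (G i).
  exact: (big_morph _ (gl_repD prU) gl0).
rewrite {1}(matrix_sum_delta Z) glsum; apply: eq_bigr => a _.
by rewrite glsum; apply: eq_bigr => b _; rewrite (gl_repZ prU).
Qed.

Lemma act_gl_action : gl_action act.
Proof.
split=> [a b|a b c d].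
  by rewrite /act -(gl_rep_adj prU) trmx_delta map_delta_mx.
rewrite /act -(gl_rep_bracket prU) !mul_delta_mx_cond.
have e (t : bool) (X : 'M[C]_m) : X *+ t = t%:R *: X by rewrite scaler_nat.
by rewrite !e (gl_repD prU) gl_repN !(gl_repZ prU).
Qed.

(** From group to algebra, (1 - P) pr(g) P = 0 is differentiated. Conversely P F_ab P = F_ab P
    together with its adjoint for F_ba shows that [P] commutes with the algebra, hence with the
    group by [gl_rep_comm]. *)
Lemma invariant_stable (W : {vspace 'cV[C]_N}) :
  @invariant_sub R m N pr W <-> stable act W.
Proof.
have [P [Padj PW PE]] := orth_projector W; split=> invW.
  move=> a b v vW.
  have PgP g : g \is unitarymx -> (1%:M - P) *m pr g *m P = 0.
    move=> gu; apply: colmx_ext => v'; rewrite mul0mx -!mulmxA mulmxBl mul1mx.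
    by rewrite (PE _ (invW _ _ gu (PW v'))) subrr.
  have := gl_rep_sub0 prU PgP (delta_mx a b).
  move=> /(congr1 (mulmx^~ v)); rewrite mul0mx -!mulmxA (PE _ vW) mulmxBl mul1mx.
  by move=> /eqP; rewrite subr_eq0 => /eqP e; rewrite /act e; exact: PW.
have PFP a b : P *m act a b *m P = act a b *m P.
  by apply: colmx_ext => v; rewrite -!mulmxA PE //; exact/invW/PW.
have comm a b : act a b *m P = P *m act a b.
  rewrite -PFP; have := congr1 (fun X => X ^t*) (PFP b a).
  by rewrite !adj_mul Padj !(act_adj act_gl_action) mulmxA.
have commZ Z : gl Z *m P = P *m gl Z.
  rewrite gl_rep_act mulmx_suml mulmx_sumr; apply: eq_bigr => a _.
  rewrite mulmx_suml mulmx_sumr; apply: eq_bigr => b _.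
  by rewrite -scalemxAl -scalemxAr comm.
move=> g v gu vW; rewrite -(PE _ vW) mulmxA (gl_rep_comm prU commZ gu) -mulmxA.
exact: PW.
Qed.

Lemma irreducible_simple (W : {vspace 'cV[C]_N}) :
  @irreducible_sub R m N pr W <-> simple act W.
Proof.
split=> -[W0 invW minW]; split=> //; try exact/invariant_stable.
- by move=> U /invariant_stable; exact: minW.
- by move=> U /invariant_stable; exact: minW.
Qed.

Lemma highest_weight_hwv (W : {vspace 'cV[C]_N}) (lam : 'I_m -> int) :
  @highest_weight R m N pr W lam <->
  exists v, v \in W /\ hwv act (fun j => (lam j)%:~R) v.
Proof.
split=> [[v [vW [v0 vl] up]]|[v [vW [v0 vl up]]]]; exists v.
  by split=> //; split=> //; exact/eqP.
by split=> //; split=> //; exact/eqP.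
Qed.

End Bridge.

Section Components.
Variables (R : realType) (m L : nat).
Local Notation C := (cplx R).
Variable tau : 'M[C]_m -> 'M[C]_L.
Hypothesis tauU : urep tau.
Variables (M : 'M[C]_L) (alpha : C) (lam : 'I_m -> 'I_m -> int) (w : 'I_m -> int).
Hypothesis Madj : M ^t* = M.
Hypothesis casM : casimir (act tau) = alpha%:M - 2 *: M.
Hypothesis hwM : forall l x, hwv (act tau) l x -> exists k,
  (forall j, l j = (lam k j)%:~R) /\
  (forall beta : C, M *m x = beta *: x -> beta = (w k)%:~R).
Hypothesis lam_inj : forall i k, lam i =1 lam k -> i = k.
Hypothesis w_inj : injective w.

Local Notation comp i := (@component R m L tau (lam i)).
Local Notation Pi i := (@orth_proj R L (comp i) : 'M[C]_L).
Let FP := act_gl_action tauU.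

Lemma component0 i : comp i 0.
Proof.
rewrite /component; case: ifP => // _.
by exists 0%N, (fun=> 0%VS); split; [case|rewrite mem0v].
Qed.

(** A weight that occurs is dominant, so [component] is in its isotypic branch, where [U] is simply
    one more summand. *)
Lemma componentD U l v : simple (act tau) U -> v \in U -> hwv (act tau) l v ->
  exists i, forall x y, x \in U -> comp i y -> comp i (x + y).
Proof.
move=> simU vU hv; have [k [lk _]] := hwM hv; exists k => x y xU.
have lamk : (fun j => (lam k j)%:~R) = l by apply/funext => j; rewrite lk.
have -> : comp k = @isotypic R m L tau (lam k).
  rewrite /component ifT //; apply/forallP => i; apply/forallP => j; apply/implyP => ij.
  by have := hwv_dominant FP hv ij; rewrite !lk ler_int.
move=> [s [W [WP yW]]].
exists s.+1, (fun j => if unlift ord0 j is Some j' then W j' else U); split.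
  move=> j; case: (unlift ord0 j) => [j'|]; first exact: WP.
  split; first exact/(irreducible_simple tauU).
  by apply/(highest_weight_hwv tau); exists v; rewrite lamk.
rewrite big_ord_recl unlift_none; apply: memv_add => //.
by under eq_bigr do rewrite liftK.
Qed.

(** On each summand [M] is the scalar (alpha - c) / 2. At a highest weight vector this scalar is
    some [w k], and comparing weights forces k = i. *)
Lemma component_eigen i x : comp i x -> M *m x = (w i)%:~R *: x.
Proof.
rewrite /component; case: ifP => [_|_ ->]; last by rewrite mulmx0 scaler0.
move=> [s [W [WP /memv_sumP[xs xsW ->]]]].
rewrite mulmx_sumr scaler_sumr; apply: eq_bigr => j _.
have [/(irreducible_simple tauU) simW /(highest_weight_hwv tau)[v [vW hv]]] := WP j.
have [c cW] := casimir_simple FP simW vW hv.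
have Mc y : y \in W j -> M *m y = (2^-1 * (alpha - c)) *: y.
  move=> /cW; rewrite casM mulmxBl mul_scalar_mx -scalemxAl => /eqP.
  rewrite subr_eq addrC -subr_eq -scalerBl => /eqP e.
  by rewrite -scalerA e scalerA mulVf ?scale1r // pnatr_eq0.
have [k [lk /(_ _ (Mc v vW)) ck]] := hwM hv.
have <- : k = i by apply: lam_inj => a; apply/esym/(@intr_inj C); rewrite -lk.
by rewrite -ck; apply: Mc; exact: xsW.
Qed.

Lemma component_decomposition x :
  exists y, (forall i, comp i (y i)) /\ x = \sum_i y i.
Proof.
apply: (isotypic_decomposition FP (comp := fun i => comp i) component0 componentD
  (W := fullv)) (memvf x).
by move=> *; exact: memvf.
Qed.

Lemma eigen_orth i j x y : i != j ->
  M *m x = (w i)%:~R *: x -> M *m y = (w j)%:~R *: y -> inner x y = 0.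
Proof.
move=> ij Mx My; have := inner_adj M x y; rewrite Madj Mx My innerZr innerZl.
rewrite rmorph_int => /eqP; rewrite -subr_eq0 -mulrBl mulf_eq0 -intrB intr_eq0 subr_eq0.
by move=> /orP[/eqP/w_inj ji|/eqP //]; rewrite ji eqxx in ij.
Qed.

(* The components are exactly the eigenspaces of [M]: they span and the [w i] are
   pairwise distinct.  Hence [orth_proj] is not the default value of [xget]. *)
Lemma component_projection i : exists P : 'M[C]_L,
  [/\ Pi i = P, P ^t* = P, P *m P = P &
      forall y, (forall j, comp j (y j)) -> P *m (\sum_j y j) = y i].
Proof.
have [||E EP] := @pred_vspace C _ (fun y : 'cV[C]_L => M *m y = (w i)%:~R *: y).
- by rewrite mulmx0 scaler0.
- move=> a x y Mx My; rewrite mulmxDr -scalemxAr Mx My scalerDr !scalerA.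
  by rewrite [a * _]mulrC.
have [P [Padj PE Pid]] := orth_projector E.
have PP : P *m P = P by apply: colmx_ext => v; rewrite -mulmxA Pid.
have Py y : (forall j, comp j (y j)) -> P *m (\sum_j y j) = y i.
  move=> yP; rewrite mulmx_sumr (bigD1 i) //= big1 => [|j ji].
    by rewrite addr0 Pid //; apply/EP/component_eigen.
  apply/eqP; rewrite -inner_eq0 inner_adj Padj mulmxA PP; apply/eqP.
  by apply: (eigen_orth (i := i) (j := j)) (component_eigen (yP j));
    [rewrite eq_sym|apply/EP].
have Pcomp v : comp i (P *m v).
  by have [y [yP ->]] := component_decomposition v; rewrite Py.
exists P; split=> //.
have PQ : [set Q : 'M[R[i]]_L | forall v, comp i (Q *m v) /\
    forall w, comp i w -> w ^t* *m (v - Q *m v) = 0]%classic P.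
  move=> v; split; first exact: Pcomp.
  move=> u /component_eigen /EP /Pid <-.
  by rewrite adj_mul Padj -mulmxA mulmxBr mulmxA PP subrr mulmx0.
apply: (xget_unique _ PQ) => Q QP; apply: colmx_ext => v.
have [Qv Qorth] := QP v; have [_ Porth] := PQ v.
have inn u : comp i u -> inner u (P *m v - Q *m v) = 0.
  move=> cu; have -> : P *m v - Q *m v = (v - Q *m v) - (v - P *m v).
    by rewrite opprB [RHS]addrC addrA subrK.
  by rewrite innerBr /inner (Qorth u cu) (Porth u cu) !mxE subrr.
(* Only P v and Q v are known to lie in the component, so the squared length of their difference is
   expanded on the left into two products that vanish separately. *)
apply/eqP; rewrite eq_sym -subr_eq0 -inner_eq0.
rewrite {1}/inner adjB mulmxBl mxE [X in _ + X]mxE.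
by rewrite -!/(inner _ _) (inn _ (Pcomp v)) (inn _ Qv) subrr.
Qed.

Lemma component_sum q : \sum_i (w i)%:~R ^+ q *: Pi i = M ^+ q.
Proof.
apply: colmx_ext => v; have [y [yP ->]] := component_decomposition v.
rewrite mulmx_suml mulmx_sumr; apply: eq_bigr => i _.
have [P [-> _ _ Py]] := component_projection i.
rewrite -scalemxAl (Py y yP).
(* At q = 0 the factor is 1 even when [w i] is 0, in accordance with the convention 0^0 = 1. *)
elim: q => [|q IHq]; first by rewrite !expr0 scale1r mul1mx.
rewrite !exprS -scalerA IHq -[M * _]/(M *m _) -mulmxA -IHq -scalemxAr.
by rewrite (component_eigen (yP i)) !scalerA mulrC.
Qed.

Lemma component_gram i : (Pi i) ^t* *m Pi i = Pi i.
Proof. by have [P [-> -> PP _]] := component_projection i. Qed.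

End Components.

(** * Clifford homomorphisms as blocks of projections, and the theorem *)

Section Clifford.
Variables (R : realType) (m N : nat).
Local Notation C := (cplx R).
Variables (pr : 'M[C]_m -> 'M[C]_N) (rho : 'I_m -> int).
Hypothesis prU : urep pr.
Hypothesis pr_irr : @irreducible_rep R m N pr.
Hypothesis rho_dom : dominant rho.
Hypothesis pr_hw : @highest_weight R m N pr fullv rho.
Local Notation J := (@emb C N m).
Local Notation F := (act pr).

Let FP := act_gl_action prU.
Let simV : simple F fullv.
Proof. exact/(irreducible_simple prU). Qed.

Let rho_le (i j : 'I_m) : (i <= j)%N -> rho j <= rho i.
Proof. by move=> ij; have /forallP/(_ i)/forallP/(_ j)/implyP := rho_dom; apply. Qed.

Let casF : exists c : C, casimir F = c%:M.
Proof.
have /highest_weight_hwv[v [vV hv]] := pr_hw.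
have [c cP] := casimir_simple FP simV vV hv; exists c.
by apply: colmx_ext => x; rewrite mul_scalar_mx cP ?memvf.
Qed.

Lemma mu_inj (i k : 'I_m) : mu i =1 mu k -> i = k.
Proof. by move/(_ i); rewrite /mu eqxx => /esym/eqP; rewrite pnatr_eq1 eqb1 => /eqP. Qed.

(** The index grows strictly while - rho grows weakly. For [w_minus] the same comparison gives
    strict decrease. *)
Lemma w_plus_inj : injective (w_plus rho).
Proof.
have mono (i j : 'I_m) : (i < j)%N -> w_plus rho i < w_plus rho j.
  move=> ij; have := rho_le (ltnW ij); rewrite /w_plus; lia.
move=> i j wij; apply: val_inj; case: (ltngtP i j) => // /mono; by rewrite wij ltxx.
Qed.

Lemma w_minus_inj : injective (w_minus rho).
Proof.
have mono (i j : 'I_m) : (i < j)%N -> w_minus rho j < w_minus rho i.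
  move=> ij; have := rho_le (ltnW ij); rewrite /w_minus; lia.
move=> i j wij; apply: val_inj; case: (ltngtP i j) => // /mono; by rewrite wij ltxx.
Qed.

(** Makes the composite of an adjoint Clifford homomorphism with another one the block J_k^* P J_l
    of the projection, once P^* P = P is known. *)
Lemma clifford_emb (P : 'M[C]_(N * m)) (k : 'I_m) :
  @clifford R m N P (eps R k) = P *m J k.
Proof.
apply/matrixP => x b; rewrite mxE.
have -> : @tens R m N (delta_mx b 0) (eps R k) = J k *m delta_mx b 0.
  rewrite -colE; apply/matrixP => y z; rewrite !mxE !ord1 /=.
  by rewrite !andbT -natrM mulnb.
by rewrite mulmxA -colE mxE.
Qed.

Lemma conj_eps (k : 'I_m) : conj_vec (eps R k) = eps R k.
Proof. exact: map_delta_mx. Qed.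

Lemma act_tensor : act (tensor pr (@std_rep R m)) = tens_act J F.
Proof.
apply/funext => a; apply/funext => b.
by rewrite /act (gl_tensor prU (std_urep R m)) gl_std tens_1 tens_delta.
Qed.

Lemma act_tensor_conj : act (tensor pr (@conj_rep R m)) = tens_conj_act J F.
Proof.
apply/funext => a; apply/funext => b.
by rewrite /act (gl_tensor prU (conj_urep R m)) gl_conj tens_1 tens_oppdelta.
Qed.

Let JJ := @emb_adj_mul C N m.
Let JJ1 := @emb_sum C N m.

Lemma plus_sum q (k l : 'I_m) :
  \sum_(i < m) (w_plus rho i)%:~R ^+ q *:
    ((p_plus pr rho i (eps R k)) ^t* *m p_plus pr rho i (eps R l)) =
  blk_pow (fun k l => - F l k) q k l.
Proof.
have /highest_weight_hwv[v0 [_ hv0]] := pr_hw.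
have [c cF] := casF.
pose M := blk J (fun k l => - F l k).
have Madj : M ^t* = M by apply: blk_adj => a b; rewrite adjN (act_adj FP).
have tU := tensor_urep prU (std_urep R m).
have casM : casimir (act (tensor pr (@std_rep R m))) = (c + m%:R)%:M - 2 *: M.
  by rewrite act_tensor (casimir_tens JJ JJ1 cF).
pose lam (i j : 'I_m) := rho j + mu i j.
have lam_inj i j : lam i =1 lam j -> i = j.
  by move=> e; apply: mu_inj => a; have := e a => /addrI.
have hwM (l' : 'I_m -> C) x : hwv (act (tensor pr (@std_rep R m))) l' x ->
    exists k, (forall j, l' j = (lam k j)%:~R) /\
      (forall beta : C, M *m x = beta *: x -> beta = (w_plus rho k)%:~R).
  rewrite act_tensor => /(hwv_tens JJ JJ1 FP simV hv0)[i [ix li Mi]].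
  (* The eigenvalue is read off in the one component where M x has been computed; that component is
     nonzero. *)
  exists i; split=> // beta Mx; move: Mi; rewrite -/M Mx -scalemxAr => /eqP.
  by rewrite -subr_eq0 -scalerBl scaler_eq0 (negbTE ix) orbF subr_eq0 => /eqP.
have sumE := component_sum tU Madj casM hwM lam_inj w_plus_inj q.
have gram := component_gram tU Madj casM hwM lam_inj w_plus_inj.
rewrite -(J_blk_J JJ (blk_pow _ _)) -(blk_exp JJ JJ1) -/M -sumE.
rewrite mulmx_sumr mulmx_suml; apply: eq_bigr => i _.
rewrite /p_plus !clifford_emb -scalemxAr -scalemxAl; congr (_ *: _).
by rewrite adj_mul -mulmxA [X in _ *m X]mulmxA gram !mulmxA.
Qed.

Lemma minus_sum q (k l : 'I_m) :
  \sum_(i < m) (w_minus rho i)%:~R ^+ q *: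
    ((p_minus pr rho i (conj_vec (eps R k))) ^t* *m
      p_minus pr rho i (conj_vec (eps R l))) =
  blk_pow F q k l.
Proof.
have /highest_weight_hwv[v0 [_ hv0]] := pr_hw.
have [c cF] := casF.
pose M := blk J F.
have Madj : M ^t* = M by apply: blk_adj => a b; exact: (act_adj FP).
have tU := tensor_urep prU (conj_urep R m).
have casM : casimir (act (tensor pr (@conj_rep R m))) = (c + m%:R)%:M - 2 *: M.
  by rewrite act_tensor_conj (casimir_tens_conj JJ JJ1 cF).
pose lam (i j : 'I_m) := rho j - mu i j.
have lam_inj i j : lam i =1 lam j -> i = j.
  by move=> e; apply: mu_inj => a; have := e a => /addrI/oppr_inj.
have hwM (l' : 'I_m -> C) x : hwv (act (tensor pr (@conj_rep R m))) l' x ->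
    exists k, (forall j, l' j = (lam k j)%:~R) /\
      (forall beta : C, M *m x = beta *: x -> beta = (w_minus rho k)%:~R).
  rewrite act_tensor_conj => /(hwv_tens_conj JJ JJ1 FP simV hv0)[i [ix li Mi]].
  exists i; split=> // beta Mx; move: Mi; rewrite -/M Mx -scalemxAr => /eqP.
  by rewrite -subr_eq0 -scalerBl scaler_eq0 (negbTE ix) orbF subr_eq0 => /eqP.
have sumE := component_sum tU Madj casM hwM lam_inj w_minus_inj q.
have gram := component_gram tU Madj casM hwM lam_inj w_minus_inj.
rewrite -(J_blk_J JJ (blk_pow _ _)) -(blk_exp JJ JJ1) -/M -sumE.
rewrite mulmx_sumr mulmx_suml; apply: eq_bigr => i _.
rewrite /p_minus !conj_eps !clifford_emb -scalemxAr -scalemxAl; congr (_ *: _).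
by rewrite adj_mul -mulmxA [X in _ *m X]mulmxA gram !mulmxA.
Qed.

End Clifford.

Theorem theorem4p5 (R : realType) (m n : nat) (m_ge1 : (1 <= m)%N)
    (pi_rho : 'M[R[i]]_m -> 'M[R[i]]_n) (rho : 'I_m -> int)
    (pi_unitary : unitary_rep pi_rho)
    (pi_irr : irreducible_rep pi_rho)
    (rho_dominant : dominant rho)
    (pi_hw : highest_weight pi_rho fullv rho) :
  (forall (q : nat) (k l : 'I_m),
     \sum_(i < m) (w_plus rho i)%:~R ^+ q *:
       ((p_plus pi_rho rho i (eps R k)) ^t* *m p_plus pi_rho rho i (eps R l))
       = ugl_rep pi_rho (etilde_pow R[i] q k l)
     /\
     \sum_(i < m) (w_minus rho i)%:~R ^+ q *:
       ((p_minus pi_rho rho i (conj_vec (eps R k))) ^t* *m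
         p_minus pi_rho rho i (conj_vec (eps R l)))
       = ugl_rep pi_rho (e_pow R[i] q k l))
  /\
  (forall q : nat,
     \sum_(i < m) \sum_(k < m) (w_plus rho i)%:~R ^+ q *:
       ((p_plus pi_rho rho i (eps R k)) ^t* *m p_plus pi_rho rho i (eps R k))
       = ugl_rep pi_rho (ctilde_pow R[i] m q)
     /\
     \sum_(i < m) \sum_(k < m) (w_minus rho i)%:~R ^+ q *:
       ((p_minus pi_rho rho i (conj_vec (eps R k))) ^t* *m
         p_minus pi_rho rho i (conj_vec (eps R k)))
       = ugl_rep pi_rho (c_pow R[i] m q)).
Proof.
have prU : urep (pi_rho : 'M[cplx R]_m -> 'M[cplx R]_n).
  exact: urep_of_unitary_rep.
have glD := gl_repD prU; have glZ := gl_repZ prU; have glL := gl_rep_bracket prU.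
have plus q k l := etrans (plus_sum prU pi_irr rho_dominant pi_hw q k l)
  (esym (env_ext_etilde_pow glD glZ glL q k l)).
have minus q k l := etrans (minus_sum prU pi_irr rho_dominant pi_hw q k l)
  (esym (env_ext_e_pow glD glZ glL q k l)).
split=> [q k l|q]; first by split; [exact: plus|exact: minus].
split; rewrite exchange_big /=.
  apply: etrans (esym (env_ext_sum glD glZ glL _ _ _)).
  by apply: eq_bigr => k _; exact: plus.
apply: etrans (esym (env_ext_sum glD glZ glL _ _ _)).
by apply: eq_bigr => k _; exact: minus.
Qed.
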